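(* Assume that $(\varphi,c)\in \operatorname{Aut}(\mathbb{P}^t)\times\mathbb{P}^t$ satisfies the critical density condition. Then $R=R(\varphi,c)$ is a connected $\mathbb{N}$-graded maximal order, finitely generated in degree $1$, for which $\chi_i$ fails for all $i\ge 2$.
   Context: Let $k$ be an algebraically closed field, $t\ge 2$ an integer, $U=k[x_0,\dots,x_t]$ the commutative polynomial ring with $\deg x_i=1$, and $\mathbb{P}^t=\operatorname{Proj}U$; ''point'' means closed point. Multiplication in $U$ is written $\circ$. For a point $d$ let $\mathfrak{m}_d\subseteq U$ be its homogeneous ideal. Given $\varphi\in\operatorname{Aut}(\mathbb{P}^t)$, let $\phi$ be a graded $k$-algebra automorphism of $U$ with $\mathfrak{m}_{\varphi(d)}=\phi^{-1}(\mathfrak{m}_d)$ for all points $d$ ($\phi$ is unique up to a nonzero scalar multiple, which does not affect the isomorphism class of the algebras below). The (left) Zhang twist $S=S(\varphi)$ is the graded $k$-algebra with the same underlying graded vector space as $U$ and multiplication $fg=\phi^n(f)\circ g$ for $f\in U_m$, $g\in U_n$. For a point $c$, $R(\varphi,c)$ is the $k$-subalgebra of $S(\varphi)$ generated by the codimension-one subspace $(\mathfrak{m}_c)_1=\{f\in U_1 : f(c)=0\}$ of $S_1=U_1$. Put $c_i=\varphi^{-i}(c)$ for $i\in\mathbb{Z}$. An infinite set $\mathcal{C}$ of closed points of a variety $X$ is critically dense in $X$ if every proper Zariski-closed subset of $X$ contains only finitely many points of $\mathcal{C}$. The critical density condition on $(\varphi,c)$: $c$ has infinite order under $\varphi$ (the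 $c_i$ are distinct) and $\{c_i\}_{i\in\mathbb{Z}}$ is critically dense in $\mathbb{P}^t$. (Under this condition $R(\varphi,c)$ is a noetherian domain.) A noetherian domain $A$ with Goldie quotient ring $Q$ is a maximal order (in $Q$) if, for any ring $T$ with $A\subseteq T\subseteq Q$ and nonzero $a,b\in A$ with $aTb\subseteq A$, one has $T=A$. For a connected ($A_0=k$) $\mathbb{N}$-graded algebra $A$, finitely generated in degree 1, let $A\text{-Gr}$ be the category of $\mathbb{Z}$-graded left $A$-modules with degree-preserving homomorphisms, $A\text{-gr}$ its full subcategory of noetherian objects, $M[n]$ the shift with $M[n]_m=M_{n+m}$, and $\underline{\operatorname{Ext}}^i_A(M,N)=\bigoplus_{n\in\mathbb{Z}}\operatorname{Ext}^i_{A\text{-Gr}}(M,N[n])$. Write $k=A/A_{\ge 1}$ as a left module. $A$ satisfies $\chi_i$ if $\dim_k\underline{\operatorname{Ext}}^j_A(k,M)<\infty$ for all $0\le j\le i$ and all $M\in A\text{-gr}$. *)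

(* Defs.v *)
From HB Require Import structures.
From mathcomp Require Import all_boot all_order all_algebra.
From mathcomp Require Import boolp classical_sets functions cardinality.
From mathcomp Require Import mpoly.

Set Implicit Arguments.
Unset Strict Implicit.
Unset Printing Implicit Defensive.

Import GRing.Theory.
Local Open Scope ring_scope.
Local Open Scope classical_set_scope.

(* [V] is the internal direct sum of the additive subgroups [D i], expressed by
   spanning and independence. *)
Definition is_grading (I : eqType) (V : zmodType) (D : I -> set V) : Prop :=
  [/\ forall i, D i 0 /\ (forall x y, D i x -> D i y -> D i (x - y)),
      forall v, exists s : seq V,
        (forall x, x \in s -> exists i, D i x) /\ v = \sum_(x <- s) x &
      forall (s : seq I) (x : I -> V), uniq s -> (forall i, D i (x i)) ->
        \sum_(i <- s) x i = 0 -> forall i, i \in s -> x i = 0].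

Section GradingTheory.
Variables (I : eqType) (V : zmodType) (D : I -> set V).
Hypothesis gD : is_grading D.

Lemma grading0 i : D i 0. Proof. by case: gD => /(_ i) []. Qed.

Lemma gradingB i x y : D i x -> D i y -> D i (x - y).
Proof. by case: gD => /(_ i) [_ h] _ _; apply: h. Qed.

Lemma gradingN i x : D i x -> D i (- x).
Proof. by move=> Dx; rewrite -sub0r; apply: gradingB => //; apply: grading0. Qed.

Lemma gradingD i x y : D i x -> D i y -> D i (x + y).
Proof. by move=> Dx Dy; rewrite -[y]opprK; apply/gradingB/gradingN. Qed.

(* Collecting the terms of equal degree in a sum of homogeneous elements. *)
Lemma grading_collect (P : pred I) (s : seq V) :
  (forall x, x \in s -> exists2 i, P i & D i x) ->
  exists (r : seq I) (y : I -> V),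
    [/\ uniq r, all P r, forall i, D i (y i) & \sum_(x <- s) x = \sum_(i <- r) y i].
Proof.
elim: s => [|x s IHs] hs.
  by exists [::], (fun=> 0); split=> // [i|]; [apply: grading0 | rewrite !big_nil].
have [|r [y [ur Pr Dy Es]]] := IHs.
  by move=> z zs; apply: hs; rewrite inE zs orbT.
have [i Pi Dx] := hs x (mem_head _ _); rewrite big_cons Es.
have Dy' j : D j (if j == i then x + y j else y j).
  by case: eqP => [->|_]; [apply: gradingD|apply: Dy].
have [ir|ir] := boolP (i \in r).
  exists r, (fun j => if j == i then x + y j else y j); split=> //.
  rewrite !(big_rem i ir) /= eqxx addrA; congr (_ + _).
  rewrite !big_seq; apply: eq_bigr => j; rewrite mem_rem_uniq // inE.
  by case/andP=> /negPf ->.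
exists (i :: r), (fun j => if j == i then x else y j); split.
- by rewrite /= ir ur.
- by rewrite /= Pi Pr.
- by move=> j; case: eqP => [->|_].
rewrite big_cons eqxx; congr (_ + _); rewrite !big_seq; apply: eq_bigr => j jr.
by case: eqP => // ji; rewrite -ji jr in ir.
Qed.

End GradingTheory.

Record grAlg (k : fieldType) := GrAlg {
  ga_alg :> algType k;
  ga_deg : nat -> set ga_alg;
  ga_grading : is_grading ga_deg;
  ga_scale : forall n (a : k) x, ga_deg n x -> ga_deg n (a *: x);
  ga_one : ga_deg 0%N 1;
  ga_mul : forall m n x y, ga_deg m x -> ga_deg n y -> ga_deg (m + n)%N (x * y)
}.

Definition is_subalg (k : fieldType) (A : algType k) (T : set A) : Prop :=
  [/\ T 1, forall (a : k) x y, T x -> T y -> T (a *: x + y) &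
      forall x y, T x -> T y -> T (x * y)].

Definition gen_subalg (k : fieldType) (A : algType k) (X : set A) : set A :=
  fun x => forall T : set A, is_subalg T -> X `<=` T -> T x.

Definition connected_gr (k : fieldType) (A : grAlg k) : Prop :=
  forall x : A, ga_deg 0%N x <-> exists a : k, x = a%:A.

Definition fin_gen_deg1 (k : fieldType) (A : grAlg k) : Prop :=
  exists s : seq A, (forall x, x \in s -> ga_deg 1%N x) /\
    (forall x : A, gen_subalg [set y | y \in s] x).

Section GenSubalg.
Variables (k : fieldType) (A : algType k) (X : set A).

Definition in_gen_subalg : {pred A} := fun x => `[< gen_subalg X x >].

Lemma gen_subalg_is_subalg : is_subalg (gen_subalg X).
Proof.
split=> [T [] //|a x y Gx Gy T hT XT|x y Gx Gy T hT XT]; case: (hT) => _ TL TM.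
  exact: TL (Gx T hT XT) (Gy T hT XT).
exact: TM (Gx T hT XT) (Gy T hT XT).
Qed.

Lemma in_gen_subalg_closed : GRing.subalg_closed in_gen_subalg.
Proof.
have [G1 GL GM] := gen_subalg_is_subalg.
split=> [|a x y /asboolP Gx /asboolP Gy|x y /asboolP Gx /asboolP Gy]; apply/asboolP.
- exact: G1.
- exact: GL.
- exact: GM.
Qed.

(* The generated subalgebra as a type, with its induced algebra structure. *)
Record subalg_of := SubalgOf { subalg_val : A; _ : subalg_val \in in_gen_subalg }.

HB.instance Definition _ := [isSub for subalg_val].
HB.instance Definition _ := [Choice of subalg_of by <:].
HB.instance Definition _ := GRing.SubChoice_isSubAlgebra.Build k A
  in_gen_subalg subalg_of in_gen_subalg_closed.

End GenSubalg.

Section GenGrAlg.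
Variables (k : fieldType) (A : grAlg k) (X : set A).
Hypothesis hX : forall x, X x -> exists n, ga_deg n x.

Local Notation G := (gen_subalg X).

Lemma gen_subalg_homog x : G x -> exists s : seq A,
  (forall y, y \in s -> exists n, ga_deg n y /\ G y) /\ x = \sum_(y <- s) y.
Proof.
have [G1 GL GM] := gen_subalg_is_subalg X.
move/(_ (fun x => exists s : seq A,
  (forall y, y \in s -> exists n, ga_deg n y /\ G y) /\ x = \sum_(y <- s) y)).
apply; first split.
- exists [:: 1]; rewrite big_seq1; split=> // y; rewrite inE => /eqP ->.
  by exists 0%N; split=> //; apply: ga_one.
- move=> a x1 x2 [s1 [h1 ->]] [s2 [h2 ->]]; exists ([seq a *: y | y <- s1] ++ s2).
  rewrite big_cat big_map scaler_sumr; split=> // y; rewrite mem_cat.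
  case/orP=> [/mapP[z /h1[n [Dz Gz]] ->]|/h2 //]; exists n; split.
    exact: ga_scale.
  rewrite -[_ *: _]addr0; apply: (GL) => //.
  by rewrite -[0](subrr 1) addrC -scaleN1r; apply: GL.
- move=> x1 x2 [s1 [h1 ->]] [s2 [h2 ->]].
  exists [seq y1 * y2 | y1 <- s1, y2 <- s2]; split.
    move=> _ /allpairsP[[y1 y2] /= [/h1[n1 [D1 ?]] /h2[n2 [D2 ?]] ->]].
    by exists (n1 + n2)%N; split; [apply: ga_mul | apply: GM].
  rewrite big_allpairs_dep mulr_suml; apply: eq_bigr => y1 _; exact: mulr_sumr.
move=> x1 Xx1; exists [:: x1]; rewrite big_seq1; split=> // y.
rewrite inE => /eqP ->; have [n Dn] := hX Xx1; exists n; split=> // T _; exact.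
Qed.

Definition gen_deg (n : nat) : set (subalg_of X) := [set x | ga_deg n (val x)].

Lemma gen_grading : is_grading gen_deg.
Proof.
have gA := ga_grading A; split.
- move=> i; split; first exact: (grading0 gA).
  by move=> x y Dx Dy; change (ga_deg i (val (x - y))); rewrite raddfB; exact: (gradingB gA Dx Dy).
- move=> v; have /asboolP Gv := valP v; have [s [hs vE]] := gen_subalg_homog Gv.
  exists (pmap insub s); split.
    move=> x; rewrite mem_pmap_sub => /hs[n [Dn _]]; exists n; exact: Dn.
  apply: val_inj; rewrite raddf_sum vE /=.
  transitivity (\sum_(y <- map val (pmap insub s : seq (subalg_of X))) y); last first.
    by rewrite big_map.
  rewrite pmap_filter; last exact: insubK.
  rewrite big_filter [LHS]big_seq_cond [RHS]big_seq_cond; apply: eq_bigl => y.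
  rewrite andbT; case ys: (y \in s) => //=.
  have [n [_ Gy]] := hs y ys; rewrite insubT //; exact/asboolP.
- move=> s x us Dx s0 i si; apply: val_inj.
  case: gA => _ _ /(_ s (fun i => val (x i)) us Dx); apply => //.
  by rewrite -raddf_sum s0.
Qed.

Definition gen_grAlg : grAlg k.
Proof.
refine (@GrAlg k (subalg_of X) gen_deg gen_grading _ _ _).
- move=> n a x; exact: ga_scale.
- exact: ga_one.
- move=> m n x y; exact: ga_mul.
Defined.

End GenGrAlg.

Definition is_domain (A : nzRingType) : Prop :=
  forall x y : A, x * y = 0 -> x = 0 \/ y = 0.

Definition left_ideal (A : nzRingType) (J : set A) : Prop :=
  [/\ J 0, forall x y, J x -> J y -> J (x - y) & forall a x, J x -> J (a * x)].

Definition right_ideal (A : nzRingType) (J : set A) : Prop :=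
  [/\ J 0, forall x y, J x -> J y -> J (x - y) & forall a x, J x -> J (x * a)].

Definition acc (T : Type) (P : set T -> Prop) : Prop :=
  forall J : nat -> set T, (forall n, P (J n)) ->
    (forall n, J n `<=` J n.+1) ->
    exists N, forall n, (N <= n)%N -> J n = J N.

Definition is_noetherian (A : nzRingType) : Prop :=
  acc (@left_ideal A) /\ acc (@right_ideal A).

Definition is_regular (A : nzRingType) (a : A) : Prop := GRing.lreg a /\ GRing.rreg a.

Definition invertible (Q : nzRingType) (q : Q) : Prop :=
  exists q', q * q' = 1 /\ q' * q = 1.

Definition is_goldie_quotient (A Q : nzRingType) (iota : {rmorphism A -> Q}) : Prop :=
  [/\ injective iota,
      forall a, is_regular a -> invertible (iota a),
      forall q, exists a s, is_regular s /\ iota s * q = iota a &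
      forall q, exists a s, is_regular s /\ q * iota s = iota a].

Definition is_subring (Q : nzRingType) (T : set Q) : Prop :=
  [/\ T 1, forall x y, T x -> T y -> T (x - y) & forall x y, T x -> T y -> T (x * y)].

Definition is_maximal_order_in (A Q : nzRingType) (iota : {rmorphism A -> Q}) : Prop :=
  forall T : set Q, is_subring T -> range iota `<=` T ->
    (exists a b : A, [/\ a != 0, b != 0 &
       forall x, T x -> range iota (iota a * x * iota b)]) ->
    T = range iota.

(* A noetherian domain has a Goldie quotient ring, and any two are isomorphic
   over the domain, so it does not matter which one is used. *)
Definition is_maximal_order (A : nzRingType) : Prop :=
  [/\ is_noetherian A, is_domain A &
      forall (Q : nzRingType) (iota : {rmorphism A -> Q}),
        is_goldie_quotient iota -> is_maximal_order_in iota].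

Record grMod (k : fieldType) (A : grAlg k) := GrMod {
  gm_mod :> lmodType A;
  gm_deg : int -> set gm_mod;
  gm_grading : is_grading gm_deg;
  gm_act : forall (n : nat) (m : int) (a : A) x,
    ga_deg n a -> gm_deg m x -> gm_deg (n%:Z + m) (a *: x)
}.

Definition is_grHom (k : fieldType) (A : grAlg k) (M N : grMod A) (f : M -> N) : Prop :=
  linear f /\ forall m x, gm_deg m x -> gm_deg m (f x).

Definition is_grSubmod (k : fieldType) (A : grAlg k) (M : grMod A) (N : set M) : Prop :=
  [/\ N 0, forall (a : A) x y, N x -> N y -> N (a *: x + y) &
      forall x, N x -> exists s : seq M,
        (forall y, y \in s -> N y /\ exists m, gm_deg m y) /\ x = \sum_(y <- s) y].

Definition is_grNoetherian (k : fieldType) (A : grAlg k) (M : grMod A) : Prop :=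
  acc (@is_grSubmod k A M).

Section Shift.
Variables (k : fieldType) (A : grAlg k) (M : grMod A) (n : int).

Definition shift_deg (m : int) : set M := gm_deg (n + m).

Lemma shift_grading : is_grading shift_deg.
Proof.
have [gB gS gI] := gm_grading M; split.
- by move=> i; apply: gB.
- move=> v; have [s [hs vE]] := gS v; exists s; split=> // x /hs[i Di].
  by exists (i - n); rewrite /shift_deg addrC subrK.
- move=> s x us Dx s0 i si.
  have := gI [seq n + j | j <- s] (fun j => x (j - n)).
  have addK j : n + j - n = j by rewrite addrC addKr.
  move=> /(_ _ _ _ (n + i)); rewrite addK; apply.
  + by rewrite map_inj_uniq // => j1 j2 /addrI.
  + by move=> j; have := Dx (j - n); rewrite /shift_deg addrC subrK.
  + by rewrite big_map -[RHS]s0; apply: eq_bigr => j _; rewrite addK.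
  + exact: map_f.
Qed.

Definition shift : grMod A.
Proof.
refine (@GrMod k A M shift_deg shift_grading _).
by move=> p m a x Da Dx; rewrite /shift_deg addrCA; apply: gm_act.
Defined.

End Shift.

Section TrivialModule.
Variables (k : fieldType) (A : grAlg k).

(* [A_{>= 1}] *)
Definition ga_ge1 : set A := [set v | exists s : seq A,
  (forall x, x \in s -> exists2 n, (0 < n)%N & ga_deg n x) /\ v = \sum_(x <- s) x].

Definition in_ge1 : {pred A} := fun v => `[< ga_ge1 v >].

Lemma in_ge1_mull a v : v \in in_ge1 -> a * v \in in_ge1.
Proof.
move=> /asboolP[s [hs ->]]; apply/asboolP.
have [_ /(_ a)[r [hr ->]] _] := ga_grading A.
exists [seq y1 * y2 | y1 <- r, y2 <- s]; split.
  move=> _ /allpairsP[[y1 y2] /= [/hr[n1 D1] /hs[n2 n20 D2] ->]].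
  by exists (n1 + n2)%N; [rewrite addn_gt0 n20 orbT | apply: ga_mul].
rewrite big_allpairs_dep mulr_suml; apply: eq_bigr => y1 _; exact: mulr_sumr.
Qed.

Lemma in_ge1_zmod : GRing.zmod_closed in_ge1.
Proof.
have gA := ga_grading A; split; first by apply/asboolP; exists [::]; rewrite big_nil.
move=> u v /asboolP[s [hs ->]] /asboolP[r [hr ->]]; apply/asboolP.
exists (s ++ [seq - y | y <- r]); split.
  move=> x; rewrite mem_cat => /orP[/hs //|/mapP[y /hr[n n0 Dy] ->]].
  by exists n => //; apply: (gradingN gA).
by rewrite big_cat big_map sumrN.
Qed.

HB.instance Definition _ := GRing.isZmodClosed.Build A in_ge1 in_ge1_zmod.

Definition triv : Type := Quotient.quot (in_ge1 : zmodClosed A).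
HB.instance Definition _ := GRing.Zmodule.on triv.

Definition triv_pi (a : A) : triv := (\pi_(Quotient.quot (in_ge1 : zmodClosed A)) a)%qT.

Lemma triv_pi_surj x : exists a, x = triv_pi a.
Proof. by exists (repr x); rewrite /triv_pi reprK. Qed.

Lemma triv_piE a b : (triv_pi a = triv_pi b) <-> a - b \in in_ge1.
Proof.
rewrite (Quotient.idealrBE (in_ge1 : zmodClosed A)); split; last exact: eqP.
by move=> h; apply/eqP.
Qed.

Lemma triv_piB : {morph triv_pi : a b / a - b}.
Proof. by move=> a b; rewrite /triv_pi raddfB. Qed.

Lemma triv_piD : {morph triv_pi : a b / a + b}.
Proof. by move=> a b; rewrite /triv_pi raddfD. Qed.

Definition triv_scale (a : A) (x : triv) : triv := triv_pi (a * repr x).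

Lemma triv_scale_pi a b : triv_scale a (triv_pi b) = triv_pi (a * b).
Proof.
rewrite /triv_scale; apply/triv_piE; rewrite -mulrBr; apply: in_ge1_mull.
by apply/triv_piE; rewrite /triv_pi reprK.
Qed.

Lemma triv_scaleA a b x : triv_scale a (triv_scale b x) = triv_scale (a * b) x.
Proof. by have [c ->] := triv_pi_surj x; rewrite !triv_scale_pi mulrA. Qed.

Lemma triv_scale1 : left_id 1 triv_scale.
Proof. by move=> x; have [c ->] := triv_pi_surj x; rewrite triv_scale_pi mul1r. Qed.

Lemma triv_scaleDr : right_distributive triv_scale +%R.
Proof.
move=> a x y; have [b ->] := triv_pi_surj x; have [c ->] := triv_pi_surj y.
by rewrite -triv_piD !triv_scale_pi mulrDr triv_piD.
Qed.

Lemma triv_scaleDl x : {morph triv_scale^~ x : a b / a + b}.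
Proof.
by move=> a b; have [c ->] := triv_pi_surj x; rewrite !triv_scale_pi mulrDl triv_piD.
Qed.

HB.instance Definition _ := GRing.Zmodule_isLmodule.Build A triv
  triv_scaleA triv_scale1 triv_scaleDr triv_scaleDl.

Definition triv_deg (m : int) : set triv :=
  [set x | exists n a, [/\ m = n%:Z, ga_deg n a & x = triv_pi a]] `|` [set 0].

Lemma triv_pi0E : triv_pi 0 = 0.
Proof. by rewrite /triv_pi raddf0. Qed.

Lemma triv_pi0 a : triv_pi a = 0 <-> a \in in_ge1.
Proof. by have := triv_piE a 0; rewrite triv_pi0E subr0. Qed.

Lemma ga_deg0_ge1 a : ga_deg 0%N a -> a \in in_ge1 -> a = 0.
Proof.
have gA := ga_grading A.
move=> Da /asboolP[s [hs aE]].
have [r [y [ur Pr Dy sE]]] := grading_collect gA (P := fun n => (0 < n)%N) hs.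
have r0 : 0%N \notin r by apply/negP => /(allP Pr).
case: gA => gB _ /(_ (0%N :: r) (fun n => if n == 0%N then - a else y n)) h.
apply/eqP; rewrite -oppr_eq0; apply/eqP; move: h => /(_ _ _ _ 0%N); apply.
- by rewrite /= r0.
- case=> [|n] //=; have [g0 gS] := gB 0%N.
  by rewrite -sub0r; apply: gS.
- rewrite big_cons /= aE sE addrC; apply/eqP; rewrite subr_eq0; apply/eqP.
  rewrite !big_seq; apply: eq_bigr => n nr; case: eqP => // n0.
  by rewrite n0 (negPf r0) in nr.
- exact: mem_head.
Qed.

Lemma triv_grading : is_grading triv_deg.
Proof.
have gA := ga_grading A; split.
- move=> m; split; first by right.
  move=> x y [[n [a [mn Da ->]]]|->] [[n' [b [mn' Db ->]]]|->].
  + left; exists n, (a - b); split=> //; last by rewrite triv_piB.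
    move: mn' Db; rewrite mn => -[<-] Db; exact: (gradingB gA).
  + by rewrite subr0; left; exists n, a.
  + rewrite sub0r; left; exists n', (- b); split=> //; first exact: (gradingN gA).
    by rewrite -[- b]sub0r triv_piB triv_pi0E sub0r.
  + by rewrite subr0; right.
- move=> v; have [a ->] := triv_pi_surj v.
  have [_ /(_ a)[s [hs ->]] _] := gA.
  exists [seq triv_pi x | x <- s]; split.
    move=> _ /mapP[x /hs[n Dn] ->]; exists n%:Z; left; by exists n, x.
  rewrite big_map; elim: s {hs} => [|x s IHs]; rewrite ?big_nil ?big_cons.
    exact: triv_pi0E.
  by rewrite triv_piD IHs.
- move=> s x us Dx s0.
  have xN0 i : i != 0 -> x i = 0.
    case: (Dx i) => [[n [a [-> Da ->]]] n0|//]; apply/triv_pi0/asboolP.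
    exists [:: a]; rewrite big_seq1; split=> // y; rewrite inE => /eqP ->.
    by exists n => //; rewrite lt0n.
  move=> i si; have [i0|/xN0 //] := eqVneq i 0; move: s0.
  by rewrite (big_rem i si) /= big_seq big1 ?addr0 // => j;
    rewrite mem_rem_uniq // inE => /andP[ji _]; apply: xN0; rewrite -i0.
Qed.

Definition triv_mod : grMod A.
Proof.
refine (@GrMod k A triv triv_deg triv_grading _).
move=> n m a x Da [[p [b [-> Db ->]]]|->].
  left; exists (n + p)%N, (a * b); split; rewrite ?PoszD //.
    exact: ga_mul.
  exact: triv_scale_pi.
by right; rewrite scaler0.
Defined.

End TrivialModule.

Definition is_grProjective (k : fieldType) (A : grAlg k) (P : grMod A) : Prop :=
  forall (M N : grMod A) (g : M -> N) (f : P -> N),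
    is_grHom g -> (forall y, exists x, g x = y) -> is_grHom f ->
    exists h : P -> M, is_grHom h /\ forall x, g (h x) = f x.

Record grResolution (k : fieldType) (A : grAlg k) (K : grMod A) := GrResolution {
  res_obj : nat -> grMod A;
  res_d : forall i, res_obj i.+1 -> res_obj i;
  res_aug : res_obj 0%N -> K;
  res_proj : forall i, is_grProjective (res_obj i);
  res_d_hom : forall i, is_grHom (@res_d i);
  res_aug_hom : is_grHom res_aug;
  res_aug_surj : forall y, exists x, res_aug x = y;
  res_exact0 : forall x, res_aug x = 0 <-> exists y, @res_d 0%N y = x;
  res_exact : forall i x, @res_d i x = 0 <-> exists y, @res_d i.+1 y = x
}.

Section Ext.
Variables (k : fieldType) (A : grAlg k) (K : grMod A) (P : grResolution K).

(* Ext^j_{A-Gr}(K, N) is the quotient of [cocycle j N] by [coboundary j N]. *)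
Definition cocycle (j : nat) (N : grMod A) : set (res_obj P j -> N) :=
  [set f | is_grHom f /\ forall x, f (res_d x) = 0].

Arguments cocycle : clear implicits.

Definition coboundary (j : nat) (N : grMod A) : set (res_obj P j -> N) :=
  match j with
  | 0%N => [set f | forall x, f x = 0]
  | i.+1 => [set f | exists g : res_obj P i -> N,
                       is_grHom g /\ forall x, f x = g (res_d x)]
  end.

Arguments coboundary : clear implicits.

(* The direct sums over n of the cocycles and of the coboundaries with values
   in N[n]: finitely supported families indexed by n. *)
Definition cocycle_sum (j : nat) (N : grMod A) : set (int -> res_obj P j -> N) :=
  [set z | finite_set [set n | z n <> 0] /\
           forall n, cocycle j (shift N n) (z n)].

Definition coboundary_sum (j : nat) (N : grMod A) : set (int -> res_obj P j -> N) :=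
  [set z | finite_set [set n | z n <> 0] /\
           forall n, coboundary j (shift N n) (z n)].

End Ext.

Arguments cocycle_sum {k A K} P j N.
Arguments coboundary_sum {k A K} P j N.

(* dim_k (Z / B) < oo, for k-subspaces B of Z of an A-module; k acts through
   the structure map of A. *)
Definition fin_dim_quot (k : fieldType) (A : grAlg k) (V : lmodType A)
    (Z B : set V) : Prop :=
  exists s : seq V, (forall x, x \in s -> Z x) /\
    forall z, Z z -> exists a : 'I_(size s) -> k,
      B (z - \sum_(i < size s) (a i)%:A *: s`_i).

(* [A / A_{>= 1}] is [triv_mod A]. Ext is computed from a projective resolution;
   up to isomorphism it does not depend on the choice of [P]. *)
Definition chi (k : fieldType) (A : grAlg k) (i : nat) : Prop :=
  forall (j : nat) (M : grMod A), (j <= i)%N -> is_grNoetherian M ->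
    forall P : grResolution (triv_mod A),
      fin_dim_quot (cocycle_sum P j M) (coboundary_sum P j M).

Record gr_aut (k : fieldType) (n : nat) := GrAut {
  gr_aut_fun :> {lrmorphism {mpoly k[n]} -> {mpoly k[n]}};
  gr_aut_bij : bijective gr_aut_fun;
  gr_aut_homog : forall d f, f \is d.-homog -> gr_aut_fun f \is d.-homog
}.

Section Twist.
Variables (k : fieldType) (n : nat) (phi : gr_aut k n).
Local Notation U := {mpoly k[n]}.

(* For [g] homogeneous of degree [d] this is [phi^d(f) * g]; it is extended
   linearly in [g]. *)
Definition twist_mul (f g : U) : U :=
  \sum_(d < msize g) iter d phi f * pihomog mdeg d g.

Lemma pihomog_geq d (g : U) : (msize g <= d)%N -> pihomog mdeg d g = 0.
Proof.
move=> gd; rewrite pihomogE big_seq_cond big_pred0 // => m.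
apply/negP => /andP[/msize_mdeg_lt mg /eqP md].
by rewrite -md leqNgt mg in gd.
Qed.

Lemma twist_mulE N f g : (msize g <= N)%N ->
  twist_mul f g = \sum_(d < N) iter d phi f * pihomog mdeg d g.
Proof.
move=> gN; rewrite /twist_mul.
rewrite (big_ord_widen N (fun d => iter d phi f * pihomog mdeg d g) gN).
rewrite big_mkcond; apply: eq_bigr => d _; case: ltnP => // gd.
by rewrite pihomog_geq // mulr0.
Qed.

Lemma iterZ d (a : k) : {morph iter d phi : f / a *: f}.
Proof. by elim: d => [//|d IHd] f /=; rewrite IHd linearZ. Qed.

Lemma iter_addr d : {morph iter d phi : f g / f + g}.
Proof. by elim: d => [//|d IHd] f g /=; rewrite IHd rmorphD. Qed.

Lemma iterM d : {morph iter d phi : f g / f * g}.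
Proof. by elim: d => [//|d IHd] f g /=; rewrite IHd rmorphM. Qed.

Lemma iter1 d : iter d phi 1 = 1.
Proof. by elim: d => [//|d IHd] /=; rewrite IHd rmorph1. Qed.

Lemma iter_homog d e f : f \is e.-homog -> iter d phi f \is e.-homog.
Proof. by move=> fe; elim: d => //= d; apply: gr_aut_homog. Qed.

Lemma twist_mul_homog f g d : g \is d.-homog -> twist_mul f g = iter d phi f * g.
Proof.
move=> gd; rewrite (@twist_mulE (maxn (msize g) d.+1)) ?leq_maxl //.
have dN : (d < maxn (msize g) d.+1)%N by rewrite leq_max leqnn orbT.
rewrite (bigD1 (Ordinal dN)) //= pihomog_dE // big1 ?addr0 // => e ed.
by rewrite (@pihomog_ne0 _ _ _ d) ?mulr0 // eq_sym; apply: contra_neq ed => ed'; apply: val_inj.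
Qed.

Lemma twist_mulDl : left_distributive twist_mul +%R.
Proof.
move=> f g h; rewrite /twist_mul -big_split; apply: eq_bigr => d _ /=.
by rewrite iter_addr mulrDl.
Qed.

Lemma twist_mulDr : right_distributive twist_mul +%R.
Proof.
move=> f g h; pose N := maxn (msize (g + h)) (maxn (msize g) (msize h)).
rewrite !(@twist_mulE N) ?leq_max ?leqnn ?orbT // -big_split.
by apply: eq_bigr => d _ /=; rewrite pihomogD mulrDr.
Qed.

Lemma twist_mul0 f : twist_mul f 0 = 0.
Proof. by rewrite /twist_mul msize0 big_ord0. Qed.

Lemma twist_0mul f : twist_mul 0 f = 0.
Proof. by apply: (addrI (twist_mul 0 f)); rewrite -twist_mulDl !addr0. Qed.

Lemma twist_mul_suml J (r : seq J) (F : J -> U) g :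
  twist_mul (\sum_(j <- r) F j) g = \sum_(j <- r) twist_mul (F j) g.
Proof. by apply: (big_morph (twist_mul^~ g)) => [x y|]; rewrite ?twist_mulDl ?twist_0mul. Qed.

Lemma twist_mul_sumr J (r : seq J) (F : J -> U) f :
  twist_mul f (\sum_(j <- r) F j) = \sum_(j <- r) twist_mul f (F j).
Proof. by apply: (big_morph (twist_mul f)) => [x y|]; rewrite ?twist_mulDr ?twist_mul0. Qed.

Lemma twist_mul1 : right_id 1 twist_mul.
Proof. by move=> f; rewrite (twist_mul_homog f (dhomog1 _ _)) mulr1. Qed.

Lemma twist_1mul : left_id 1 twist_mul.
Proof.
move=> f; rewrite /twist_mul [RHS](pihomog_partitionE (leqnn (msize f))).
by apply: eq_bigr => d _; rewrite iter1 mul1r.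
Qed.

Lemma twist_mulA_homog f g h d e : g \is d.-homog -> h \is e.-homog ->
  twist_mul f (twist_mul g h) = twist_mul (twist_mul f g) h.
Proof.
move=> hg hh; rewrite !(twist_mul_homog _ hh) (twist_mul_homog _ hg).
rewrite (twist_mul_homog f (dhomogM (iter_homog e hg) hh)).
by rewrite iterM mulrA addnC iterD.
Qed.

Lemma twist_mulA : associative twist_mul.
Proof.
move=> f g h; rewrite [h](pihomog_partitionE (leqnn (msize h))).
elim/big_rec: _ => [|e h' _ IHh]; first by rewrite !twist_mul0.
rewrite !twist_mulDr IHh; congr (_ + _).
rewrite [g](pihomog_partitionE (leqnn (msize g))).
elim/big_rec: _ => [|d g' _ IHg]; first by rewrite twist_mul0 !twist_0mul twist_mul0.
rewrite twist_mulDl !twist_mulDr twist_mulDl IHg; congr (_ + _).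
exact: twist_mulA_homog (pihomogP _ _ _) (pihomogP _ _ _).
Qed.

Lemma twist_scaleAl (a : k) f g : a *: twist_mul f g = twist_mul (a *: f) g.
Proof.
rewrite /twist_mul scaler_sumr; apply: eq_bigr => d _.
by rewrite iterZ scalerAl.
Qed.

Lemma twist_scaleAr (a : k) f g : a *: twist_mul f g = twist_mul f (a *: g).
Proof.
rewrite [in RHS](@twist_mulE (maxn (msize g) (msize (a *: g)))) ?leq_maxr //.
rewrite (@twist_mulE (maxn (msize g) (msize (a *: g)))) ?leq_maxl //.
rewrite scaler_sumr; apply: eq_bigr => d _.
by rewrite linearZ /= scalerAr.
Qed.

(* The underlying graded vector space of [U], with the twisted product. *)
Definition zhang_twist : Type := U.

HB.instance Definition _ := GRing.Lmodule.copy zhang_twist U.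
HB.instance Definition _ := GRing.Zmodule_isNzRing.Build zhang_twist
  twist_mulA twist_1mul twist_mul1 twist_mulDl twist_mulDr (oner_neq0 U).
HB.instance Definition _ := GRing.Lmodule_isLalgebra.Build k zhang_twist twist_scaleAl.
HB.instance Definition _ := GRing.Lalgebra_isAlgebra.Build k zhang_twist twist_scaleAr.

Definition twist_deg (d : nat) : set zhang_twist := [set f | (f : U) \is d.-homog].

Lemma twist_grading : is_grading twist_deg.
Proof.
split.
- move=> d; split; first exact: (dhomog0 _ _ _).
  by move=> f g hf hg; apply: (@rpredB U).
- move=> f; exists [seq (pihomog mdeg d (f : U) : zhang_twist) |
                     d <- index_iota 0 (msize (f : U))].
  split; first by move=> _ /mapP[d _ ->]; exists d; apply: pihomogP.
  rewrite big_map big_mkord; exact: (pihomog_partitionE (leqnn (msize (f : U)))).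
- move=> s x us hx s0 d ds.
  have : pihomog mdeg d (\sum_(e <- s) (x e : U)) = 0 by rewrite [X in pihomog _ _ X]s0 raddf0.
  rewrite raddf_sum (big_rem d ds) /= pihomog_dE ?hx // big_seq big1 ?addr0 // => e.
  rewrite mem_rem_uniq // inE => /andP[ed _].
  by rewrite (pihomog_ne0 ed (hx e)).
Qed.

Definition twist_grAlg : grAlg k.
Proof.
refine (@GrAlg k zhang_twist twist_deg twist_grading _ _ _).
- by move=> d a f hf; apply: (@rpredZ k U).
- exact: dhomog1.
- move=> d e f g hf hg; rewrite /twist_deg /=.
  have -> : (f * g : zhang_twist) = iter e phi (f : U) * (g : U) :> U.
    exact: twist_mul_homog.
  by apply: dhomogM => //; apply: iter_homog.
Defined.

End Twist.

(* A closed point is a line through the origin. *)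
Definition pt (k : fieldType) (t : nat) : Type :=
  {L : {vspace 'rV[k]_t.+1} | \dim L == 1%N}.

Section Projective.
Variables (k : fieldType) (t : nat).
Local Notation P := (pt k t).
Local Notation U := {mpoly k[t.+1]}.

Definition vanishes (f : U) (d : P) : Prop :=
  forall v : 'rV[k]_t.+1, v \in sval d -> f.@[v 0] = 0.

(* [f] is in the ideal generated by the homogeneous polynomials vanishing at [d]
   iff all its homogeneous components vanish at [d]. *)
Definition pt_ideal (d : P) : set U :=
  [set f | forall e, vanishes (pihomog mdeg e f) d].

Definition zariski_closed (Z : set P) : Prop :=
  exists T : set U, (forall f, T f -> exists e, f \is e.-homog) /\
    Z = [set d | forall f, T f -> vanishes f d].

Definition critically_dense (C : set P) : Prop :=
  infinite_set C /\
  forall Z, zariski_closed Z -> Z <> setT -> finite_set (C `&` Z).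

(* Locally, q |-> [F_0(q) : ... : F_t(q)] for homogeneous F_i of equal degree
   without common zero. *)
Definition is_morphism (h : P -> P) : Prop :=
  forall p, exists (W : set P) (e : nat) (F : 'I_t.+1 -> U),
    [/\ zariski_closed (~` W), W p, forall i, F i \is e.-homog &
        forall q (v : 'rV[k]_t.+1), W q -> v \in sval q -> v != 0 ->
          let w := \row_i (F i).@[v 0] in w != 0 /\ w \in sval (h q)].

Record proj_aut := ProjAut {
  pa_fun :> P -> P;
  pa_inv : P -> P;
  pa_funK : cancel pa_fun pa_inv;
  pa_invK : cancel pa_inv pa_fun;
  pa_fun_morphism : is_morphism pa_fun;
  pa_inv_morphism : is_morphism pa_inv
}.

(* c_i = phi^{-i}(c) *)
Definition orbit_pt (phi : proj_aut) (c : P) (i : int) : P :=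
  match i with
  | Posz n => iter n (pa_inv phi) c
  | Negz n => iter n.+1 phi c
  end.

Definition critical_density_condition (phi : proj_aut) (c : P) : Prop :=
  injective (orbit_pt phi c) /\ critically_dense (range (orbit_pt phi c)).

Definition lifts (Phi : gr_aut k t.+1) (phi : proj_aut) : Prop :=
  forall d, pt_ideal (phi d) = Phi @^-1` pt_ideal d.

Section Ralg.
Variables (Phi : gr_aut k t.+1) (c : P).

Definition lin_forms_at : set (twist_grAlg Phi) :=
  [set f : twist_grAlg Phi | ga_deg 1%N f /\ vanishes (f : U) c].

Lemma lin_forms_at_homog f : lin_forms_at f -> exists n, ga_deg n f.
Proof. by case=> f1 _; exists 1%N. Qed.

Definition Ralg : grAlg k := gen_grAlg lin_forms_at_homog.

End Ralg.
End Projective.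

(* Main.v *)
From HB Require Import structures.
Require Import Defs.
From mathcomp Require Import all_boot all_order all_algebra.
From mathcomp Require Import boolp classical_sets functions cardinality.
From mathcomp Require Import mpoly freeg.
From mathcomp Require Import zify ring.

(** Write [U] for the polynomial ring, [Phi] for its automorphism, [S] for the twisted
    algebra and [R] for the subalgebra, and choose vectors [v_i] on the lines [c_i]
    such that [(Phi f)(v_(i+1)) = f(v_i)].

    Since the [c_i] are distinct, Koszul relations and interpolation show that
    the piece [R_n] consists of all forms of degree [n] that vanish at
    [c_0, ..., c_(n-1)] ([Rn_generated], which rests on [koszul_adjust]). Everything
    is deduced from this description. The opposite of [R] is of the same kind, for
    the inverse automorphism and the other half of the orbit ([opp_mapM]), so only
    left ideals have to be considered, and passing to leading forms reduces
    them to graded ones.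

    Noetherian property. Let [I] be a graded left ideal, and let [f_1, ..., f_r] in [I]
    generate the ideal of [U] generated by [I]. By critical density the [f_i] have no
    common zero among the [c_j] for large [j]. Hence an element of [I] of large degree
    [n] is [\sum_i u_i f_i] with [u_i] vanishing at [c_j] for [j0 <= j < n],
    where [j0] does not depend on [n]. It is in the left ideal generated by the [f_i] if
    the [u_i] vanish also at the finitely many remaining points, so that only
    a finite-dimensional space of values is left ([left_family_finitely_generated]).

    Maximal order. It is enough that a fraction [q] with [q I] contained in [I], for a
    nonzero left ideal [I], belongs to [R], and similarly on the right
    ([maximal_order_criterion]). In the graded case the divisorial hulls of the pieces
    [I_d] in [U] increase with [d], because the linear forms through a point have no
    common factor, so they become stationary. Multiplication by [q], moved by [Phi],
    preserves the last one, hence [q] is in [U], which is completely integrally closed.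
    Elements of [I] that do not vanish at distant points of the orbit, which
    exist by critical density, show that [q] is in [R] ([graded_fraction_in_Rn]).

    Failure of [chi_2]. For every [i] there is a nonzero class in degree [i] of
    [Ext^2(k, R)], so this space has infinite dimension. As a left module [S / R] is
    a sum of truncated point modules, one for each [c_i], and a tangent vector at [c_0]
    extends the one for [c_i] by one dimension in degree [i]. The class is the image
    of this extension under the connecting map to [Ext^2(k, R)]. It is written as
    a cocycle on a free resolution ([Theta_cocycle]), and a Koszul relation between two
    linear forms through [c_0] shows that it is not a coboundary
    ([Theta_not_coboundary]). *)

Set Implicit Arguments.
Unset Strict Implicit.
Unset Printing Implicit Defensive.

Import Order.TTheory GRing.Theory.
Local Open Scope ring_scope.
Local Open Scope classical_set_scope.

(** * Finite generation of polynomial ideals *)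

(** Each term is chosen to be minimal among the values that remain. *)
Lemma nondecreasing_subsequence (f : nat -> nat) :
  exists2 s : nat -> nat, {homo s : i j / (i < j)%N} &
    {homo (f \o s) : i j / (i <= j)%N}.
Proof.
have next N : exists i, (N <= i)%N /\ forall j, (i <= j)%N -> (f i <= f j)%N.
  have ex : exists n, `[< exists2 i, (N <= i)%N & f i = n >].
    by exists (f N); apply/asboolP; exists N.
  case: (ex_minnP ex) => n /asboolP[i Ni <-] h; exists i; split=> // j ij.
  by apply: h; apply/asboolP; exists j => //; apply: leq_trans ij.
have [g hg] := choice next.
pose s := fix s i := if i is i'.+1 then g (s i').+1 else g 0%N.
have sS i : (s i < s i.+1)%N by have [] := hg (s i).+1.
have smono : {homo s : i j / (i < j)%N} := homo_ltn ltn_trans sS.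
exists s => // i j ij.
have smin l : (s i <= l)%N -> (f (s i) <= f l)%N.
  by case: i {ij} => [|i] /=; [case: (hg 0%N) | case: (hg (s i).+1)] => _; apply.
apply: smin => /=.
by move: ij; rewrite leq_eqVlt => /predU1P[->//|/smono/ltnW].
Qed.

Lemma monomial_nondecreasing_subsequence n (m : nat -> 'X_{1..n}) :
  exists2 s : nat -> nat, {homo s : i j / (i < j)%N} &
    forall i j, (i <= j)%N -> (m (s i) <= m (s j))%MM.
Proof.
suff [s sm hs] : exists2 s : nat -> nat, {homo s : i j / (i < j)%N} &
    forall c, c \in enum 'I_n -> {homo (fun i => m (s i) c) : i j / (i <= j)%N}.
  by exists s => // i j ij; apply/mnm_lepP => c; apply: hs; rewrite ?mem_enum.
elim: (enum 'I_n) => [|c r [s sm hs]]; first by exists id.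
have [s' sm' hs'] := nondecreasing_subsequence (fun i => m (s i) c).
exists (s \o s') => [i j ij|d]; first by apply: sm; apply: sm'.
rewrite inE => /predU1P[->//|dr] i j ij; apply: hs => //.
by move: ij; rewrite leq_eqVlt => /predU1P[->//|/sm'/ltnW].
Qed.

(** Dickson's lemma: otherwise one could choose a sequence of elements of [M]
    none of which is above an earlier one. *)
Lemma dickson n (M : set 'X_{1..n}) :
  exists2 s : seq 'X_{1..n}, (forall m, m \in s -> M m) &
    forall m, M m -> exists2 m', m' \in s & (m' <= m)%MM.
Proof.
apply: contrapT => nD.
have next (s : seq 'X_{1..n}) : exists m, (forall m', m' \in s -> M m') ->
    M m /\ forall m', m' \in s -> ~ (m' <= m)%MM.
  have [sM|nsM] := pselect (forall m', m' \in s -> M m'); last by exists 0%MM.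
  apply: contrapT => nm; apply: nD; exists s => // m Mm.
  apply: contrapT => h; apply: nm; exists m => _; split=> // m' m's le.
  by apply: h; exists m'.
have [g hg] := choice next.
pose S := fix S i := if i is i'.+1 then g (S i') :: S i' else [::].
have SM i : forall m', m' \in S i -> M m'.
  elim: i => //= i IH m'; rewrite inE => /predU1P[->|/IH//].
  by have [] := hg _ IH.
have inS i j : (i < j)%N -> g (S i) \in S j.
  elim: j => // j IH; rewrite ltnS leq_eqVlt inE => /predU1P[->|/IH->].
    by rewrite eqxx.
  by rewrite orbT.
have [s sm hs] := monomial_nondecreasing_subsequence (fun i => g (S i)).
have [_ /(_ (g (S (s 0%N))))] := hg _ (SM (s 1%N)).
by case; [apply: inS; apply: sm | apply: hs].
Qed.

Section Ideals.
Variables (k : fieldType) (n : nat).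
Local Notation U := {mpoly k[n]}.
Implicit Types (f g a b : U) (s : seq U).

Definition is_ideal (J : set U) : Prop :=
  [/\ J 0, forall f g, J f -> J g -> J (f + g) & forall f g, J g -> J (f * g)].

Definition ideal_gen (X : set U) : set U :=
  fun f => forall J, is_ideal J -> X `<=` J -> J f.

Lemma ideal_gen_is_ideal (X : set U) : is_ideal (ideal_gen X).
Proof.
split=> [J [] //|f g hf hg J hJ XJ|f g hg J hJ XJ]; case: (hJ) => _ JD JM.
  by apply: JD; [apply: hf|apply: hg].
by apply: JM; apply: hg.
Qed.

Lemma sub_ideal_gen (X : set U) : X `<=` ideal_gen X.
Proof. by move=> f Xf J _; apply. Qed.

Lemma ideal_gen_sub (X Y : set U) : X `<=` ideal_gen Y -> ideal_gen X `<=` ideal_gen Y.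
Proof. by move=> XY f /(_ _ (ideal_gen_is_ideal Y) XY). Qed.

Lemma idealB J f g : is_ideal J -> J f -> J g -> J (f - g).
Proof. by case=> _ JD JM Jf Jg; apply: JD => //; rewrite -mulN1r; apply: JM. Qed.

Lemma ideal_gen_seqP s f : ideal_gen [set x | x \in s] f ->
  exists u : nat -> U, f = \sum_(i < size s) u i * s`_i.
Proof.
move/(_ (fun f => exists u : nat -> U, f = \sum_(i < size s) u i * s`_i)).
apply=> [|x /= xs].
  split; first by exists (fun=> 0); rewrite big1 // => i _; rewrite mul0r.
    move=> g h [u ->] [w ->]; exists (fun i => u i + w i).
    by rewrite -big_split; apply: eq_bigr => i _; rewrite mulrDl.
  move=> g h [u ->]; exists (fun i => g * u i).
  by rewrite mulr_sumr; apply: eq_bigr => i _; rewrite mulrA.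
exists (fun i => (i == index x s)%:R).
rewrite -index_mem in xs; rewrite (bigD1 (Ordinal xs)) //= eqxx mul1r.
rewrite nth_index ?big1 ?addr0 -?index_mem // => i /negPf ni.
by move: ni; rewrite -val_eqE /= => ->; rewrite mul0r.
Qed.

Lemma mlead_cancel f g : f != 0 -> f != g -> mlead f = mlead g ->
  mleadc f = mleadc g -> (mlead (f - g) < mlead f)%O.
Proof.
move=> f0 fg e c; have le : (mlead (f - g) <= mlead f)%O.
  by rewrite -[X in (_ <= X)%O]joinxx {2}e mleadB_le.
rewrite lt_neqAle le andbT; apply: contraNneq fg => e'.
by rewrite -subr_eq0 -mleadc_eq0 mcoeffB e' c -e subrr.
Qed.

(** Hilbert's basis theorem, with the generators in a prescribed generating set:
    elements whose leading monomials generate those of the ideal generate it. *)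
Lemma hilbert_basis (X : set U) : exists2 s : seq U,
  (forall x, x \in s -> X x) & X `<=` ideal_gen [set x | x \in s].
Proof.
pose fin f := exists2 s : seq U, (forall x, x \in s -> X x) & ideal_gen [set x | x \in s] f.
have [ms hms msM] := dickson [set m | exists f, [/\ ideal_gen X f, f != 0 & mlead f = m]].
have fingen f : ideal_gen X f -> fin f.
  move/(_ fin); apply=> [|x Xx]; last first.
    exists [:: x] => [y|]; first by rewrite inE => /eqP->.
    by apply: sub_ideal_gen; rewrite /= inE.
  have finS s1 s2 : ideal_gen [set x | x \in s1] `<=` ideal_gen [set x | x \in s1 ++ s2].
    by apply: ideal_gen_sub => x xs; apply: sub_ideal_gen; rewrite /= mem_cat xs.
  have finS' s1 s2 : ideal_gen [set x | x \in s2] `<=` ideal_gen [set x | x \in s1 ++ s2].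
    by apply: ideal_gen_sub => x xs; apply: sub_ideal_gen; rewrite /= mem_cat xs orbT.
  split; first by exists [::] => //; case: (ideal_gen_is_ideal [set x | x \in [::]]).
    move=> g h [s1 X1 h1] [s2 X2 h2]; exists (s1 ++ s2).
      by move=> x; rewrite mem_cat => /orP[/X1|/X2].
    case: (ideal_gen_is_ideal [set x | x \in s1 ++ s2]) => _ ID _.
    by apply: ID; [apply: finS|apply: finS'].
  move=> g h [s1 X1 h1]; exists s1 => //.
  by case: (ideal_gen_is_ideal [set x | x \in s1]) => _ _; apply.
have [s sX hs] : exists2 s : seq U, (forall x, x \in s -> X x) &
    forall m, m \in ms -> exists f, [/\ ideal_gen [set x | x \in s] f, f != 0 & mlead f = m].
  elim: ms hms {msM} => [|m ms IH] hms; first by exists [::].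
  have [s1 X1 h1] := IH (fun m' mm => hms m' (mem_behead (s := m :: ms) mm)).
  have [f [/fingen[s2 X2 h2] f0 fm]] := hms m (mem_head _ _).
  exists (s1 ++ s2) => [x|m']; first by rewrite mem_cat => /orP[/X1|/X2].
  rewrite inE => /predU1P[->|/h1[g [hg g0 gm]]].
    exists f; split=> //; apply: ideal_gen_sub h2 => x xs.
    by apply: sub_ideal_gen; rewrite /= mem_cat xs orbT.
  exists g; split=> //; apply: ideal_gen_sub hg => x xs.
  by apply: sub_ideal_gen; rewrite /= mem_cat xs.
exists s => // f /sub_ideal_gen.
have gX : ideal_gen [set x | x \in s] `<=` ideal_gen X.
  by apply: ideal_gen_sub => x xs; apply: sub_ideal_gen; apply: sX.
move: {2}(mlead f) (erefl (mlead f)) => l.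
elim/(well_founded_ind (@ltom_wf n)): l f => l IH f fl fX; rewrite -{}fl in IH.
have [->|f0] := eqVneq f 0; first by case: (ideal_gen_is_ideal [set x | x \in s]).
have [|m' /hs[g [gs g0 gm]] le] := msM (mlead f); first by exists f.
pose q := (mleadc f / mleadc g) *: 'X_[mlead f - m'] : U.
have gc : mleadc g != 0 by rewrite mleadc_eq0.
have fc : mleadc f != 0 by rewrite mleadc_eq0.
have c0 : mleadc f / mleadc g != 0 by rewrite mulf_neq0 ?invr_eq0.
have q0 : q != 0.
  by rewrite /q mscalerI (negPf c0) -msize_poly_eq0 msizeX.
have qg : mlead (q * g) = mlead f by rewrite mleadM // mleadZ // mleadXm gm submK.
have [-> //|nfq] := eqVneq f (q * g).
  by case: (ideal_gen_is_ideal [set x | x \in s]) => _ _; apply.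
have lt : (mlead (f - q * g) < mlead f)%O.
  apply: mlead_cancel => //.
  rewrite mleadM // mleadcM mleadcZE mleadXm.
  by rewrite mcoeffX eqxx mulr1 divfK.
have [_ ID IM] := ideal_gen_is_ideal [set x | x \in s].
rewrite -[f](subrK (q * g)); apply: (ID); last exact: IM.
apply: (IH _ lt (f - q * g)) => //.
apply: (idealB (ideal_gen_is_ideal X) fX).
by case: (ideal_gen_is_ideal X) => _ _ IM'; apply: (IM'); apply: gX.
Qed.

(** Applied to the union of the chain. *)
Lemma ideal_chain_stable (J : nat -> set U) : (forall i, is_ideal (J i)) ->
  (forall i, J i `<=` J i.+1) -> exists N, forall i, (N <= i)%N -> J i `<=` J N.
Proof.
move=> hJ JS.
have Jle i j : (i <= j)%N -> J i `<=` J j.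
  elim: j => [|j IH]; first by rewrite leqn0 => /eqP->.
  rewrite leq_eqVlt => /predU1P[->//|/IH ij]; exact: subset_trans ij (JS j).
have [s sJ hs] := hilbert_basis [set f | exists i, J i f].
have [N hN] : exists N, forall x, x \in s -> J N x.
  elim: s sJ {hs} => [|x s IH] sJ; first by exists 0%N.
  have [N hN] := IH (fun y ys => sJ y (mem_behead (s := x :: s) ys)).
  have [M hM] := sJ x (mem_head _ _); exists (maxn N M) => y.
  rewrite inE => /predU1P[->|/hN]; first by apply: Jle hM; apply: leq_maxr.
  exact: Jle (leq_maxl _ _) _.
exists N => i Ni f Jf; have /hs/(_ (J N) (hJ N) hN) : (exists i, J i f) by exists i.
by [].
Qed.

(** * Divisibility of polynomials *)

Definition mdvd b a : Prop := exists h, a = b * h.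

Lemma mdvd_mull b a c : mdvd b a -> mdvd b (c * a).
Proof. by move=> [h ->]; exists (c * h); rewrite mulrCA. Qed.

(** Polynomial rings are completely integrally closed: if all the powers of the
    fraction [a / b] have the common denominator [u], then comparing exponents
    shows that the leading monomial of [b] divides that of [a], so that the leading
    term of [a] can be removed. *)
Lemma completely_integrally_closed a b u : b != 0 -> u != 0 ->
  (forall d, mdvd (b ^+ d) (a ^+ d * u)) -> mdvd b a.
Proof.
move=> b0 u0; move: {2}(mlead a) (erefl (mlead a)) => l.
elim/(well_founded_ind (@ltom_wf n)): l a => l IH a al hab; rewrite -{}al in IH.
have [->|a0] := eqVneq a 0; first by exists 0; rewrite mulr0.
have le : (mlead b <= mlead a)%MM.
  apply/mnm_lepP => c; rewrite leqNgt; apply/negP => lt.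
  have [h e] := hab (mlead u c).+1.
  have h0 : h != 0.
    apply: contra_neq u0 => h0; apply/eqP; move/eqP: e.
    by rewrite h0 mulr0 mulf_eq0 expf_eq0 (negPf a0).
  have: (mlead (a ^+ (mlead u c).+1 * u)) c = (mlead (b ^+ (mlead u c).+1 * h)) c by rewrite e.
  rewrite !mleadM ?expf_neq0 // !mleadX // !mnmDE !mulmnE.
  by move: (mlead a c) (mlead b c) lt (mlead u c) (mlead h c) => x y lt z w; nia.
pose q := (mleadc a / mleadc b) *: 'X_[mlead a - mlead b] : U.
have bc : mleadc b != 0 by rewrite mleadc_eq0.
have ac : mleadc a != 0 by rewrite mleadc_eq0.
have c0 : mleadc a / mleadc b != 0 by rewrite mulf_neq0 ?invr_eq0.
have q0 : q != 0 by rewrite /q mscalerI (negPf c0) -msize_poly_eq0 msizeX.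
have qb : mlead (q * b) = mlead a by rewrite mleadM // mleadZ // mleadXm submK.
have [->|naq] := eqVneq a (q * b); first by exists q; rewrite mulrC.
have lt : (mlead (a - q * b) < mlead a)%O.
  apply: mlead_cancel => //.
  rewrite mleadM // mleadcM mleadcZE mleadXm.
  by rewrite mcoeffX eqxx mulr1 divfK.
rewrite -[a](subrK (q * b)); have [h ->] : mdvd b (a - q * b).
  apply: (IH _ lt (a - q * b)) => // d; rewrite exprBn_comm; last exact: mulrC.
  rewrite mulr_suml; elim/big_ind: _ => [|x y hx hy|i _].
  - by exists 0; rewrite mulr0.
  - by case: hx hy => [h ->] [h' ->]; exists (h + h'); rewrite mulrDr.
  have [h e] := hab (d - i)%N; exists ((-1) ^+ i * q ^+ i * h *+ 'C(d, i)).
  rewrite mulrnAl mulrnAr; congr (_ *+ _).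
  have -> : b ^+ d = b ^+ (d - i) * b ^+ i by rewrite -exprD subnK // -ltnS.
  rewrite exprMn; transitivity ((-1) ^+ i * (q ^+ i * b ^+ i) * (a ^+ (d - i) * u)); first by ring.
  by rewrite e; ring.
by exists (h + q); ring.
Qed.

End Ideals.

(** * Linear forms and points *)

Section Points.
Variables (k : fieldType) (n : nat).
Local Notation U := {mpoly k[n]}.
Local Notation point := ('I_n -> k).
Implicit Types (f g l : U) (p q : point).

(** Neither vector is a multiple of the other: the points [p] and [q] of the
    projective space are defined and distinct. *)
Definition nonprop p q : Prop := exists i j, p i * q j != p j * q i.

Lemma nonprop_neq0 p q : nonprop p q -> exists c, q c != 0.
Proof.
case=> i [j h]; have [qj|] := eqVneq (q j) 0; last by exists j.
by exists i; apply: contraNneq h => ->; rewrite qj !mulr0.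
Qed.

Lemma dhomogX1 i : ('X_i : U) \is 1.-homog.
Proof. by rewrite dhomogX /= mdeg1. Qed.

Lemma linform_sum l : l \is 1.-homog -> l = \sum_i l@_U_(i) *: 'X_i.
Proof.
move=> hl; apply/mpolyP => m; rewrite raddf_sum /=.
under eq_bigr do rewrite mcoeffZ mcoeffX.
have [/mdeg1P[i /eqP mi]|m1] := boolP (mdeg m == 1%N).
  rewrite mi (bigD1 i) //= eqxx mulr1 big1 ?addr0 // => j ji.
  by rewrite eq_mnm1 (negPf ji) mulr0.
rewrite (dhomog_nemf_coeff hl) // big1 // => i _.
by have [e|_] := eqVneq U_(i)%MM m; [rewrite -e mdeg1 in m1 | rewrite mulr0].
Qed.

Lemma homog_monomial d (P : U -> Prop) :
  P 0 -> (forall c f g, P f -> P g -> P (c *: f + g)) ->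
  (forall m, mdeg m = d -> P 'X_[m]) -> forall f, f \is d.-homog -> P f.
Proof.
move=> P0 PD PX f hf; rewrite [f]mpolyE big_seq.
apply: big_rec => // m g mf Pg; apply: PD => //; apply: PX.
exact: (dhomog_mf hf mf).
Qed.

(** The linear forms vanishing at [p] in a coordinate system that has [p] as a
    coordinate point, for an index [c] with [p c != 0]. *)
Definition pt_form p (c i : 'I_n) : U := 'X_i - (p i / p c) *: 'X_c.

Lemma pt_form_homog p c i : pt_form p c i \is 1.-homog.
Proof. by rewrite rpredB ?rpredZ ?dhomogX1. Qed.

Lemma pt_form_eval p c i : p c != 0 -> (pt_form p c i).@[p] = 0.
Proof. by move=> pc; rewrite mevalB mevalZ !mevalXU divfK ?subrr. Qed.

Lemma mdegS_split d (m : 'X_{1..n}) : mdeg m = d.+1 ->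
  exists i m', m = (U_(i) + m')%MM /\ mdeg m' = d.
Proof.
move=> md; have [i mi] : exists i, m i != 0%N.
  apply: contrapT => nm; have m0 : m = 0%MM.
    by apply/mnmP => j; rewrite mnm0E; apply: contrapT => mj; apply: nm; exists j; apply/eqP.
  by rewrite m0 mdeg0 in md.
have mE : m = (U_(i) + (m - U_(i)))%MM by rewrite addmC submK // lep1mP.
by exists i, (m - U_(i))%MM; split=> //; move: md; rewrite {1}mE mdegD mdeg1 => -[].
Qed.

Lemma pt_form_expand p c d f : f \is d.+1.-homog -> p c != 0 ->
  exists a (g : 'I_n -> U), (forall i, g i \is d.-homog) /\
    f = a *: 'X_c ^+ d.+1 + \sum_i pt_form p c i * g i.
Proof.
move=> hf pc; move: f hf; apply: homog_monomial.
- exists 0, (fun=> 0); split=> [i|]; first exact: rpred0.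
  by rewrite scale0r add0r big1 // => i _; rewrite mulr0.
- move=> x f g [a [u [hu ->]]] [b [w [hw ->]]].
  exists (x * a + b), (fun i => x *: u i + w i); split.
    by move=> i; rewrite rpredD ?rpredZ.
  rewrite scalerDl scalerDr scaler_sumr -scalerA addrACA -big_split.
  by congr (_ + _); apply: eq_bigr => i _ /=; rewrite mulrDr scalerAr.
have XE i : 'X_i = pt_form p c i + (p i / p c) *: 'X_c :> U by rewrite subrK.
elim: d => [|d IH] m /mdegS_split[i [m' [-> md]]]; rewrite mpolyXD {1}XE.
  move/eqP: md; rewrite mdeg_eq0 => /eqP->; rewrite mpolyX0 mulr1.
  exists (p i / p c), (fun j => (j == i)%:R); split=> [j|].
    by case: eqP; rewrite ?rpred0 // dhomog1.
  rewrite expr1 addrC; congr (_ + _); rewrite (bigD1 i) //= eqxx mulr1 big1 ?addr0 //.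
  by move=> j /negPf->; rewrite mulr0.
have [a [g [hg e]]] := IH m' md.
exists (p i / p c * a), (fun j => (if j == i then 'X_[m'] else 0) + (p i / p c) *: ('X_c * g j)).
split=> [j|].
  rewrite rpredD ?rpredZ //; first by case: ifP; rewrite ?rpred0 // dhomogX /= md.
  by rewrite -add1n; apply: dhomogM; [apply: dhomogX1|apply: hg].
rewrite mulrDl {2}e mulrDr addrC -addrA; congr (_ + _).
  by rewrite -scalerAl -scalerAr scalerA -exprS mulrC.
under [RHS]eq_bigr do rewrite mulrDr; rewrite big_split /= addrC; congr (_ + _).
  rewrite (bigD1 i) //= eqxx big1 ?addr0 // => j /negPf->.
  by rewrite mulr0.
rewrite mulr_sumr; apply: eq_bigr => j _; rewrite -scalerAl -scalerAr.
by congr (_ *: _); ring.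
Qed.

(** In [pt_form_expand] the coefficient of the power of ['X_c] is, up to a nonzero
    factor, the value at [p]. *)
Lemma pt_form_span p c d f : f \is d.+1.-homog -> p c != 0 -> f.@[p] = 0 ->
  exists2 g : 'I_n -> U, forall i, g i \is d.-homog & f = \sum_i pt_form p c i * g i.
Proof.
move=> hf pc f0; have [a [g [hg e]]] := pt_form_expand hf pc; exists g => //.
move: f0; rewrite {1}e mevalD mevalZ rmorphXn /= mevalXU raddf_sum big1 ?addr0 => [/eqP|i _].
  by rewrite mulf_eq0 expf_eq0 (negPf pc) orbF => /eqP a0; rewrite e a0 scale0r add0r.
by rewrite /= mevalM pt_form_eval ?mul0r.
Qed.

Lemma separating_linform p q : nonprop p q ->
  exists l, [/\ l \is 1.-homog, l.@[p] = 0 & l.@[q] != 0].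
Proof.
case=> i [j h]; exists (p i *: 'X_j - p j *: 'X_i).
rewrite rpredB ?rpredZ ?dhomogX1 // !mevalB !mevalZ !mevalXU subr_eq0 mulrC subrr.
by split.
Qed.

Section Interpolation.
Variable v : nat -> point.

(** Distinct points impose independent conditions on forms of degree at least their
    number minus one: a product of linear forms separates one from the others. *)
Lemma separating_form (s : seq nat) i d :
  (forall j, j \in s -> nonprop (v j) (v i)) -> (exists c, v i c != 0) ->
  (size s <= d)%N -> exists e, [/\ e \is d.-homog, e.@[v i] = 1 &
    forall j, j \in s -> e.@[v j] = 0].
Proof.
move=> hs [c vc]; elim: s d hs => [|j s IH] d hs.
  move=> _; exists ((v i c)^-1 ^+ d *: 'X_c ^+ d); split=> //.
    by rewrite rpredZ //; have := dhomogMn d (dhomogX1 c); rewrite mul1n.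
  by rewrite mevalZ rmorphXn /= mevalXU -exprMn mulVf ?expr1n.
case: d => // d; rewrite ltnS => /IH[j' js|e [he e1 e0]].
  by apply: hs; rewrite inE js orbT.
have [l [hl l0 l1]] := separating_linform (hs j (mem_head _ _)).
exists ((l.@[v i])^-1 *: (l * e)); split.
- by rewrite rpredZ // -add1n dhomogM.
- by rewrite mevalZ mevalM e1 mulr1 mulVf.
- move=> j'; rewrite inE mevalZ mevalM => /predU1P[->|/e0->].
    by rewrite l0 mul0r mulr0.
  by rewrite !mulr0.
Qed.

(** Koszul relations between the [f i] change the coefficients of a combination
    without changing its value; interpolating them makes all the coefficients vanish
    at the points where the combination does. The bound on [dg] gives these relations
    a degree in which the points impose independent conditions. *)
Lemma koszul_adjust (s : seq nat) r N (f u : 'I_r -> U) (dg : 'I_r -> nat) :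
  uniq s -> (forall i j, i \in s -> j \in s -> i != j -> nonprop (v i) (v j)) ->
  (forall j, j \in s -> exists c, v j c != 0) ->
  (forall i, f i \is (dg i).-homog) ->
  (forall i, u i \is (N - dg i)%N.-homog) ->
  (forall i i', (dg i + dg i' + size s <= N.+1)%N) ->
  (forall j, j \in s -> exists i, (f i).@[v j] != 0) ->
  (forall j, j \in s -> (\sum_i u i * f i).@[v j] = 0) ->
  exists2 u' : 'I_r -> U, (forall i, u' i \is (N - dg i)%N.-homog) &
    \sum_i u' i * f i = \sum_i u i * f i /\
    forall j, j \in s -> forall i, (u' i).@[v j] = 0.
Proof.
move=> us vs v0 hf hu hdg fs us0.
suff : forall t : seq nat, {subset t <= s} ->
    exists2 u' : 'I_r -> U, (forall i, u' i \is (N - dg i)%N.-homog) &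
    \sum_i u' i * f i = \sum_i u i * f i /\
    forall j, j \in t -> forall i, (u' i).@[v j] = 0 by apply.
elim=> [|j t IH] ts; first by exists u.
have [|w hw [wE w0]] := IH; first by move=> j' j't; apply: ts; rewrite inE j't orbT.
have js : j \in s by apply: ts; rewrite mem_head.
have [l fl] := fs j js.
have size_s : (0 < size s)%N by case: (s) js.
have /choice[e he] : forall i, exists e, [/\ e \is (N - dg i - dg l)%N.-homog, e.@[v j] = 1 &
    forall j', j' \in rem j s -> e.@[v j'] = 0].
  move=> i; apply: separating_form; [|exact: v0|].
    move=> j'; rewrite mem_rem_uniq // inE => /andP[jj' js'].
    by apply: vs.
  rewrite size_rem //; move: (hdg i l) size_s; move: (size s) (dg i) (dg l) => x y z.
  lia.
(* The relations [f l * f i = f i * f l], weighted by forms that vanish at all the points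
   but [v j], change values at this point only. *)
pose a i := (w i).@[v j] / (f l).@[v j].
pose w' i := if i == l then w l + \sum_(i' | i' != l) a i' *: (e i' * f i')
             else w i - a i *: (e i * f l).
have sumE : \sum_i w' i * f i = \sum_i u i * f i.
  rewrite -wE (bigD1 l) //= [RHS](bigD1 l) //= /w' eqxx mulrDl -addrA; congr (_ + _).
  rewrite mulr_suml -big_split; apply: eq_bigr => i /negPf-> /=.
  by rewrite -!mul_mpolyC; ring.
exists w' => [i|].
  have eh i' : e i' * f i' \is (N - dg l)%N.-homog.
    have -> : (N - dg l = N - dg i' - dg l + dg i')%N by have := hdg i' l; lia.
    by apply: dhomogM => //; case: (he i').
  rewrite /w'; case: eqP => [->|_].
    by rewrite rpredD // rpred_sum // => i' _; rewrite rpredZ.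
  rewrite rpredB ?rpredZ //.
  have -> : (N - dg i = N - dg i - dg l + dg l)%N by have := hdg i l; lia.
  by apply: dhomogM => //; case: (he i).
split=> // j'; rewrite inE; have [->|jj'] := eqVneq j' j => /= [_|j't].
  have w'0 i : i != l -> (w' i).@[v j] = 0.
    move=> /negPf il; rewrite /w' il mevalB mevalZ mevalM.
    by case: (he i) => _ -> _; rewrite mul1r divfK ?subrr.
  move=> i; have [->|/w'0//] := eqVneq i l.
  have := us0 j js; rewrite -sumE raddf_sum (bigD1 l) //= big1 ?addr0 => [/eqP|i' il].
    by rewrite mevalM mulf_eq0 (negPf fl) orbF => /eqP.
  by rewrite mevalM w'0 ?mul0r.
have j's : j' \in rem j s.
  by rewrite mem_rem_uniq // inE jj' ts // inE j't orbT.
have e0 i : (e i).@[v j'] = 0 by case: (he i) => _ _; apply.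
move=> i; rewrite /w'; case: eqP => [_|_].
  rewrite mevalD w0 // add0r raddf_sum big1 // => i' _.
  by rewrite /= mevalZ mevalM e0 mul0r mulr0.
by rewrite mevalB w0 // mevalZ mevalM e0 mul0r mulr0 subrr.
Qed.

(** Koszul relations allow the coefficients in [pt_form_span] to vanish at further
    points. *)
Lemma pt_form_span_vanishing (s : seq nat) j c f :
  uniq (j :: s) -> (forall i i', i \in j :: s -> i' \in j :: s -> i != i' -> nonprop (v i) (v i')) ->
  f \is (size s).+1.-homog -> v j c != 0 -> (forall i, i \in j :: s -> f.@[v i] = 0) ->
  exists2 g : 'I_n -> U, f = \sum_i pt_form (v j) c i * g i &
    forall i, g i \is (size s).-homog /\ forall j', j' \in s -> (g i).@[v j'] = 0.
Proof.
move=> /andP[js us] vs hf vjc f0.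
have [g hg fE] := pt_form_span hf vjc (f0 j (mem_head _ _)).
have sub i : i \in s -> nonprop (v j) (v i).
  move=> si; apply: vs; rewrite ?inE ?eqxx ?si ?orbT //.
  by apply: contraNneq js => ->.
have comm (h : 'I_n -> U) : \sum_i pt_form (v j) c i * h i = \sum_i h i * pt_form (v j) c i.
  by apply: eq_bigr => i _; rewrite mulrC.
have := @koszul_adjust s n (size s).+1 (pt_form (v j) c) g (fun=> 1%N) us.
rewrite subSS subn0; case.
- by move=> i i' si si'; apply: vs; rewrite inE ?si ?si' orbT.
- by move=> i /sub/nonprop_neq0.
- by move=> i; apply: pt_form_homog.
- exact: hg.
- by move=> i l; lia.
- move=> i /sub[a [b h]]; apply: contrapT => nE; case/eqP: h.
  have e a' : v i a' = v j a' / v j c * v i c.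
    apply/eqP; rewrite -subr_eq0; apply/eqP; apply: contrapT => h; apply: nE.
    by exists a'; apply/eqP; rewrite mevalB mevalZ !mevalXU.
  by rewrite (e a) (e b); ring.
- by move=> i si; rewrite -comm -fE f0 // inE si orbT.
move=> g' hg' [gE g0]; exists g' => [|i]; first by rewrite comm gE -comm.
by split; [apply: hg' | move=> j' js'; apply: g0].
Qed.
End Interpolation.

(** * Proportionality of linear forms *)

(** The substitution that solves [l = 0] for one of the variables is an
    endomorphism with kernel generated by [l]. *)
Lemma linform_prime l f (a : U) : l \is 1.-homog -> f \is 1.-homog -> l != 0 ->
  (forall x, f != x *: l) -> mdvd l (f * a) -> mdvd l a.
Proof.
move=> hl hf l0 nf; have [c lc] : exists c, l@_U_(c) != 0.
  apply: contrapT => nE; case/eqP: l0; rewrite (linform_sum hl) big1 // => i _.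
  apply/eqP; rewrite mscalerI; apply/orP; left; apply/eqP; apply: contrapT => h.
  by apply: nE; exists i; apply/eqP.
pose lq := [tuple 'X_i - ((i == c)%:R / l@_U_(c)) *: l | i < n].
have lqE i : 'X_i \mPo lq = 'X_i - ((i == c)%:R / l@_U_(c)) *: l.
  by rewrite comp_mpolyXU -tnth_nth tnth_mktuple.
have sigE h : h \is 1.-homog -> h \mPo lq = h - (h@_U_(c) / l@_U_(c)) *: l.
  move=> hh; rewrite {1 2}(linform_sum hh) raddf_sum /=.
  under eq_bigr do rewrite comp_mpolyZ lqE scalerBr scalerA.
  rewrite sumrB; congr (_ - _); rewrite (bigD1 c) //= eqxx big1 ?addr0 ?mul1r // => i /negPf->.
  by rewrite mul0r mulr0 scale0r.
have sD (x : k) (h1 h2 : U) : (x *: h1 + h2) \mPo lq = x *: (h1 \mPo lq) + (h2 \mPo lq).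
  by rewrite raddfD; congr (_ + _); apply: comp_mpolyZ.
have sigD h : mdvd l (h - (h \mPo lq)).
  elim/mpolyind: h => [|x m h _ _ [q e]]; first by exists 0; rewrite mulr0 (raddf0 (comp_mpoly lq)) subrr.
  suff [q' e'] : mdvd l ('X_[m] - ('X_[m] \mPo lq)).
    exists (x *: q' + q); rewrite sD opprD addrACA e mulrDr; congr (_ + _).
    by rewrite -scalerBr e' scalerAr.
  move: {2}(mdeg m) (erefl (mdeg m)) => d; elim: d m => [|d IH] m.
    by move/eqP; rewrite mdeg_eq0 => /eqP->; exists 0; rewrite mpolyX0 mulr0 (rmorph1 (comp_mpoly lq)) subrr.
  move=> /mdegS_split[i [m' [-> /IH[q' e']]]].
  rewrite mpolyXD rmorphM /= lqE; set y := _ / _.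
  exists ('X_i * q' + y *: ('X_[m'] \mPo lq)).
  rewrite mulrDr [l * (_ * q')]mulrCA -e'.
  by rewrite -!mul_mpolyC; ring.
case=> q e; have : (f * a) \mPo lq = (l * q) \mPo lq by rewrite e.
rewrite !rmorphM /= (sigE l) // divff // scale1r subrr mul0r => /eqP.
rewrite mulf_eq0 (sigE f) // subr_eq0 (negPf (nf _)) /= => /eqP a0.
by have := sigD a; rewrite a0 subr0.
Qed.

Lemma pt_form_coeff p c i j : j != c -> (pt_form p c i)@_U_(j) = (i == j)%:R.
Proof.
by move=> jc; rewrite mcoeffB mcoeffZ !mcoeffXU [c == j]eq_sym (negPf jc) mulr0 subr0.
Qed.

(** This is where the dimension of the projective space matters: the forms vanishing
    at a point have a common factor on a line, but not in higher dimension. *)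
Lemma two_linforms p : (3 <= n)%N -> (exists c, p c != 0) ->
  exists l1 l2 : U, [/\ l1 \is 1.-homog /\ l2 \is 1.-homog, l1.@[p] = 0 /\ l2.@[p] = 0,
    l1 != 0 /\ (forall x, l2 != x *: l1) & l2 != 0 /\ (forall x, l1 != x *: l2)].
Proof.
move=> n3 [c pc].
have [a ac] : exists a, a != c.
  have i0 : (0 < n)%N by lia.
  have i1 : (1 < n)%N by lia.
  have [e|] := eqVneq (Ordinal i0) c; last by exists (Ordinal i0).
  by exists (Ordinal i1); rewrite -e.
have [b [bc ba]] : exists b, b != c /\ b != a.
  have : (0 < #|[set~ c] :\ a|)%N.
    have := cardsD1 a [set~ c]; rewrite !inE ac cardsC1 card_ord.
    by move: #|_| => z; lia.
  by case/card_gt0P=> b; rewrite !inE => /andP[h1 h2]; exists b.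
have coefE := pt_form_coeff p; have ab : a != b by rewrite eq_sym.
have neq i j : i != c -> j != c -> i != j -> forall x, pt_form p c i != x *: pt_form p c j.
  move=> ic jc ij x; apply/eqP => /(congr1 (mcoeff U_(i))).
  by rewrite mcoeffZ !coefE // eqxx [j == i]eq_sym (negPf ij) mulr0 => /eqP; rewrite oner_eq0.
exists (pt_form p c a), (pt_form p c b).
have neq0 i : i != c -> pt_form p c i != 0.
  move=> ic; apply/eqP => /(congr1 (mcoeff U_(i))).
  by rewrite coefE // mcoeff0 eqxx => /eqP; rewrite oner_eq0.
split; split; rewrite ?pt_form_homog ?pt_form_eval ?neq0 //; exact: neq.
Qed.

Lemma linform_through p q : (3 <= n)%N -> (exists c, p c != 0) ->
  exists w : U, [/\ w \is 1.-homog, w != 0, w.@[p] = 0 & w.@[q] = 0].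
Proof.
move=> n3 /(two_linforms n3)[l1 [l2 [[h1 h2] [p1 p2] [l10 n21] [l20 n12]]]].
have [q1|q1] := eqVneq (l1.@[q]) 0; first by exists l1.
exists (l2 - (l2.@[q] / l1.@[q]) *: l1).
by rewrite rpredB ?rpredZ // subr_eq0 n21 !mevalB !mevalZ p1 p2 divfK // subrr mulr0 subr0.
Qed.

End Points.

Lemma digits_inj B n (a b : 'I_n -> nat) : (forall i, a i < B)%N -> (forall i, b i < B)%N ->
  (\sum_i a i * B ^ i = \sum_i b i * B ^ i)%N -> a =1 b.
Proof.
elim: n a b => [|n IH] a b aB bB; first by move=> _ [].
have sumE (c : 'I_n.+1 -> nat) :
    (\sum_i c i * B ^ i = c ord0 + (\sum_i c (fintype.lift ord0 i) * B ^ i) * B)%N.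
  rewrite big_ord_recl /= expn0 muln1 big_distrl /=; congr (_ + _)%N.
  by apply: eq_bigr => i _; rewrite /bump /= add1n expnSr mulnA.
rewrite !sumE => e; have B0 : (0 < B)%N by apply: leq_ltn_trans (aB ord0).
have e0 : a ord0 = b ord0.
  by have := congr1 (modn^~ B) e; rewrite /= ![(_ ord0 + _)%N]addnC !modnMDl !modn_small.
have /IH h : (\sum_i a (fintype.lift ord0 i) * B ^ i = \sum_i b (fintype.lift ord0 i) * B ^ i)%N.
  by move/eqP: e; rewrite e0 eqn_add2l eqn_pmul2r // => /eqP.
move=> i; case: (unliftP ord0 i) => [j|] -> //; exact: h.
Qed.

Section InfiniteField.
Variable k : closedFieldType.

Lemma exists_notin (s : seq k) : exists x, x \notin s.
Proof.
pose P : {poly k} := \prod_(a <- s) ('X - a%:P).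
have P0 : P != 0 by rewrite monic_neq0 // monic_prod_XsubC.
have /closed_rootP[x hx] : size ('X * P + 1) != 1%N.
  by rewrite size_polyDl ?size_poly1 mulrC size_mulX // size_prod_XsubC.
exists x; apply/negP => xs; move: hx; rewrite rootE !hornerE.
have /eqP -> : P.[x] == 0 by rewrite -rootE root_prod_XsubC.
by rewrite mulr0 add0r oner_eq0.
Qed.

Lemma avoiding_linform n (v : nat -> 'I_n -> k) (s : seq nat) i :
  (forall j, j \in s -> nonprop (v i) (v j)) ->
  exists l, [/\ l \is 1.-homog, l.@[v i] = 0 & forall j, j \in s -> l.@[v j] != 0].
Proof.
elim: s => [|j s IH] hs; first by exists 0; rewrite rpred0 meval0.
have [|l [hl l0 lN]] := IH; first by move=> j' js; apply: hs; rewrite inE js orbT.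
have [l' [hl' l'0 l'N]] := separating_linform (hs j (mem_head _ _)).
have [x hx] := exists_notin [seq - l'.@[v j'] / l.@[v j'] | j' <- j :: s].
have xN j' : j' \in j :: s -> l.@[v j'] != 0 -> l'.@[v j'] + x * l.@[v j'] != 0.
  move=> js lj; apply: contraNneq hx => /eqP; rewrite addrC addr_eq0 => /eqP e.
  by apply/mapP; exists j' => //; rewrite -e mulfK.
exists (l' + x *: l); split.
- by rewrite rpredD ?rpredZ.
- by rewrite mevalD mevalZ l0 l'0 mulr0 addr0.
move=> j' j's; rewrite mevalD mevalZ; move: (j's); rewrite inE.
case/predU1P=> [e|/lN]; last exact: xN.
have [lj|] := eqVneq (l.@[v j']) 0; last exact: xN.
by rewrite lj mulr0 addr0 e.
Qed.

(** Substituting distinct powers of one variable for the variables, with exponents in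
    a base larger than all the degrees, keeps distinct monomials distinct. *)
Lemma exists_nonroot n (f : {mpoly k[n]}) : f != 0 -> exists v, f.@[v] != 0.
Proof.
move=> f0; pose B := msize f.
pose W (m : 'X_{1..n}) := (\sum_i m i * B ^ i)%N.
have mB m : m \in msupp f -> forall i, (m i < B)%N.
  move=> mf i; apply: leq_ltn_trans (msize_mdeg_lt mf).
  by rewrite mdegE (bigD1 i) //= leq_addr.
pose F : {poly k} := \sum_(m <- msupp f) f@_m *: 'X^(W m).
have F0 : F != 0.
  have mf := mlead_supp f0; apply: contraNneq f0 => /(congr1 (fun p : {poly k} => p`_(W (mlead f)))).
  rewrite coef0 coef_sum (big_rem _ mf) /= coefZ coefXn eqxx mulr1 big_seq big1.
    by rewrite addr0 => /eqP; rewrite mleadc_eq0.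
  move=> m; rewrite mem_rem_uniq ?msupp_uniq // inE => /andP[ml mf'].
  rewrite coefZ coefXn; case: eqP; rewrite ?mulr0 // => /(digits_inj (mB _ mf) (mB _ mf')) e.
  by case/eqP: ml; apply/mnmP => i; rewrite e.
have [x hx] : exists x, F.[x] != 0.
  have /closed_rootP[x] : size (F * 'X + 1) != 1%N.
    have s : (1 < size (F * 'X : {poly k})%R)%N by rewrite size_mulX // ltnS lt0n size_poly_eq0.
    by rewrite size_polyDl ?size_poly1 // neq_ltn s orbT.
  rewrite rootE !hornerE => h; exists x; apply: contraTneq h => ->.
  by rewrite mul0r add0r oner_eq0.
exists (fun i => x ^+ (B ^ i)); apply: contraNneq hx => e; rewrite -e mevalE /F horner_sum.
apply/eqP; apply: eq_bigr => m _; rewrite !hornerE; congr (_ * _).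
by rewrite /W expr_sum; apply: eq_bigr => i _; rewrite -exprM mulnC.
Qed.
End InfiniteField.

(** * Homogeneous components *)

Section Homogeneous.
Variables (k : fieldType) (n : nat).
Local Notation U := {mpoly k[n]}.
Implicit Types (f g : U).

Lemma pihomog_sum_all N f : (msize f <= N)%N -> f = \sum_(d < N) pihomog mdeg d f.
Proof. exact: pihomog_partitionE. Qed.

Lemma pihomog_mulr d m f g : g \is d.-homog -> (d <= m)%N ->
  pihomog mdeg m (f * g) = pihomog mdeg (m - d) f * g.
Proof.
move=> hg dm; rewrite {1}(@pihomog_sum_all (maxn (msize f) (m - d).+1) f (leq_maxl _ _)).
rewrite mulr_suml raddf_sum /=.
have dN : (m - d < maxn (msize f) (m - d).+1)%N by rewrite leq_max leqnn orbT.
rewrite (bigD1 (Ordinal dN)) //= pihomog_dE; last first.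
  by rewrite -{2}(subnK dm); apply: dhomogM; [apply: pihomogP|].
rewrite big1 ?addr0 // => i ni.
apply: (@pihomog_ne0 _ _ _ (i + d)%N); last by apply: dhomogM; [apply: pihomogP|].
by apply: contraNneq ni => e; apply/eqP/val_inj => /=; apply/eqP; rewrite -(eqn_add2r d) e subnK.
Qed.

Lemma homog_quotient d e f g : g \is d.-homog -> g != 0 -> f * g \is (d + e)%N.-homog ->
  f \is e.-homog.
Proof.
move=> hg g0 hfg; have := pihomog_dE hfg.
rewrite (pihomog_mulr f hg (leq_addr e d)) addKn => /(mulIf g0) <-; exact: pihomogP.
Qed.

Lemma homog0_const f : f \is 0.-homog -> f = (f@_0%MM)%:MP.
Proof.
move=> hf; apply/mpolyP => m; rewrite mcoeffC.
have [->|m0] := eqVneq m 0%MM; first by rewrite mulr1.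
by rewrite mulr0 (dhomog_nemf_coeff hf) // mdeg_eq0.
Qed.

End Homogeneous.

(** * Iterates of a graded automorphism *)

Section Twist.
Variables (k : fieldType) (n : nat) (Phi : gr_aut k n).
Local Notation U := {mpoly k[n]}.
Implicit Types (f g : U).

Definition twn d f : U := iter d Phi f.

Lemma twn_is_additive d : {morph twn d : x y / x - y}.
Proof. by move=> f g; rewrite /twn -scaleN1r Defs.iter_addr iterZ scaleN1r. Qed.

Lemma twn_is_multiplicative d : multiplicative (twn d).
Proof. by split=> [f g|]; rewrite /twn ?Defs.iterM ?Defs.iter1. Qed.

HB.instance Definition _ d := GRing.isAdditive.Build U U (twn d) (@twn_is_additive d).
HB.instance Definition _ d := GRing.isMultiplicative.Build U U (twn d) (@twn_is_multiplicative d).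
HB.instance Definition _ d := GRing.isScalable.Build k U U *:%R (twn d) (@iterZ _ _ Phi d).

Lemma twnD d e f : twn (d + e) f = twn d (twn e f).
Proof. exact: iterD. Qed.

Lemma twnSr d f : twn d.+1 f = twn d (Phi f).
Proof. exact: iterSr. Qed.

Lemma twn_inj d : injective (twn d).
Proof.
elim: d => [//|d IH] f g /= e; apply: IH.
by apply: (bij_inj (gr_aut_bij Phi)).
Qed.

Lemma twn_homog d e f : f \is e.-homog -> twn d f \is e.-homog.
Proof. exact: iter_homog. Qed.

Lemma twn_eq0 d f : (twn d f == 0) = (f == 0).
Proof.
by apply/eqP/eqP => [e|->]; rewrite ?raddf0 //; apply: (@twn_inj d); rewrite e raddf0.
Qed.

Lemma pihomog_twn d e f : pihomog mdeg e (twn d f) = twn d (pihomog mdeg e f).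
Proof.
set N := maxn (msize f) e.+1.
have eN : (e < N)%N by rewrite leq_max leqnn orbT.
rewrite {1}(@pihomog_sum_all _ _ N f (leq_maxl _ _)).
rewrite (raddf_sum (twn d)) (raddf_sum (pihomog mdeg e)) /=.
rewrite (bigD1 (Ordinal eN)) //= pihomog_dE ?twn_homog ?pihomogP // big1 ?addr0 // => i ni.
apply: (@pihomog_ne0 _ _ _ i); last by apply: twn_homog; apply: pihomogP.
by apply: contraNneq ni => ie; apply/eqP/val_inj.
Qed.

Lemma twn_surj d f : exists g, twn d g = f.
Proof.
elim: d f => [|d IH] f; first by exists f.
have [g <-] := IH f; case: (gr_aut_bij Phi) => h _ hK.
by exists (h g); rewrite /twn iterSr hK.
Qed.

Lemma twn_surj_homog d e f : f \is e.-homog -> exists2 g, g \is e.-homog & twn d g = f.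
Proof.
move=> hf; have [g gE] := twn_surj d f; exists (pihomog mdeg e g); first exact: pihomogP.
by rewrite -pihomog_twn gE pihomog_dE.
Qed.

End Twist.

(** * Subspaces of finite-dimensional spaces *)

Section FiniteDimension.
Variable k : fieldType.

Definition lin_closed (V : lmodType k) (P : set V) : Prop :=
  P 0 /\ forall a x y, P x -> P y -> P (a *: x + y).

Lemma lin_closed_sum (V : lmodType k) (P : set V) I (r : seq I) (Q : pred I) (a : I -> k) (x : I -> V) :
  lin_closed P -> (forall i, Q i -> P (x i)) -> P (\sum_(i <- r | Q i) a i *: x i).
Proof. by case=> P0 PD Px; apply: big_rec => // i y Qi; apply: PD; apply: Px. Qed.

(** The list spans a subspace of maximal dimension. *)
Lemma fin_subspace (W : vectType k) (P : set W) :
  exists2 s : seq W, (forall x, x \in s -> P x) &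
    forall Q : set W, lin_closed Q -> (forall x, x \in s -> Q x) -> P `<=` Q.
Proof.
have ex : exists d, `[< exists2 s : seq W, forall x, x \in s -> P x & \dim <<s>> = d >].
  by exists 0%N; apply/asboolP; exists [::] => //; rewrite span_nil dimv0.
have bd d : `[< exists2 s : seq W, forall x, x \in s -> P x & \dim <<s>> = d >] ->
    (d <= \dim (fullv : {vspace W}))%N.
  by case/asboolP => s _ <-; apply: dimvS; apply: subvf.
case: (ex_maxnP ex bd) => d /asboolP[s sP sd] dmax; exists s => // Q hQ sQ x Px.
have xs : x \in <<s>>%VS.
  have sub : (<<s>> <= <<x :: s>>)%VS by rewrite span_cons addvSr.
  have le : (\dim <<x :: s>> <= \dim <<s>>)%N.
    rewrite sd; apply: dmax; apply/asboolP; exists (x :: s) => // y.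
    by rewrite inE => /predU1P[->|/sP].
  have /eqP -> : <<s>>%VS == <<x :: s>>%VS by rewrite eqEdim sub.
  by apply: memv_span; rewrite mem_head.
rewrite (coord_span (X := in_tuple s) xs); apply: lin_closed_sum => // i _.
by apply: sQ; apply: mem_nth; rewrite ltn_ord.
Qed.

(** A form of given degree is determined by finitely many coefficients. *)
Lemma fin_homog n d (P : set {mpoly k[n]}) : lin_closed P -> (forall f, P f -> f \is d.-homog) ->
  exists2 s : seq {mpoly k[n]}, (forall x, x \in s -> P x) &
    forall Q : set {mpoly k[n]}, lin_closed Q -> (forall x, x \in s -> Q x) -> P `<=` Q.
Proof.
move=> [P0 PD] hP; pose L (f : {mpoly k[n]}) : {ffun 'X_{1..n < d.+1} -> k^o} := [ffun m => f@_(val m)].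
have LD a f g : L (a *: f + g) = a *: L f + L g.
  by apply/ffunP => m; rewrite !ffunE mcoeffD mcoeffZ.
have L0 : L 0 = 0 by apply/ffunP => m; rewrite !ffunE mcoeff0.
have Linj f g : P f -> P g -> L f = L g -> f = g.
  move=> /hP hf /hP hg e; apply/mpolyP => m.
  have [md|md] := eqVneq (mdeg m) d; last by rewrite (dhomog_nemf_coeff hf) // (dhomog_nemf_coeff hg).
  have lt : (mdeg m < d.+1)%N by rewrite md.
  by have /ffunP/(_ (BMultinom lt)) := e; rewrite !ffunE.
have [s sP hs] := @fin_subspace {ffun 'X_{1..n < d.+1} -> k^o} [set w | exists2 f, P f & L f = w].
have [s' s'P s'E] : exists2 s' : seq {mpoly k[n]}, (forall x, x \in s' -> P x) & s = map L s'.
  elim: s sP {hs} => [|w s IH] sP; first by exists [::].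
  have [x xs|s' s'P ->] := IH; first by apply: sP; rewrite inE xs orbT.
  have [f Pf <-] := sP w (mem_head _ _); exists (f :: s') => // x.
  by rewrite inE => /predU1P[->|/s'P].
exists s' => // Q [Q0 QD] s'Q f Pf.
have [|||g [[Pg Qg]]] := hs [set w | exists g, (P g /\ Q g) /\ L g = w] _ _ (L f).
- split; first by exists 0.
  move=> a _ _ [g [[Pg Qg] <-]] [h [[Ph Qh] <-]]; exists (a *: g + h); rewrite LD.
  by split=> //; split; [apply: PD|apply: QD].
- by move=> w; rewrite s'E => /mapP[g gs' ->]; exists g; split=> //; split; [apply: s'P|apply: s'Q].
- by exists f.
by move=> /(Linj _ _ Pg Pf) <-.
Qed.

End FiniteDimension.

(** * The graded pieces of the subalgebra *)

(** The half-orbit [c_0, c_1, ...] of the point, through representatives chosen so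
    that the automorphism moves values along it without scalar factors. Only
    half-orbits occur because the opposite algebra is of the same kind, for the
    inverse automorphism and the other half of the orbit. *)
Record orbit_data (k : fieldType) (n : nat) (Phi : gr_aut k n) (v : nat -> 'I_n -> k) : Prop :=
  OrbitData {
    od_eval : forall i f, (Phi f).@[v i.+1] = f.@[v i];
    od_distinct : forall i j, i != j -> nonprop (v i) (v j);
    od_dense : forall d f, f \is d.-homog -> f != 0 ->
      exists N, forall i, (N <= i)%N -> f.@[v i] != 0
  }.

Section Pieces.
Variables (k : closedFieldType) (n : nat) (Phi : gr_aut k n) (v : nat -> 'I_n -> k).
Hypothesis od : orbit_data Phi v.
Local Notation U := {mpoly k[n]}.
Local Notation twn := (twn Phi).
Implicit Types (f g r : U).

Definition Rn (m : nat) : set U :=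
  [set f | f \is m.-homog /\ forall i, (i < m)%N -> f.@[v i] = 0].

Lemma v_neq0 i : exists c, v i c != 0.
Proof. by apply: (@nonprop_neq0 _ _ (v i.+1)); apply: (od_distinct od); lia. Qed.

Lemma twn_eval d i f : (twn d f).@[v (d + i)%N] = f.@[v i].
Proof. by elim: d => [//|d IH]; rewrite addSn -IH -(od_eval od (d + i)). Qed.

Lemma Rn_lin_closed m : lin_closed (Rn m).
Proof.
split; first by split=> [|i _]; [apply: rpred0|apply: meval0].
move=> a f g [hf f0] [hg g0]; split=> [|i im]; first by rewrite rpredD ?rpredZ.
by rewrite mevalD mevalZ f0 // g0 // mulr0 addr0.
Qed.

Lemma Rn_mul m m' r f : Rn m r -> Rn m' f -> Rn (m + m') (twn m' r * f).
Proof.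
move=> [hr r0] [hf f0]; split; first by apply: dhomogM => //; apply: twn_homog.
move=> i im; rewrite mevalM; have [/f0->|m'i] := ltnP i m'; first by rewrite mulr0.
by rewrite -(subnKC m'i) twn_eval r0 ?mul0r //; lia.
Qed.

Lemma Rn_twn a d f : f \is d.-homog ->
  (forall i, (a <= i < a + d)%N -> f.@[v i] = 0) -> exists2 r, Rn d r & twn a r = f.
Proof.
move=> hf f0; have [r hr rE] := twn_surj_homog Phi a hf; exists r => //; split=> // i id.
by rewrite -(twn_eval a) rE f0 //; lia.
Qed.

(** The algebra is generated in degree one: the points of the orbit being distinct,
    a form vanishing at [m + 1] of them is a combination of products of linear
    forms through them. *)
Lemma Rn_generated m f : Rn m.+1 f -> exists2 l : 'I_n -> U, (forall i, Rn 1 (l i)) &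
  exists2 g : 'I_n -> U, (forall i, Rn m (g i)) & f = \sum_i twn m (l i) * g i.
Proof.
move=> [hf f0]; have [c vc] := v_neq0 m.
have vanish i : i \in m :: iota 0 m -> f.@[v i] = 0.
  by rewrite inE mem_iota add0n => /predU1P[->|/andP[_ im]]; apply: f0; lia.
have [|||g fE hg] := @pt_form_span_vanishing _ _ v (iota 0 m) m c f _ _ _ vc vanish.
- by rewrite /= iota_uniq mem_iota add0n ltnn andbF.
- by move=> i i' _ _; apply: (od_distinct od).
- by rewrite size_iota.
have /choice[l hl] : forall i, exists l, Rn 1 l /\ twn m l = pt_form (v m) c i.
  move=> i; have [j jm|l h1 h2] := @Rn_twn m 1 _ (pt_form_homog (v m) c i); last by exists l.
  have -> : j = m by lia.
  by rewrite pt_form_eval.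
exists l => [i|]; first by case: (hl i).
exists g => [i|]; last by rewrite fE; apply: eq_bigr => i _; case: (hl i) => _ ->.
case: (hg i) => h1 h2; rewrite size_iota in h1; split=> // j jm.
by apply: h2; rewrite mem_iota add0n jm.
Qed.

(** * Graded left ideals are finitely generated *)

(** The pieces of a graded left ideal: [twn m' r * f] is the product of [r] and [f] in
    the twisted algebra. *)
Definition left_family (I : nat -> set U) : Prop :=
  [/\ forall m, I m `<=` Rn m, forall m, lin_closed (I m) &
      forall m m' r f, Rn m r -> I m' f -> I (m + m')%N (twn m' r * f)].

Lemma left_family_sum I m J (s : seq J) (F : J -> U) :
  left_family I -> (forall i, I m (F i)) -> I m (\sum_(i <- s) F i).
Proof.
case=> _ IL _ hF; have [I0 ID] := IL m; apply: big_rec => // i y _ hy.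
by rewrite -[F i]scale1r; apply: ID.
Qed.

(** If [f_1, ..., f_r] in [I] generate the polynomial ideal generated by [I],
    then an element of [I] of degree [m] is [\sum_i u_i f_i], where [u_i] can be made
    to vanish at the points [c_j] with [j0 <= j < m] because the [f_i] have no common
    zero among these. It belongs to the left ideal generated by the [f_i] if the
    [u_i] vanish also at the [c_j] with [j < j0], and these values form a space of
    bounded dimension. *)
Section FinitelyGenerated.
Variable I : nat -> set U.
Hypothesis hI : left_family I.
Variables (r : nat) (f : 'I_r -> U) (dg : 'I_r -> nat) (j0 : nat).
Hypothesis If : forall i, I (dg i) (f i).
Hypothesis dg_bound : forall i i', (dg i + dg i' <= j0)%N.
Hypothesis f_gen : forall m g, (j0 <= m)%N -> I m g ->
  exists2 u : 'I_r -> U, (forall i, u i \is (m - dg i)%N.-homog) & g = \sum_i u i * f i.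
Hypothesis f_nonzero : forall j, (j0 <= j)%N -> exists i, (f i).@[v j] != 0.

Let dg_le i m : (j0 <= m)%N -> (dg i <= m)%N.
Proof. by move=> j0m; have := dg_bound i i; lia. Qed.

Lemma vanishing_coefficients m g : (j0 <= m)%N -> I m g ->
  exists2 u : 'I_r -> U, (forall i, u i \is (m - dg i)%N.-homog) &
    g = \sum_i u i * f i /\ forall j, (j0 <= j < m)%N -> forall i, (u i).@[v j] = 0.
Proof.
move=> j0m Ig; have [u hu gE] := f_gen j0m Ig.
have [IR _ _] := hI; have [hg g0] := IR _ _ Ig.
have [||||||||u' hu' [u'E u'0]] := @koszul_adjust _ _ v (iota j0 (m - j0)) r m f u dg.
- exact: iota_uniq.
- by move=> i j _ _; apply: (od_distinct od).
- by move=> j _; apply: v_neq0.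
- by move=> i; have [] := IR _ _ (If i).
- exact: hu.
- by move=> i i'; rewrite size_iota; have := dg_bound i i'; lia.
- by move=> j; rewrite mem_iota => /andP[h _]; apply: f_nonzero.
- by move=> j; rewrite mem_iota => h; rewrite -gE g0 //; lia.
exists u' => //; split=> [|j jm]; first by rewrite u'E.
by apply: u'0; rewrite mem_iota; lia.
Qed.

(* Multiplication by [lf l] is the step from degree [l] to degree [l + 1]: it vanishes
   at the point that becomes relevant and at none of the first [j0] points, so
   that the values there in different degrees can be compared. *)
Variable lf : nat -> U.
Hypothesis lf_homog : forall l, lf l \is 1.-homog.
Hypothesis lf_root : forall l, (j0 <= l)%N -> (lf l).@[v l] = 0.
Hypothesis lf_nonroot : forall l j, (j0 <= l)%N -> (j < j0)%N -> (lf l).@[v j] != 0.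

Let rho a b := \prod_(l <- iota a (b - a)) lf l.

Lemma rho_homog a b : rho a b \is (b - a)%N.-homog.
Proof.
rewrite /rho; move: (b - a)%N => d; elim: d a => [|d IH] a; first by rewrite big_nil dhomog1.
by rewrite /= big_cons -(add1n d); apply: dhomogM => //; apply: IH.
Qed.

Lemma rho_root a b i : (j0 <= a)%N -> (a <= i < b)%N -> (rho a b).@[v i] = 0.
Proof.
move=> ja iab; have ii : i \in iota a (b - a) by rewrite mem_iota; lia.
by rewrite /rho (big_rem i ii) /= mevalM lf_root ?mul0r //; lia.
Qed.

Lemma rho_nonroot a b j : (j0 <= a)%N -> (j < j0)%N -> (rho a b).@[v j] != 0.
Proof.
move=> ja jj; rewrite /rho; have : all (leq a) (iota a (b - a)).
  by apply/allP => l; rewrite mem_iota => /andP[].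
elim: (iota a (b - a)) => [|l s IH] /=; first by rewrite big_nil meval1 oner_eq0.
case/andP=> al /IH h; rewrite big_cons mevalM mulf_neq0 // lf_nonroot //.
exact: leq_trans ja al.
Qed.

Lemma rho_cat a b d : (a <= b)%N -> (b <= d)%N -> rho a b * rho b d = rho a d.
Proof.
move=> ab bd; rewrite /rho -big_cat /=; congr (\prod_(l <- _) _).
have -> : (d - a = (b - a) + (d - b))%N by lia.
by rewrite iotaD; congr (_ ++ iota _ _); lia.
Qed.

Lemma rho_mul a b g : (j0 <= a)%N -> (a <= b)%N -> I a g -> I b (rho a b * g).
Proof.
move=> ja ab Ig; have [x hx <-] : exists2 x, Rn (b - a) x & twn a x = rho a b.
  apply: Rn_twn => [|i iab]; first exact: rho_homog.
  by apply: rho_root => //; lia.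
by case: hI => _ _ /(_ _ _ _ _ hx Ig); rewrite subnK.
Qed.

(** The values of the coefficients at the first [j0] points, for elements of degree
    [m]. The normalisation by [rho] makes these spaces increase with [m]. *)
Definition coef_values m : set 'M[k]_(r, j0) :=
  [set e | exists2 u : 'I_r -> U, (forall i, u i \is (m - dg i)%N.-homog) &
    [/\ I m (\sum_i u i * f i), forall j, (j0 <= j < m)%N -> forall i, (u i).@[v j] = 0 &
        forall i (j : 'I_j0), (u i).@[v j] = (rho j0 m).@[v j] * e i j]].

Lemma coef_values_lin_closed m : lin_closed (coef_values m).
Proof.
have [_ /(_ m)[I0 ID] _] := hI; split.
  exists (fun=> 0) => [i|]; first exact: rpred0.
  split=> [|j _ i|i j]; rewrite ?meval0 ?mxE ?mulr0 //.
  by rewrite big1 // => i _; rewrite mul0r.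
move=> a e e' [u hu [Iu u0 uE]] [u' hu' [Iu' u'0 u'E]].
exists (fun i => a *: u i + u' i) => [i|]; first by rewrite rpredD ?rpredZ.
split=> [|j jm i|i j].
- have -> : \sum_i (a *: u i + u' i) * f i = a *: \sum_i u i * f i + \sum_i u' i * f i.
    by rewrite scaler_sumr -big_split; apply: eq_bigr => i _; rewrite mulrDl scalerAl.
  exact: ID.
- by rewrite mevalD mevalZ u0 // u'0 // mulr0 addr0.
- by rewrite mevalD mevalZ uE u'E !mxE; ring.
Qed.

Lemma coef_values_mono m m' : (j0 <= m)%N -> (m <= m')%N -> coef_values m `<=` coef_values m'.
Proof.
move=> jm mm e [u hu [Iu u0 uE]]; exists (fun i => rho m m' * u i) => [i|].
  have -> : (m' - dg i = (m' - m) + (m - dg i))%N by have := dg_le i jm; lia.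
  by apply: dhomogM => //; apply: rho_homog.
split=> [|j jm' i|i j].
- under eq_bigr do rewrite -mulrA; rewrite -mulr_sumr; exact: rho_mul.
- rewrite mevalM; have [jm1|jm1] := ltnP j m; first by rewrite u0 ?mulr0 //; lia.
  by rewrite rho_root ?mul0r //; lia.
- by rewrite mevalM uE -(rho_cat jm mm) mevalM; ring.
Qed.

Lemma coef_values_stable : exists2 N, (j0 <= N)%N & forall m, (N <= m)%N -> coef_values m `<=` coef_values N.
Proof.
pose W : set 'M[k]_(r, j0) := [set e | exists2 m, (j0 <= m)%N & coef_values m e].
have [s sW hs] := @fin_subspace _ _ W.
have [N jN sN] : exists2 N, (j0 <= N)%N & forall e, e \in s -> coef_values N e.
  elim: s sW {hs} => [|e s IH] sW; first by exists j0.
  have [y ys|N jN sN] := IH; first by apply: sW; rewrite inE ys orbT.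
  have [m jm em] := sW e (mem_head _ _); exists (maxn N m); first by rewrite leq_max jN.
  move=> y; rewrite inE => /predU1P[->|/sN].
    by apply: coef_values_mono em => //; apply: leq_maxr.
  by apply: coef_values_mono => //; apply: leq_maxl.
exists N => // m Nm e em; apply: (hs _ (coef_values_lin_closed N) sN).
by exists m => //; apply: leq_trans Nm.
Qed.

Lemma left_family_finitely_generated_aux : exists s : seq (nat * U),
  (forall x, x \in s -> I x.1 x.2) /\
  forall I', left_family I' -> (forall x, x \in s -> I' x.1 x.2) -> forall m, I m `<=` I' m.
Proof.
have [N jN hN] := coef_values_stable; have [IR IL IM] := hI.
have /choice[b hb] : forall m, exists b : seq U, (forall x, x \in b -> I m x) /\
    forall Q : set U, lin_closed Q -> (forall x, x \in b -> Q x) -> I m `<=` Q.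
  move=> m; have [|b b1 b2] := @fin_homog k n m (I m) (IL m); last by exists b.
  by move=> g /IR[].
pose s := [seq (dg i, f i) | i <- enum 'I_r] ++ [seq (m, x) | m <- iota 0 N.+1, x <- b m].
exists s; split=> [x|I' hI' sI'].
  rewrite mem_cat => /orP[/mapP[i _ ->]|/allpairsPdep[m [y [_ yb ->]]]]; first exact: If.
  by case: (hb m) => + _; apply.
have [I'R I'L I'M] := hI'.
have I'f i : I' (dg i) (f i).
  by apply: (sI' (dg i, f i)); rewrite mem_cat map_f ?mem_enum.
have low m : (m <= N)%N -> I m `<=` I' m.
  move=> mN; case: (hb m) => _; apply=> // x xb; apply: (sI' (m, x)).
  by rewrite mem_cat; apply/orP; right; apply/allpairsPdep; exists m, x; rewrite mem_iota.
move=> m g Ig; have [/low|Nm] := leqP m N; first by apply.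
have jm : (j0 <= m)%N by apply: leq_trans jN (ltnW Nm).
have [u hu [gE u0]] := vanishing_coefficients jm Ig.
pose e : 'M[k]_(r, j0) := \matrix_(i < r, j < j0) ((u i).@[v j] / (rho j0 m).@[v j]).
have [|u' hu' [Iu' u'0 u'E]] := hN m (ltnW Nm) e.
  exists u => //; split=> // [|i j]; first by rewrite -gE.
  by rewrite mxE mulrC divfK // rho_nonroot.
(* Subtracting a multiple of an element of degree [N] with the same normalised values makes
   all the coefficients vanish at the first [j0] points as well. *)
pose w i := u i - rho N m * u' i.
have gE' : g = \sum_i w i * f i + rho N m * \sum_i u' i * f i.
  rewrite gE mulr_sumr -big_split; apply: eq_bigr => i _ /=.
  by rewrite mulrA -mulrDl subrK.
have [I'0 I'D] := I'L m; rewrite gE' -[\sum_i w i * f i]scale1r; apply: (I'D); last first.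
  have Rx : exists2 x, Rn (m - N) x & twn N x = rho N m.
    apply: Rn_twn => [|i iab]; first exact: rho_homog.
    by apply: rho_root => //; lia.
  have [x hx <-] := Rx; have := I'M _ _ _ _ hx (low N (leqnn _) _ Iu').
  by rewrite subnK // ltnW.
apply: left_family_sum => // i.
have [x hx <-] : exists2 x, Rn (m - dg i) x & twn (dg i) x = w i.
  apply: Rn_twn => [|j jm'].
    apply: rpredB; first exact: hu.
    have -> : (m - dg i = (m - N) + (N - dg i))%N.
      by have := dg_le i jN; lia.
    by apply: dhomogM => //; apply: rho_homog.
  rewrite mevalB mevalM; have [jj|jj] := ltnP j j0.
    rewrite (u'E i (Ordinal jj)) /= mxE /= -(rho_cat jN (ltnW Nm)) mevalM.
    have r1 : (rho j0 N).@[v j] != 0 by apply: rho_nonroot.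
    have r2 : (rho N m).@[v j] != 0 by apply: rho_nonroot.
    suff key (x y z : k) : x != 0 -> y != 0 -> z - y * (x * (z / (x * y))) = 0 by exact: key.
    by move=> x0 y0; field; rewrite x0 y0.
  rewrite u0; last by lia.
  have [jN'|jN'] := ltnP j N; first by rewrite u'0 ?mulr0 ?subrr //; lia.
  by rewrite rho_root ?mul0r ?subrr //; lia.
by have := I'M _ _ _ _ hx (I'f i); rewrite subnK ?dg_le.
Qed.
End FinitelyGenerated.

(** The generators are taken from Hilbert's basis theorem, completed in low degrees. *)
Theorem left_family_finitely_generated I : left_family I -> exists s : seq (nat * U),
  (forall x, x \in s -> I x.1 x.2) /\
  forall I', left_family I' -> (forall x, x \in s -> I' x.1 x.2) -> forall m, I m `<=` I' m.
Proof.
move=> hI; have [IR IL IM] := hI.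
have [s sI hs] := @hilbert_basis k n [set f | exists m, I m f].
pose f (i : 'I_(size s)) := s`_i.
have /choice[dg If] : forall i, exists d, I d (f i) by move=> i; apply: sI; apply: mem_nth.
have [[i0 fi0]|f0] := pselect (exists i, f i != 0); last first.
  exists [::]; split=> // I' [_ I'L _] _ m g Ig; have : (exists m, I m g) by exists m.
  move/hs/ideal_gen_seqP=> [u ->]; rewrite big1 => [|i _]; first by case: (I'L m).
  by apply/eqP; rewrite mulf_eq0; apply/orP; right; apply: contrapT => h; apply: f0; exists i; apply/negP.
have [N hN] := od_dense od (proj1 (IR _ _ (If i0))) fi0.
(* From [N] on, [f i0] vanishes at no point; the other bound gives room for the Koszul
   relations. *)
pose j0 := maxn N (2 * \max_i dg i).
have dgle i : (dg i <= \max_i dg i)%N by apply: leq_bigmax.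
have /choice[lf hlf] : forall l, exists x : U, [/\ x \is 1.-homog, (j0 <= l)%N -> x.@[v l] = 0 &
    forall j, (j0 <= l)%N -> (j < j0)%N -> x.@[v j] != 0].
  move=> l; have [jl|lj] := leqP j0 l; last by exists 0; split=> [|//|]; [apply: rpred0|lia].
  have [|x [h1 h2 h3]] := @avoiding_linform k n v (iota 0 j0) l.
    by move=> j; rewrite mem_iota => jj; apply: (od_distinct od); lia.
  by exists x; split=> // j _ jj; apply: h3; rewrite mem_iota.
apply: (@left_family_finitely_generated_aux I hI (size s) f dg j0 If _ _ _ lf).
- by move=> i i'; have := dgle i; have := dgle i'; rewrite leq_max; lia.
- move=> m g jm Ig; have : (exists m, I m g) by exists m.
  move/hs/ideal_gen_seqP=> [u gE]; exists (fun i => pihomog mdeg (m - dg i) (u i)).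
    by move=> i; apply: pihomogP.
  have [hg _] := IR _ _ Ig; rewrite -(pihomog_dE hg) gE raddf_sum; apply: eq_bigr => i _ /=.
  have [hf _] := IR _ _ (If i).
  by rewrite (pihomog_mulr _ hf) //; have := dgle i; move: jm; rewrite geq_max; lia.
- by move=> j jj; exists i0; apply: hN; move: jj; rewrite geq_max => /andP[].
- by move=> l; case: (hlf l).
- by move=> l; case: (hlf l).
- by move=> l j; case: (hlf l) => _ _; apply.
Qed.

End Pieces.

Section Graded.
Variables (k : closedFieldType) (n : nat) (Phi : gr_aut k n) (v : nat -> 'I_n -> k).
Hypothesis od : orbit_data Phi v.
Local Notation U := {mpoly k[n]}.
Local Notation twn := (twn Phi).
Local Notation Rn := (Rn v).
Local Notation left_family := (left_family Phi v).
Implicit Types (f g r : U).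

(** The union of the chain is finitely generated. *)
Lemma left_family_chain (I : nat -> nat -> set U) : (forall s, left_family (I s)) ->
  (forall s m, I s m `<=` I s.+1 m) ->
  exists N, forall s m, (N <= s)%N -> I s m `<=` I N m.
Proof.
move=> hI IS.
have Ile m s s' : (s <= s')%N -> I s m `<=` I s' m.
  elim: s' => [|s' IH]; first by rewrite leqn0 => /eqP->.
  rewrite leq_eqVlt => /predU1P[->//|/IH ss]; exact: subset_trans ss (IS s' m).
have hU : left_family (fun m f => exists s, I s m f).
  split=> [m f [s]|m|m m' r f Rr [s If]].
  - by case: (hI s) => + _ _; apply.
  - split; first by exists 0%N; case: (hI 0%N) => _ /(_ m)[].
    move=> a f g [s fs] [s' gs]; exists (maxn s s').
    case: (hI (maxn s s')) => _ /(_ m)[_ h] _; apply: h.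
      by apply: Ile fs; apply: leq_maxl.
    by apply: Ile gs; apply: leq_maxr.
  - by exists s; case: (hI s) => _ _; apply.
have [l [lI hl]] := left_family_finitely_generated od hU.
have [N hN] : exists N, forall x, x \in l -> I N x.1 x.2.
  elim: l lI {hl} => [|x l IH] lI; first by exists 0%N.
  have [y yl|N hN] := IH; first by apply: lI; rewrite inE yl orbT.
  have [s xs] := lI x (mem_head _ _); exists (maxn N s) => y.
  rewrite inE => /predU1P[->|/hN]; first by apply: Ile xs; apply: leq_maxr.
  by apply: Ile; apply: leq_maxl.
exists N => s m Ns f If; apply: (hl _ (hI N) hN).
by exists s.
Qed.

(** * Fractions that preserve a graded left ideal *)

(** The smallest ideal that contains [X] and is an intersection of principal
    fractional ideals: the ideal of the multiples of the greatest common divisor of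
    [X], defined without unique factorisation. *)
Definition divisorial_hull (X : set U) : set U :=
  [set u | forall a b : U, b != 0 -> (forall f, X f -> mdvd b (a * f)) -> mdvd b (a * u)].

Lemma divisorial_hull_ideal X : is_ideal (divisorial_hull X).
Proof.
split=> [a b _ _|f g hf hg a b b0 hX|f g hg a b b0 hX].
- by exists 0; rewrite !mulr0.
- have [x xE] := hf a b b0 hX; have [y yE] := hg a b b0 hX.
  by exists (x + y); rewrite !mulrDr xE yE.
- by rewrite mulrCA; apply: mdvd_mull; apply: hg.
Qed.

Lemma sub_divisorial_hull X : X `<=` divisorial_hull X.
Proof. by move=> f Xf a b _; apply. Qed.

(** In dimension at least two the linear forms through a point have no common
    factor, so multiplication by them does not shrink the divisorial hull. *)
Lemma divisorial_hull_mono I d : (3 <= n)%N -> left_family I ->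
  divisorial_hull (I d) `<=` divisorial_hull (I d.+1).
Proof.
move=> n3 [IR IL IM] u hu a b b0 hX; apply: hu => // f If.
have [l1 [l2 [[h1 h2] [p1 p2] [l10 n21] _]]] := two_linforms n3 (v_neq0 od d).
have Il l : l \is 1.-homog -> l.@[v d] = 0 -> I d.+1 (l * f).
  move=> hl l0; have [i id|r hr <-] := Rn_twn od hl (a := d).
    by have -> : i = d by lia.
  by rewrite -add1n; apply: IM.
have [x1 e1] := hX _ (Il _ h1 p1); have [x2 e2] := hX _ (Il _ h2 p2).
have [y yE] : mdvd l1 x1.
  apply: (linform_prime h1 h2 l10 n21); exists x2; apply: (mulfI b0).
  by rewrite mulrCA -e1 [RHS]mulrCA -e2; ring.
exists y; apply: (mulfI l10); rewrite [RHS]mulrCA -yE -e1; ring.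
Qed.

Lemma left_family_nonzero I d f : left_family I -> I d f -> f != 0 ->
  forall m, (d <= m)%N -> exists2 g, I m g & g != 0.
Proof.
case=> _ _ IM If f0 m dm.
have [|||e [he e1 e0]] := @separating_form _ _ v (iota 0 (m - d)) (m - d) (m - d).
- by move=> j; rewrite mem_iota => jm; apply: (od_distinct od); lia.
- exact: v_neq0 od _.
- by rewrite size_iota.
exists (twn d e * f).
  rewrite -(subnK dm); apply: IM => //; split=> // i im.
  by apply: e0; rewrite mem_iota.
rewrite mulf_neq0 // twn_eq0; apply: contraNneq (oner_neq0 k) => e'.
by rewrite -e1 e' meval0.
Qed.

(** If left multiplication by [sigma^-1 alpha] maps the graded left ideal [I] to itself,
    then this fraction belongs to the algebra. Its degree is not negative, by a
    nonzero element of [I] of minimal degree. The divisorial hulls of the pieces of [I] form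
    an increasing chain of ideals; once the chain is stationary, the fraction, moved by
    the automorphism, preserves its last member, so it is a polynomial [h] because
    polynomial rings are completely integrally closed. Finally [h] vanishes at [c_i], because
    some element of [I] does not vanish at a translate of this point where its
    product with [h] does. *)
Theorem graded_fraction_in_Rn I p p' sigma alpha :
  (3 <= n)%N -> left_family I -> (exists m f, I m f /\ f != 0) ->
  Rn p sigma -> sigma != 0 -> Rn p' alpha -> alpha != 0 ->
  (forall m f, I m f -> f != 0 -> exists m' g,
     [/\ I m' g, (m' + p = m + p')%N & twn m' sigma * g = twn m alpha * f]) ->
  (p <= p')%N /\ exists2 h, Rn (p' - p) h & alpha = twn (p' - p) sigma * h.
Proof.
move=> n3 hI ex [hs _] s0 [ha _] a0 H; have [IR IL IM] := hI.
have ex' : exists m, `[< exists2 f, I m f & f != 0 >].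
  by case: ex => m [f [If f0]]; exists m; apply/asboolP; exists f.
case: (ex_minnP ex') => d0 /asboolP[f0 If0 f00] dmin.
have pp : (p <= p')%N.
  have [m' [g [Ig e E]]] := H _ _ If0 f00.
  have /dmin : `[< exists2 f, I m' f & f != 0 >].
    apply/asboolP; exists g => //; apply: contra_neq f00 => g0; apply/eqP.
    by move/eqP: E; rewrite g0 mulr0 eq_sym mulf_eq0 twn_eq0 (negPf a0).
  by lia.
split=> //; set e := (p' - p)%N.
have H' m f : I m f -> f != 0 -> exists2 g, I (m + e)%N g & twn (m + e) sigma * g = twn m alpha * f.
  move=> If fn0; have [m' [g [Ig mE E]]] := H m f If fn0.
  have <- : m' = (m + e)%N by rewrite /e; lia.
  by exists g.
pose E d := divisorial_hull (I d).
have [N hN] := ideal_chain_stable (fun d => divisorial_hull_ideal (I d))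
                 (fun d => divisorial_hull_mono (d := d) n3 hI).
have Emono d d' : (d <= d')%N -> E d `<=` E d'.
  elim: d' => [|d' IH]; first by rewrite leqn0 => /eqP->.
  rewrite leq_eqVlt => /predU1P[->//|/IH dd].
  exact: subset_trans dd (divisorial_hull_mono n3 hI).
pose d := maxn N d0; have Nd : (N <= d)%N by apply: leq_maxl.
have [f If fn0] := left_family_nonzero hI If0 f00 (leq_maxr N d0 : (d0 <= d)%N).
pose beta := twn (d + e) sigma; pose gamma := twn d alpha.
have b0 : beta != 0 by rewrite twn_eq0.
have step u : E N u -> exists2 w, E N w & gamma * u = beta * w.
  move=> /(Emono _ _ Nd) Eu; have [w wE] : mdvd beta (gamma * u).
    apply: Eu => // g Ig; have [->|g0] := eqVneq g 0; first by exists 0; rewrite !mulr0.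
    by have [g' _ <-] := H' _ _ Ig g0; exists g'.
  exists w => //; apply: (hN (d + e)%N); first by rewrite (leq_trans Nd) ?leq_addr.
  move=> a b bn0 hX; have [|y yE] := Eu (a * gamma) (beta * b) (mulf_neq0 b0 bn0).
    move=> g Ig; have [->|g0] := eqVneq g 0; first by exists 0; rewrite !mulr0.
    have [g' Ig' gE] := H' _ _ Ig g0; have [z zE] := hX _ Ig'.
    by exists z; rewrite -!mulrA -gE -zE; ring.
  by exists y; apply: (mulfI b0); rewrite [RHS]mulrA -yE -mulrA wE; ring.
have [h0 h0E] : mdvd beta gamma.
  apply: (completely_integrally_closed b0 fn0) => j.
  suff [w _ wE] : exists2 w, E N w & gamma ^+ j * f = beta ^+ j * w by exists w.
  elim: j => [|j [w Ew wE]]; first by exists f => //; apply: (hN d) => //; apply: sub_divisorial_hull.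
  by have [w' Ew' w'E] := step w Ew; exists w' => //; rewrite !exprS -mulrA wE mulrCA w'E; ring.
have hh0 : h0 \is e.-homog.
  have hb : beta \is p.-homog by apply: twn_homog.
  apply: (homog_quotient hb b0); rewrite mulrC -h0E /e subnKC //.
  exact: twn_homog.
have [h hh hE] := twn_surj_homog Phi d hh0.
have alphaE : alpha = twn e sigma * h.
  by apply: (@twn_inj _ _ Phi d); rewrite rmorphM /= hE -twnD.
exists h => //; split=> // i ie.
have [N' hN'] := od_dense od (proj1 (IR _ _ If0)) f00.
have [|||r [hr r1 r0]] := @separating_form _ _ v (iota 0 N') (N' + i) N'.
- by move=> j; rewrite mem_iota => jm; apply: (od_distinct od); clear -jm; lia.
- exact: v_neq0 od _.
- by rewrite size_iota.
have Rr : Rn N' r by split=> // j jN; apply: r0; rewrite mem_iota.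
(* An element of [I] that does not vanish at the translate of [c_i] by [N' + d0]. *)
pose x := twn d0 r * f0; have Ix : I (N' + d0)%N x by apply: IM.
have vx : x.@[v (d0 + (N' + i))%N] != 0.
  by rewrite mevalM (twn_eval od) r1 mul1r hN' // (leq_trans (leq_addr i N')) ?leq_addl.
have x0 : x != 0 by apply: contraNneq vx => ->; rewrite meval0.
have [g Ig gE] := H' _ _ Ix x0.
have {gE} gE : g = twn (N' + d0) h * x.
  have sn0 : twn (N' + d0 + e) sigma != 0 by rewrite twn_eq0.
  by apply: (mulfI sn0); rewrite gE alphaE rmorphM /= -twnD [RHS]mulrA.
have [_ /(_ (d0 + (N' + i))%N)] := IR _ _ Ig.
rewrite gE mevalM addnA [(d0 + N')%N]addnC (twn_eval od) => g0.
have /g0/eqP : (N' + d0 + i < N' + d0 + e)%N by rewrite ltn_add2l.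
by rewrite mulf_eq0 -[(N' + d0)%N]addnC -addnA (negPf vx) orbF => /eqP.
Qed.

End Graded.

(** * Components in the twisted algebra *)

Section Components.
Variables (k : fieldType) (n : nat) (Phi : gr_aut k n).
Local Notation U := {mpoly k[n]}.
Local Notation S := (twist_grAlg Phi).
Local Notation twn := (twn Phi).
Implicit Types (x y z : S) (f g : U).

Definition cmp m x : U := pihomog mdeg m (x : U).

Lemma cmp_homog m x : cmp m x \is m.-homog.
Proof. exact: pihomogP. Qed.

Lemma cmpB m x y : cmp m (x - y) = cmp m x - cmp m y.
Proof. exact: (raddfB (pihomog mdeg m)). Qed.

Lemma cmpD m x y : cmp m (x + y) = cmp m x + cmp m y.
Proof. exact: (raddfD (pihomog mdeg m)). Qed.

Lemma cmpZ m (a : k) x : cmp m (a *: x) = a *: cmp m x.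
Proof. by rewrite /cmp -[LHS]/(pihomog mdeg m (a *: (x : U))) linearZ. Qed.

Lemma cmp0 m : cmp m 0 = 0.
Proof. exact: (raddf0 (pihomog mdeg m)). Qed.

Lemma cmp_sum m I (r : seq I) (P : pred I) (F : I -> S) :
  cmp m (\sum_(i <- r | P i) F i) = \sum_(i <- r | P i) cmp m (F i).
Proof. exact: (raddf_sum (pihomog mdeg m)). Qed.

Lemma cmp_id m f : f \is m.-homog -> cmp m (f : S) = f.
Proof. exact: pihomog_dE. Qed.

Lemma cmp_other m d f : f \is d.-homog -> m != d -> cmp m (f : S) = 0.
Proof. by move=> hf md; apply: (pihomog_ne0 _ hf); rewrite eq_sym. Qed.

Lemma cmp_expand N x : (msize (x : U) <= N)%N -> x = \sum_(m < N) cmp m x.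
Proof. exact: pihomog_sum_all. Qed.

Lemma cmp_inj x y : (forall m, cmp m x = cmp m y) -> x = y.
Proof.
move=> h; rewrite (cmp_expand (leq_maxl (msize (x : U)) (msize (y : U)))).
rewrite [RHS](cmp_expand (leq_maxr (msize (x : U)) (msize (y : U)))).
by apply: eq_bigr => m _.
Qed.

Lemma cmp_eq0 x : (forall m, cmp m x = 0) -> x = 0.
Proof. by move=> h; apply: cmp_inj => m; rewrite h cmp0. Qed.

Lemma cmp_large x m : (msize (x : U) <= m)%N -> cmp m x = 0.
Proof. exact: pihomog_geq. Qed.

Lemma twist_mul_homogE x (g : U) d : g \is d.-homog -> x * (g : S) = twn d x * g :> U.
Proof. exact: twist_mul_homog. Qed.

Lemma cmp_mul m x y :
  cmp m (x * y) = \sum_(d < m.+1) twn d (cmp (m - d) x) * cmp d y.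
Proof.
set N := maxn (msize (y : U)) m.+1.
have -> : x * y = \sum_(d < N) (twn d x * cmp d y : U).
  exact: (twist_mulE Phi x (leq_maxl (msize (y : U)) m.+1)).
rewrite cmp_sum (big_ord_widen N (fun d => twn d (cmp (m - d) x) * cmp d y)) ?leq_maxr //.
rewrite [RHS]big_mkcond; apply: eq_bigr => d _; rewrite ltnS.
have [dm|md] := leqP d m.
  by rewrite /cmp (pihomog_mulr _ (cmp_homog d y)) // pihomog_twn.
rewrite /cmp {1}(pihomog_sum_all (leqnn (msize (twn d x)))) mulr_suml raddf_sum big1 // => i _.
apply: (@pihomog_ne0 _ _ _ (i + d)%N); first by rewrite neq_ltn (leq_trans md) ?orbT ?leq_addl.
by apply: dhomogM; apply: pihomogP.
Qed.

Definition below N x := forall m, (N <= m)%N -> cmp m x = 0.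

Lemma below_ex x : exists N, below N x.
Proof. by exists (msize (x : U)) => m; apply: cmp_large. Qed.

Lemma below_mul N M x y : below N.+1 x -> below M.+1 y ->
  below (N + M).+1 (x * y) /\ cmp (N + M) (x * y) = twn M (cmp N x) * cmp M y.
Proof.
move=> bx yb; split=> [m mN|].
  rewrite cmp_mul big1 // => d _; have [dM|Md] := leqP d M.
    by rewrite bx ?raddf0 ?mul0r //; lia.
  by rewrite yb ?mulr0.
have MN : (M < (N + M).+1)%N by lia.
rewrite cmp_mul (bigD1 (Ordinal MN)) //= addnK big1 ?addr0 // => d dM.
have [dM'|Md] := ltnP d M; first by rewrite bx ?raddf0 ?mul0r //; lia.
rewrite yb ?mulr0 //; rewrite ltn_neqAle Md andbT.
by apply: contra_neq dM => e; apply: val_inj.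
Qed.

Lemma lead_ex x : x <> 0 -> exists N, below N.+1 x /\ cmp N x != 0.
Proof.
move=> x0; have ex : exists m, cmp m x != 0.
  apply: contrapT => h; apply: x0; apply: cmp_eq0 => m.
  by apply/eqP/negPn/negP => hm; apply: h; exists m.
have bd m : cmp m x != 0 -> (m <= msize (x : U))%N.
  by apply: contraNT; rewrite -ltnNge => /ltnW/cmp_large/eqP.
case: (ex_maxnP ex bd) => N N0 Nmax; exists N; split=> // m Nm.
by apply/eqP/negPn/negP => /Nmax; rewrite leqNgt Nm.
Qed.

Lemma below_drop N x y : below N.+1 x -> below N.+1 y -> cmp N x = cmp N y -> below N (x - y).
Proof.
move=> bx yb e m; rewrite leq_eqVlt cmpB => /predU1P[<-|Nm]; first by rewrite e subrr.
by rewrite bx // yb // subrr.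
Qed.

Lemma twist_domain x y : x * y = 0 -> x = 0 \/ y = 0.
Proof.
move=> xy0; have [x0|/lead_ex[N [bx cx]]] := pselect (x = 0); first by left.
have [y0|/lead_ex[M [yb cy]]] := pselect (y = 0); first by right.
have [_ /eqP] := below_mul bx yb.
by rewrite xy0 cmp0 eq_sym mulf_eq0 twn_eq0 (negPf cx) (negPf cy).
Qed.

End Components.

(** * The subalgebra, its left ideals and its opposite *)

Section Subalgebra.
Variables (k : closedFieldType) (n : nat) (Phi : gr_aut k n) (v : nat -> 'I_n -> k).
Local Notation U := {mpoly k[n]}.
Local Notation S := (twist_grAlg Phi).
Local Notation twn := (twn Phi).
Local Notation Rn := (Rn v).
Implicit Types (x y z : S) (f g : U).

Definition Rset : set S := [set x | forall m, Rn m (cmp m x)].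

Lemma Rset_homog m f : Rn m f -> Rset (f : S).
Proof.
move=> Rf d; have hf := proj1 Rf; have [->|dm] := eqVneq d m; first by rewrite cmp_id.
by rewrite (cmp_other Phi hf) //; case: (Rn_lin_closed v d).
Qed.

Lemma RsetD a x y : Rset x -> Rset y -> Rset (a *: x + y).
Proof. by move=> Rx Ry m; rewrite cmpD cmpZ; case: (Rn_lin_closed v m) => _; apply. Qed.

Lemma RsetB x y : Rset x -> Rset y -> Rset (x - y).
Proof. by move=> Rx Ry; rewrite addrC -scaleN1r; apply: RsetD. Qed.

Hypothesis od : orbit_data Phi v.

Lemma Rset_mul x y : Rset x -> Rset y -> Rset (x * y).
Proof.
move=> Rx Ry m; rewrite cmp_mul; apply: big_ind.
- by case: (Rn_lin_closed v m).
- by move=> f g Rf Rg; rewrite -[f]scale1r; case: (Rn_lin_closed v m) => _; apply.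
- by move=> d _; have := Rn_mul od (Rx (m - d)%N) (Ry d); rewrite subnK // -ltnS.
Qed.

Definition left_ideal_of (J : set S) : Prop :=
  [/\ J `<=` Rset, J 0, forall x y, J x -> J y -> J (x - y) & forall r x, Rset r -> J x -> J (r * x)].

(** Zero is allowed as a leading form, so that the pieces are subspaces. *)
Definition lead_pieces (J : set S) (m : nat) : set U :=
  [set f | exists x, [/\ J x, below m.+1 x & cmp m x = f]].

Lemma scalar_in_Rset (a : k) : Rset (a *: 1).
Proof.
apply: (@Rset_homog 0); split=> //; apply: rpredZ; exact: dhomog1.
Qed.

Lemma lead_pieces_left_family J : left_ideal_of J -> left_family Phi v (lead_pieces J).
Proof.
move=> [JR J0 JB JM]; split=> [m f [x [/JR Jx _ <-]]|m|m m' r f Rr [x [Jx bx <-]]].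
- exact: Jx.
- split; first by exists 0; split=> // [d _|]; rewrite cmp0.
  move=> a _ _ [x [Jx bx <-]] [y [Jy yb <-]]; exists (a *: x + y); split.
  + have -> : a *: x + y = (a *: 1) * x - (0 - y) by rewrite sub0r opprK -scalerAl mul1r.
    apply: (JB); last exact: JB.
    by apply: JM => //; apply: scalar_in_Rset.
  + by move=> d md; rewrite cmpD cmpZ bx // yb // scaler0 addr0.
  + by rewrite cmpD cmpZ.
- exists ((r : S) * x); have [br e] : below m.+1 (r : S) /\ cmp m (r : S) = r.
    have hr := proj1 Rr; split; last exact: cmp_id.
    by move=> d md; apply: (cmp_other Phi hr); rewrite neq_ltn md orbT.
  have [b E] := below_mul br bx; split=> //; last by rewrite E e.
  by apply: JM => //; apply: Rset_homog Rr.
Qed.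

(** Nested left ideals with the same leading forms are equal, by induction on the degree
    of their elements. *)
Lemma left_ideal_chain (J : nat -> set S) : (forall s, left_ideal_of (J s)) ->
  (forall s, J s `<=` J s.+1) -> exists N, forall s, (N <= s)%N -> J s `<=` J N.
Proof.
move=> hJ JS; have [|s m f [x [Jx bx cx]]|N hN] :=
    @left_family_chain _ _ Phi v od (fun s => lead_pieces (J s)).
- by move=> s; apply: lead_pieces_left_family.
- by exists x; split=> //; apply: JS.
exists N => s Ns x Jx; have [M bx] := below_ex x; elim: M x Jx bx => [|M IH] x Jx bx.
  by rewrite (cmp_eq0 (fun m => bx m (leq0n m))); case: (hJ N).
have [|y [Jy yb e]] := hN s M Ns (cmp M x); first by exists x.
have Jsy : J s y.
  elim: (s) Ns {Jx hN IH} => [|s' IH]; first by rewrite leqn0 => /eqP <-.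
  by rewrite leq_eqVlt => /predU1P[<-//|/IH]; apply: JS.
have JB i : forall x y, J i x -> J i y -> J i (x - y) by case: (hJ i).
have Jxy : J N (x - y).
  by apply: IH; [apply: JB|apply: below_drop].
have -> : x = (x - y) - (0 - y) by rewrite sub0r opprK subrK.
by apply: (JB) => //; apply: (JB) => //; case: (hJ N).
Qed.

(** Induction on the degree of [a]: the leading forms of [J] are the pieces of a graded left
    ideal preserved by the fraction of the leading forms of [s] and [a]. This
    fraction is therefore in the algebra, and subtracting its product with [s]
    from [a] lowers the degree. *)
Lemma left_fraction_in_Rset J s a : (3 <= n)%N -> left_ideal_of J -> (exists2 x, J x & x <> 0) ->
  Rset s -> s <> 0 -> Rset a -> (forall x, J x -> exists2 y, J y & s * y = a * x) ->
  exists2 h, Rset h & a = s * h.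
Proof.
move=> n3 hJ [z Jz z0] Rs s0; have [p [bs cs]] := lead_ex s0.
have [M] := below_ex a; elim: M a => [|M IH] a ba Ra H.
  exists 0; last by rewrite mulr0 (cmp_eq0 (fun m => ba m (leq0n m))).
  by case: hJ => + J0 _ _; apply.
have [a0|a0] := pselect (cmp M a = 0).
  apply: IH => // m; rewrite leq_eqVlt => /predU1P[<-//|]; exact: ba.
have hF := lead_pieces_left_family hJ.
have [JR J0 JB JM] := hJ.
have [||pM [h Rh hE]] := @graded_fraction_in_Rn _ _ _ _ od _ _ _ _ _ n3 hF _ (Rs p) cs (Ra M) (introN eqP a0).
- have [d [bz cz]] := lead_ex z0; exists d, (cmp d z); split=> //.
  by exists z.
- move=> m f [x [Jx bx <-]] cx; have [y Jy yE] := H x Jx.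
  have y0 : y <> 0.
    move=> y0; have [_] := below_mul ba bx; rewrite -yE y0 mulr0 cmp0 => /esym/eqP.
    by rewrite mulf_eq0 twn_eq0 (negPf cx) orbF => /eqP.
  have [m' [yb cy]] := lead_ex y0; exists m', (cmp m' y).
  have [b1 e1] := below_mul bs yb; have [b2 e2] := below_mul ba bx.
  have mE : (p + m' = M + m)%N.
    have neq0 (r t : S) i j : cmp i r != 0 -> cmp j t != 0 -> twn j (cmp i r) * cmp j t != 0.
      by move=> hr ht; rewrite mulf_neq0 // twn_eq0.
    apply/eqP; rewrite eqn_leq; apply/andP; split; rewrite leqNgt; apply/negP => lt.
      have /eqP := neq0 _ _ _ _ cs cy; apply.
      by rewrite -e1 yE b2.
    have /eqP := neq0 _ _ _ _ (introN eqP a0) cx; apply.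
    by rewrite -e2 -yE b1.
  split; first by exists y.
    by rewrite addnC mE addnC.
  by rewrite -e1 -e2 yE mE.
have [bh ch] : below (M - p).+1 (h : S) /\ cmp (M - p) (h : S) = h.
  have hh := proj1 Rh; split; last exact: cmp_id.
  by move=> d md; apply: (cmp_other Phi hh); rewrite neq_ltn md orbT.
have Rh' : Rset (h : S) := Rset_homog Rh.
have [b e] := below_mul bs bh; rewrite ch subnKC // in b e.
have [||x Jx|h' Rh'' h'E] := IH (a - s * (h : S)).
- by apply: below_drop; rewrite // e.
- by apply: RsetB => //; apply: Rset_mul.
- have [y Jy yE] := H x Jx; exists (y - (h : S) * x); first by apply: JB => //; apply: JM.
  by rewrite mulrBr mulrBl yE mulrA.
exists ((h : S) + h').
  by rewrite -[X in X + _]scale1r; apply: RsetD.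
by rewrite mulrDr -h'E addrC subrK.
Qed.

End Subalgebra.

(** A bi-infinite orbit, cut into two half-orbits that are traversed in opposite
    directions. *)
Record bi_orbit (k : fieldType) (n : nat) (Phi Psi : gr_aut k n) (v v' : nat -> 'I_n -> k) : Prop :=
  BiOrbit {
    bo_left : orbit_data Phi v;
    bo_right : orbit_data Psi v';
    bo_PhiK : cancel Phi Psi;
    bo_PsiK : cancel Psi Phi;
    bo_link : forall f, (Phi f).@[v 0%N] = f.@[v' 0%N]
  }.

Lemma bi_orbit_sym (k : fieldType) (n : nat) (Phi Psi : gr_aut k n) v v' :
  bi_orbit Phi Psi v v' -> bi_orbit Psi Phi v' v.
Proof. by case=> od od' K K' l; split=> // f; rewrite -l K'. Qed.

Section Opposite.
Variables (k : closedFieldType) (n : nat) (Phi Psi : gr_aut k n) (v v' : nat -> 'I_n -> k).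
Hypothesis bo : bi_orbit Phi Psi v v'.
Local Notation U := {mpoly k[n]}.

Lemma twn_cancel d : cancel (twn Phi d) (twn Psi d).
Proof.
elim: d => [//|d IH] f.
by rewrite -[twn Phi d.+1 f]/(Phi (twn Phi d f)) /twn iterSr (bo_PhiK bo); apply: IH.
Qed.

Lemma twn_eval_back j l (f : U) : (twn Phi j f).@[v' l] = f.@[v' (l + j)%N].
Proof.
elim: j l => [|j IH] l; first by rewrite addn0.
rewrite -[twn Phi j.+1 f]/(Phi (twn Phi j f)) addnS -addSn -IH.
by rewrite -(od_eval (bo_right bo) l) (bo_PhiK bo).
Qed.

Lemma Rn_opposite m (f : U) : Rn v' m f -> Rn v m (twn Phi m f).
Proof.
move=> [hf f0]; split=> [|i im]; first exact: twn_homog.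
have := twn_eval (bo_left bo) i 0 (twn Phi (m - i).-1.+1 f).
rewrite addn0 -twnD {1}prednK ?subn_gt0 // subnKC 1?ltnW // => ->.
rewrite -[twn Phi _.+1 f]/(Phi (twn Phi (m - i).-1 f)) (bo_link bo).
by rewrite twn_eval_back f0 //; lia.
Qed.

(** For [Psi] inverse to [Phi], an anti-isomorphism of the twisted algebras: it carries
    left ideals to right ideals, so that the results about right ideals follow
    from those about left ideals. *)
Definition opp_map (x : twist_grAlg Phi) : twist_grAlg Psi :=
  \sum_(m < msize (x : U)) (twn Psi m (cmp m x) : twist_grAlg Psi).

Lemma cmp_opp_map m x : cmp m (opp_map x) = twn Psi m (cmp m x).
Proof.
have hom d : twn Psi d (cmp d x) \is d.-homog by apply: twn_homog; apply: cmp_homog.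
rewrite cmp_sum; have [mx|xm] := ltnP m (msize (x : U)).
  rewrite (bigD1 (Ordinal mx)) //= cmp_id // big1 ?addr0 // => d dm.
  apply: (cmp_other Psi (hom d)); apply: contra_neq dm => e; exact: val_inj.
rewrite cmp_large // raddf0 big1 // => d _.
by apply: (cmp_other Psi (hom d)); rewrite neq_ltn (leq_trans (ltn_ord d) xm) orbT.
Qed.

Lemma opp_mapB : {morph opp_map : x y / x - y}.
Proof. by move=> x y; apply: cmp_inj => m; rewrite cmpB !cmp_opp_map cmpB raddfB. Qed.

Lemma opp_map0 : opp_map 0 = 0.
Proof. by apply: cmp_inj => m; rewrite cmp_opp_map !cmp0 raddf0. Qed.

Lemma opp_mapM x y : opp_map (x * y) = opp_map y * opp_map x.
Proof.
apply: cmp_inj => m; rewrite cmp_opp_map !cmp_mul raddf_sum /=.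
rewrite [RHS](reindex_inj rev_ord_inj) /=; apply: eq_bigr => d _.
have dm : (d <= m)%N by rewrite -ltnS.
rewrite !subSS subKn // !cmp_opp_map -twnD subnK // rmorphM /= mulrC; congr (_ * _).
by rewrite -{1}(subnK dm) twnD twn_cancel.
Qed.

Lemma opp_map_Rset x : Rset v x -> (forall m f, Rn v m f -> Rn v' m (twn Psi m f)) -> Rset v' (opp_map x).
Proof. by move=> Rx h m; rewrite cmp_opp_map; apply: h. Qed.

End Opposite.

Section RightIdeals.
Variables (k : closedFieldType) (n : nat) (Phi Psi : gr_aut k n) (v v' : nat -> 'I_n -> k).
Hypothesis bo : bi_orbit Phi Psi v v'.
Local Notation S := (twist_grAlg Phi).
Local Notation op := (opp_map (Phi := Phi) Psi).
Local Notation po := (opp_map (Phi := Psi) Phi).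

Let bo' : bi_orbit Psi Phi v' v := bi_orbit_sym bo.

Lemma opp_mapK : cancel op po.
Proof. by move=> x; apply: cmp_inj => m; rewrite !cmp_opp_map (twn_cancel bo'). Qed.

Definition right_ideal_of (J : set S) : Prop :=
  [/\ J `<=` Rset v, J 0, forall x y, J x -> J y -> J (x - y) &
      forall r x, Rset v r -> J x -> J (x * r)].

Lemma right_ideal_opposite J : right_ideal_of J -> left_ideal_of v' (fun y => J (po y)).
Proof.
move=> [JR J0 JB JM].
have Rpo y : Rset v' y -> Rset v (po y).
  by move=> Ry; apply: opp_map_Rset Ry _ => m f; apply: (Rn_opposite bo).
split=> [y /JR Ry||x y Jx Jy|r y Rr Jy].
- rewrite -[y](_ : op (po y) = y); first by apply: opp_map_Rset => // m f; apply: (Rn_opposite bo').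
  by apply: cmp_inj => m; rewrite !cmp_opp_map (twn_cancel bo).
- by rewrite opp_map0.
- by rewrite opp_mapB; apply: JB.
- by rewrite (opp_mapM bo'); apply: JM => //; apply: Rpo.
Qed.

Lemma right_ideal_chain (J : nat -> set S) : (forall s, right_ideal_of (J s)) ->
  (forall s, J s `<=` J s.+1) -> exists N, forall s, (N <= s)%N -> J s `<=` J N.
Proof.
move=> hJ JS; have [|s y|N hN] := @left_ideal_chain _ _ Psi v' (bo_right bo) (fun s y => J s (po y)).
- by move=> s; apply: right_ideal_opposite.
- exact: JS.
exists N => s Ns x Jx; have := hN s Ns (op x); rewrite opp_mapK; exact.
Qed.

Lemma right_fraction_in_Rset J s a : (3 <= n)%N -> right_ideal_of J -> (exists2 x, J x & x <> 0) ->
  Rset v s -> s <> 0 -> Rset v a -> (forall x, J x -> exists2 y, J y & y * s = x * a) ->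
  exists2 h, Rset v h & a = h * s.
Proof.
move=> n3 hJ [z Jz z0] Rs s0 Ra H.
have Rop x : Rset v x -> Rset v' (op x).
  by move=> Rx; apply: opp_map_Rset Rx _ => m f; apply: (Rn_opposite bo').
have op0 x : x <> 0 -> op x <> 0 by move=> x0 /(congr1 po); rewrite opp_mapK opp_map0.
have [|y Jy|h Rh hE] := left_fraction_in_Rset (bo_right bo) n3 (right_ideal_opposite hJ) _ (Rop _ Rs) (op0 _ s0) (Rop _ Ra).
- by exists (op z); [rewrite opp_mapK|apply: op0].
- have [w Jw wE] := H _ Jy; exists (op w); first by rewrite opp_mapK.
  have -> : y = op (po y) by apply: cmp_inj => m; rewrite !cmp_opp_map (twn_cancel bo).
  by rewrite -!(opp_mapM bo) wE.
exists (po h); first by apply: opp_map_Rset Rh _ => m f; apply: (Rn_opposite bo).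
by rewrite -[a]opp_mapK hE (opp_mapM bo') opp_mapK.
Qed.

End RightIdeals.

(** * Generation by linear forms *)

Section Generated.
Variables (k : closedFieldType) (t : nat) (Phi Psi : gr_aut k t.+1) (v v' : nat -> 'I_t.+1 -> k).
Variable c : pt k t.
Hypothesis bo : bi_orbit Phi Psi v v'.
Hypothesis vc : forall f : {mpoly k[t.+1]}, f \is 1.-homog -> vanishes f c <-> f.@[v 0%N] = 0.
Local Notation U := {mpoly k[t.+1]}.
Local Notation S := (twist_grAlg Phi).
Local Notation A := (Ralg Phi c).

Let od : orbit_data Phi v := bo_left bo.

Lemma lin_formsE (f : S) : lin_forms_at c f <-> Rn v 1 f.
Proof.
split=> [[h1 /vc h2]|[h1 h2]]; last by split=> //; apply/vc => //; apply: h2.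
by split=> // i; rewrite ltnS leqn0 => /eqP->; apply: h2.
Qed.

Lemma subalg_sum (T : set S) J (r : seq J) (F : J -> S) :
  is_subalg T -> (forall i, T (F i)) -> T (\sum_(i <- r) F i).
Proof.
move=> [T1 TL TM] h; apply: big_rec => [|i x _ Tx]; last by rewrite -[F i]scale1r; apply: TL.
by rewrite -(subrr 1) addrC -scaleN1r; apply: TL.
Qed.

Lemma Rset_subalg : is_subalg (Rset v : set S).
Proof.
split; first by rewrite -[1]scale1r; apply: scalar_in_Rset.
- by move=> a x y; apply: RsetD.
- exact: Rset_mul.
Qed.

Lemma Rn_in_subalg (T : set S) : is_subalg T -> (forall f, Rn v 1 f -> T (f : S)) ->
  forall m f, Rn v m f -> T (f : S).
Proof.
move=> hT T1; have [T1' TL TM] := hT; elim=> [|m IH] f Rf.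
  rewrite (homog0_const (proj1 Rf)) -alg_mpolyC.
  rewrite -[_%:A]addr0; apply: (TL) => //.
  by rewrite -(subrr (1 : S)) addrC -scaleN1r; apply: TL.
have [l Rl [g Rg ->]] := Rn_generated od Rf.
have -> : \sum_i twn Phi m (l i) * g i = \sum_i (l i : S) * (g i : S) :> S.
  by apply: eq_bigr => i _; rewrite (@twist_mul_homogE _ _ Phi (l i) (g i) m) //; case: (Rg i).
by apply: subalg_sum => // i; apply: TM; [apply: T1|apply: IH].
Qed.

Lemma gen_subalgE (x : S) : gen_subalg (lin_forms_at c) x <-> Rset v x.
Proof.
split=> [h|Rx T hT hX].
  by apply: (h (Rset v) Rset_subalg) => f /lin_formsE; apply: Rset_homog.
rewrite (cmp_expand (leqnn (msize (x : U)))).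
apply: subalg_sum => // m; apply: (Rn_in_subalg hT _ (Rx m)) => f /lin_formsE; exact: hX.
Qed.

Lemma Ralg_val_Rset (x : A) : Rset v (\val x).
Proof. by apply/gen_subalgE; case: x => x hx; apply/asboolP. Qed.

Lemma Ralg_of_Rset (x : S) : Rset v x -> exists y : A, \val y = x.
Proof.
by move=> /gen_subalgE hx; exists (SubalgOf (introT (asboolP _) hx)).
Qed.

Lemma Ralg_connected : connected_gr A.
Proof.
move=> x; split=> [hx|[a ->]]; last by apply: ga_scale; apply: ga_one.
have hx' : (\val x : U) \is 0.-homog by exact: hx.
exists ((\val x : U)@_0%MM); apply: val_inj.
by rewrite linearZ rmorph1 /= [LHS](homog0_const hx') -alg_mpolyC.
Qed.

Lemma Ralg_fin_gen : fin_gen_deg1 A.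
Proof.
have [c0 vc0] := v_neq0 od 0.
have R1 i : Rn v 1 (pt_form (v 0%N) c0 i).
  split=> [|j]; first exact: pt_form_homog.
  by rewrite ltnS leqn0 => /eqP->; apply: pt_form_eval.
have /choice[y yE] : forall i, exists y : A, \val y = (pt_form (v 0%N) c0 i : S).
  by move=> i; apply: Ralg_of_Rset; apply: Rset_homog (R1 i).
exists [seq y i | i <- enum 'I_t.+1]; split.
  by move=> _ /mapP[i _ ->]; rewrite /ga_deg /= /gen_deg /= yE; case: (R1 i).
move=> x T [T1 TL TM] sT.
suff : [set z : S | exists2 w : A, T w & \val w = z] (\val x).
  by case=> w Tw /val_inj <-.
have hT' : is_subalg [set z : S | exists2 w : A, T w & \val w = z].
  split; first by exists 1 => //; rewrite rmorph1.
  - move=> a _ _ [w Tw <-] [w' Tw' <-]; exists (a *: w + w'); first exact: TL.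
    by rewrite linearP.
  - move=> _ _ [w Tw <-] [w' Tw' <-]; exists (w * w'); first exact: TM.
    by rewrite rmorphM.
have := Ralg_val_Rset x => /gen_subalgE; apply=> // f /lin_formsE[hf f0].
have [g hg ->] := pt_form_span hf vc0 (f0 0%N isT).
have -> : \sum_i pt_form (v 0%N) c0 i * g i = \sum_i ((g i)@_0%MM *: (pt_form (v 0%N) c0 i : S)) :> S.
  by apply: eq_bigr => i _; rewrite {1}(homog0_const (hg i)) mulrC mul_mpolyC.
apply: subalg_sum => // i; case: hT' => h1 hL hM.
rewrite -[_ *: _]addr0; apply: (hL).
  by exists (y i) => //; apply: sT; rewrite /= map_f ?mem_enum.
by rewrite -(subrr (1 : S)) addrC -scaleN1r; apply: hL.
Qed.

End Generated.

(** * The maximal order property *)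

(** A criterion that does not mention equivalent orders: it is enough that the
    fractions [s^-1 a] and [a s^-1] that map a one-sided ideal to itself belong to [A].
    If [a T b] is contained in [A], then the elements of [a T] preserve the left ideal
    of all [y] with [a T y] in [A], hence [a T] is contained in [A], and then the
    elements of [T] preserve the right ideal of all [y] with [y T] in [A]. *)
Lemma maximal_order_criterion (A Q : nzRingType) (iota : {rmorphism A -> Q}) :
  (forall (J : set A) s a, left_ideal J -> (exists2 x, J x & x <> 0) -> s <> 0 ->
     (forall x, J x -> exists2 y, J y & s * y = a * x) -> exists h, a = s * h) ->
  (forall (J : set A) s a, right_ideal J -> (exists2 x, J x & x <> 0) -> s <> 0 ->
     (forall x, J x -> exists2 y, J y & y * s = x * a) -> exists h, a = h * s) ->
  is_goldie_quotient iota -> is_maximal_order_in iota.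
Proof.
move=> leftP rightP [iinj iinv lfrac rfrac] T [T1 TB TM] AT [a [b [a0 b0 aTb]]].
have reg0 (s : A) : is_regular s -> s <> 0.
  by move=> [rs _] s0; case/eqP: (oner_neq0 A); apply: rs; rewrite s0 !mul0r.
have imB x y : range iota x -> range iota y -> range iota (x - y).
  by move=> [x' _ <-] [y' _ <-]; exists (x' - y'); rewrite // rmorphB.
have imM x y : range iota x -> range iota y -> range iota (x * y).
  by move=> [x' _ <-] [y' _ <-]; exists (x' * y'); rewrite // rmorphM.
have im x : range iota (iota x) by exists x.
have im0 : range iota 0 by exists 0; rewrite // rmorph0.
have aT x : T x -> range iota (iota a * x).
  move=> Tx; have [a' [s [rs E]]] := lfrac (iota a * x).
  pose J : set A := [set y | forall w, T w -> range iota (iota a * w * iota y)].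
  have [||y Jy|h hE] := leftP J s a' _ _ (reg0 s rs).
  - split=> [w _|y z Jy Jz w Tw|r y Jy w Tw].
    + by rewrite rmorph0 mulr0.
    + by rewrite rmorphB mulrBr; apply: imB; [apply: Jy|apply: Jz].
    + by rewrite rmorphM mulrA -(mulrA (iota a)); apply: Jy; apply: TM => //; apply: AT.
  - exists b; [exact: aTb|exact/eqP].
  - have [y' _ y'E] := Jy x Tx; exists y'.
      move=> w Tw; have -> : iota a * w * iota y' = iota a * (w * iota a * x) * iota y.
        by rewrite y'E !mulrA.
      by apply: Jy; apply: (TM) => //; apply: TM => //; apply: AT.
    by apply: iinj; rewrite !rmorphM y'E mulrA E.
  have [s' [_ s'K]] := iinv s rs; exists h => //.
  by rewrite -[iota h]mul1r -s'K -mulrA -rmorphM -hE -E mulrA s'K mul1r.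
apply/seteqP; split=> // x Tx; have [a' [s [rs E]]] := rfrac x.
pose J : set A := [set y | forall w, T w -> range iota (iota y * w)].
have [||y Jy|h hE] := rightP J s a' _ _ (reg0 s rs).
- split=> [w _|y z Jy Jz w Tw|r y Jy w Tw].
  + by rewrite rmorph0 mul0r.
  + by rewrite rmorphB mulrBl; apply: imB; [apply: Jy|apply: Jz].
  + by rewrite rmorphM -mulrA; apply: Jy; apply: TM => //; apply: AT.
- exists a; [exact: aT|exact/eqP].
- have [y' _ y'E] := Jy x Tx; exists y'.
    by move=> w Tw; rewrite y'E -mulrA; apply: Jy; apply: TM.
  by apply: iinj; rewrite !rmorphM y'E -mulrA E.
have [s' [s'K _]] := iinv s rs; exists h => //.
by rewrite -[iota h]mulr1 -s'K mulrA -rmorphM -hE -E -mulrA s'K mulr1.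
Qed.

Section RingLevel.
Variables (k : closedFieldType) (t : nat) (Phi Psi : gr_aut k t.+1) (v v' : nat -> 'I_t.+1 -> k).
Variable c : pt k t.
Hypothesis bo : bi_orbit Phi Psi v v'.
Hypothesis vc : forall f : {mpoly k[t.+1]}, f \is 1.-homog -> vanishes f c <-> f.@[v 0%N] = 0.
Hypothesis ht : (2 <= t)%N.
Local Notation U := {mpoly k[t.+1]}.
Local Notation S := (twist_grAlg Phi).
Local Notation A := (Ralg Phi c).

Let val_img (J : set A) : set S := [set x | exists2 y : A, J y & \val y = x].

Let val_imgE (J : set A) (y : A) : val_img J (\val y) -> J y.
Proof. by case=> z Jz /val_inj <-. Qed.

Lemma left_ideal_val J : left_ideal J -> left_ideal_of v (val_img J).
Proof.
move=> [J0 JB JM]; split=> [_ [y _ <-]||_ _ [y Jy <-] [z Jz <-]|r _ Rr [y Jy <-]].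
- exact: Ralg_val_Rset bo vc _.
- by exists 0; rewrite // raddf0.
- by exists (y - z); [apply: JB|rewrite raddfB].
- have [r' <-] := Ralg_of_Rset bo vc Rr.
  by exists (r' * y); [apply: JM|rewrite rmorphM].
Qed.

Lemma right_ideal_val J : right_ideal J -> right_ideal_of v (val_img J).
Proof.
move=> [J0 JB JM]; split=> [_ [y _ <-]||_ _ [y Jy <-] [z Jz <-]|r _ Rr [y Jy <-]].
- exact: Ralg_val_Rset bo vc _.
- by exists 0; rewrite // raddf0.
- by exists (y - z); [apply: JB|rewrite raddfB].
- have [r' <-] := Ralg_of_Rset bo vc Rr.
  by exists (y * r'); [apply: JM|rewrite rmorphM].
Qed.

Lemma acc_from_chain (P : set A -> Prop) (P' : set S -> Prop) :
  (forall J, P J -> P' (val_img J)) ->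
  (forall J : nat -> set S, (forall s, P' (J s)) -> (forall s, J s `<=` J s.+1) ->
     exists N, forall s, (N <= s)%N -> J s `<=` J N) -> acc P.
Proof.
move=> PP' H J hJ JS; have [s|s _ [y /JS Jy <-]|N hN] := H (fun s => val_img (J s)).
- exact: PP'.
- by exists y.
exists N => s Ns; apply/seteqP; split=> y Jy.
  by apply: val_imgE; apply: hN Ns _ _; exists y.
elim: s Ns => [|s IH]; first by rewrite leqn0 => /eqP <-.
by rewrite leq_eqVlt => /predU1P[<-//|/IH/JS].
Qed.

Lemma Ralg_noetherian : is_noetherian A.
Proof.
split.
  by apply: (acc_from_chain left_ideal_val); apply: left_ideal_chain; apply: bo_left bo.
by apply: (acc_from_chain right_ideal_val); apply: (right_ideal_chain bo).
Qed.

Let val_neq0 (x : A) : x <> 0 -> \val x <> 0 :> S.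
Proof. by move=> x0 e; apply: x0; apply: val_inj; rewrite e raddf0. Qed.

Lemma Ralg_domain : is_domain A.
Proof.
move=> x y xy0; have /twist_domain[e|e] : (\val x : S) * \val y = 0 by rewrite -rmorphM xy0 raddf0.
  by left; apply: val_inj; rewrite e raddf0.
by right; apply: val_inj; rewrite e raddf0.
Qed.

Theorem Ralg_maximal_order : is_maximal_order A.
Proof.
split; [exact: Ralg_noetherian|exact: Ralg_domain|move=> Q iota].
have n3 : (3 <= t.+1)%N by rewrite ltnS.
apply: maximal_order_criterion => J s a hJ [z Jz z0] s0 H.
  have [|x [y Jy <-]|h Rh hE] := left_fraction_in_Rset (bo_left bo) n3 (left_ideal_val hJ) _
      (Ralg_val_Rset bo vc s) (val_neq0 s0) (Ralg_val_Rset bo vc a).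
  - by exists (\val z); [exists z|apply: val_neq0].
  - by have [w Jw wE] := H y Jy; exists (\val w); [exists w|rewrite -!rmorphM wE].
  have [h' h'E] := Ralg_of_Rset bo vc Rh.
  by exists h'; apply: val_inj; rewrite hE -h'E rmorphM.
have [|x [y Jy <-]|h Rh hE] := right_fraction_in_Rset bo n3 (right_ideal_val hJ) _
    (Ralg_val_Rset bo vc s) (val_neq0 s0) (Ralg_val_Rset bo vc a).
- by exists (\val z); [exists z|apply: val_neq0].
- by have [w Jw wE] := H y Jy; exists (\val w); [exists w|rewrite -!rmorphM wE].
have [h' h'E] := Ralg_of_Rset bo vc Rh.
by exists h'; apply: val_inj; rewrite hE -h'E rmorphM.
Qed.

End RingLevel.

(** * From closed points to vectors *)

Section Inverse.
Variables (k : fieldType) (n : nat) (Phi : gr_aut k n).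
Local Notation U := {mpoly k[n]}.

Definition gr_inv (f : U) : U := sval (cid (twn_surj Phi 1 f)).

Lemma gr_invK : cancel gr_inv Phi.
Proof. by move=> f; rewrite /gr_inv; case: cid. Qed.

Lemma gr_autK : cancel Phi gr_inv.
Proof. by move=> f; apply: (@twn_inj _ _ Phi 1); apply: gr_invK. Qed.

Lemma gr_inv_is_additive : {morph gr_inv : x y / x - y}.
Proof. by move=> f g; apply: (can_inj gr_autK); rewrite rmorphB /= !gr_invK. Qed.

Lemma gr_inv_is_multiplicative : multiplicative gr_inv.
Proof.
split=> [f g|]; apply: (can_inj gr_autK).
  by rewrite rmorphM /= !gr_invK.
by rewrite rmorph1 gr_invK.
Qed.

Lemma gr_inv_is_scalable : scalable gr_inv.
Proof. by move=> a f; apply: (can_inj gr_autK); rewrite linearZ /= !gr_invK. Qed.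

HB.instance Definition _ := GRing.isAdditive.Build U U gr_inv gr_inv_is_additive.
HB.instance Definition _ := GRing.isMultiplicative.Build U U gr_inv gr_inv_is_multiplicative.
HB.instance Definition _ := GRing.isScalable.Build k U U *:%R gr_inv gr_inv_is_scalable.

Lemma gr_inv_homog d f : f \is d.-homog -> gr_inv f \is d.-homog.
Proof.
move=> hf; have [g hg gE] := twn_surj_homog Phi 1 hf.
by rewrite (_ : gr_inv f = g) // -gE; apply: gr_autK.
Qed.

Definition gr_aut_inv : gr_aut k n :=
  @GrAut k n gr_inv (Bijective gr_invK gr_autK) gr_inv_homog.

End Inverse.

Lemma lrmorph_eval (k : fieldType) n (F : {lrmorphism {mpoly k[n]} -> {mpoly k[n]}}) f p :
  f.@[fun l => (F 'X_l).@[p]] = (F f).@[p].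
Proof.
rewrite {2}[f]mpolyE raddf_sum raddf_sum mevalE; apply: eq_bigr => m _ /=.
rewrite linearZ mevalZ mpolyXE_id !rmorph_prod; congr (_ * _).
by apply: eq_bigr => i _; rewrite !rmorphXn.
Qed.

Section Representatives.
Variables (k : closedFieldType) (t : nat).
Local Notation U := {mpoly k[t.+1]}.
Local Notation P := (pt k t).

Definition rep (d : P) : 'I_t.+1 -> k := fun i => vpick (sval d) 0 i.

Lemma pt_line (d : P) : sval d = <[vpick (sval d)]>%VS.
Proof.
apply/esym/eqP; rewrite eqEdim -memvE memv_pick (eqP (valP d)) dim_vline vpick0.
by rewrite -dimv_eq0 (eqP (valP d)).
Qed.

Lemma rep_neq0 (d : P) : exists c, rep d c != 0.
Proof.
apply: contrapT => h; have : vpick (sval d) == 0.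
  apply/eqP/rowP => i; rewrite mxE; apply: contrapT => hi; apply: h.
  by exists i; apply/eqP.
by rewrite vpick0 -dimv_eq0 (eqP (valP d)).
Qed.

Lemma homog_eval_scale d (f : U) a p : f \is d.-homog ->
  f.@[fun i => a * p i] = a ^+ d * f.@[p].
Proof.
move=> hf; rewrite !mevalE mulr_sumr; apply: eq_big_seq => m mf.
rewrite mulrCA; congr (_ * _); under eq_bigr do rewrite exprMn.
rewrite big_split /= prodrXr; congr (_ ^+ _ * _).
by rewrite -mdegE; apply: (dhomog_mf hf mf).
Qed.

Lemma vanishes_rep d (f : U) (x : P) : f \is d.-homog -> vanishes f x <-> f.@[rep x] = 0.
Proof.
move=> hf; split=> [h|f0 w]; first by apply: h; apply: memv_pick.
rewrite pt_line => /vlineP[a ->].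
rewrite (_ : f.@[_] = f.@[fun i => a * rep x i]); first by rewrite (homog_eval_scale _ _ hf) f0 mulr0.
by apply: meval_eq => i; rewrite mxE.
Qed.

Lemma pt_ideal_homog d (f : U) (x : P) : f \is d.-homog -> pt_ideal x f <-> f.@[rep x] = 0.
Proof.
move=> hf; rewrite -(vanishes_rep x hf); split=> [/(_ d)|h e]; first by rewrite pihomog_dE.
have [<-|ed] := eqVneq d e; first by rewrite pihomog_dE.
by rewrite (pihomog_ne0 ed hf) => w _; rewrite meval0.
Qed.

Lemma rep_distinct (x y : P) : x <> y -> nonprop (rep x) (rep y).
Proof.
move=> xy; apply: contrapT => h; apply: xy; apply: val_inj => /=.
have [c xc] := rep_neq0 x.
have yE : vpick (sval y) = (rep y c / rep x c) *: vpick (sval x).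
  apply/rowP => i; rewrite mxE -/(rep x i) -/(rep y i).
  have e : rep x c * rep y i = rep x i * rep y c.
    by apply/eqP; apply: contrapT => e; apply: h; exists c, i; apply/negP.
  by apply: (mulfI xc); rewrite e mulrA [rep x c * _]mulrC divfK // mulrC.
apply/esym/eqP; rewrite eqEdim (eqP (valP x)) (eqP (valP y)) leqnn andbT.
by rewrite (pt_line y) yE -memvE memvZ // memv_pick.
Qed.

Lemma nonprop_separated p q (l : U) : (exists c, p c != 0) -> l \is 1.-homog ->
  l.@[p] = 0 -> l.@[q] != 0 -> nonprop p q.
Proof.
move=> [c pc] hl l0 lq; apply: contrapT => h; case/eqP: lq.
have qE i : q i = (q c / p c) * p i.
  have e : p c * q i = p i * q c.
    by apply/eqP; apply: contrapT => e; apply: h; exists c, i; apply/negP.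
  by apply: (mulfI pc); rewrite e mulrA [p c * _]mulrC divfK // mulrC.
by rewrite (meval_eq l qE) (homog_eval_scale _ _ hl) l0 mulr0.
Qed.

Lemma zero_locus_proper d (f : U) : f \is d.-homog -> f != 0 ->
  zariski_closed [set x : P | vanishes f x] /\ [set x : P | vanishes f x] <> setT.
Proof.
move=> hf f0; split.
  exists [set f]; split=> [_ ->|]; first by exists d.
  by apply/seteqP; split=> x /= h => [g ->//|]; apply: h.
have [|p] := @exists_nonroot k t.+1 (f * 'X_ord0).
  by rewrite mulf_neq0 // -msize_poly_eq0 msizeX.
rewrite mevalM mevalXU mulf_eq0 negb_or => /andP[fp p0] ZT.
have dim1 : \dim <[\row_i p i]> == 1%N.
  rewrite dim_vline; suff -> : \row_i p i != 0 by [].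
  by apply: contraNneq p0 => /matrixP/(_ 0 ord0); rewrite !mxE => ->.
have : [set x : P | vanishes f x] (exist _ <[\row_i p i]>%VS dim1) by rewrite ZT.
move=> /(_ (\row_i p i) (memv_line _)); rewrite (_ : f.@[_] = f.@[p]); first exact/eqP.
by apply: meval_eq => i; rewrite mxE.
Qed.

Section Orbit.
Variables (phi : proj_aut k t) (c : P) (Phi : gr_aut k t.+1).
Hypothesis hPhi : lifts Phi phi.
Hypothesis hcd : critical_density_condition phi c.

Let Psi := gr_aut_inv Phi.
Let PsiK : cancel Psi Phi := gr_invK Phi.
Let PhiK : cancel Phi Psi := gr_autK Phi.

Definition fwd_orbit (i : nat) : 'I_t.+1 -> k := fun l => (twn (gr_aut_inv Phi) i 'X_l).@[rep c].
Definition bwd_orbit (i : nat) : 'I_t.+1 -> k := fun l => (twn Phi i.+1 'X_l).@[rep c].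

Lemma fwd_orbit_eval i f : f.@[fwd_orbit i] = (twn Psi i f).@[rep c].
Proof. exact: (lrmorph_eval (twn Psi i)). Qed.

Lemma bwd_orbit_eval i f : f.@[bwd_orbit i] = (twn Phi i.+1 f).@[rep c].
Proof. exact: (lrmorph_eval (twn Phi i.+1)). Qed.

Lemma pt_ideal_fwd i (x : P) f : pt_ideal (iter i (pa_inv phi) x) f <-> pt_ideal x (twn Psi i f).
Proof.
elim: i f => [//|i IH] f; rewrite twnSr -IH /=.
set y := iter _ _ _; have : pt_ideal y = Phi @^-1` pt_ideal (pa_inv phi y).
  by rewrite -{1}[y](pa_invK phi) hPhi.
by move->; rewrite /preimage /= PsiK.
Qed.

Lemma pt_ideal_bwd i (x : P) f : pt_ideal (iter i phi x) f <-> pt_ideal x (twn Phi i f).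
Proof.
elim: i f => [//|i IH] f; rewrite twnSr -IH /=.
by rewrite hPhi.
Qed.

Lemma fwd_orbit_zero d i f : f \is d.-homog -> f.@[fwd_orbit i] = 0 <-> f.@[rep (orbit_pt phi c i)] = 0.
Proof.
move=> hf; rewrite fwd_orbit_eval -(pt_ideal_homog _ hf) /= pt_ideal_fwd.
by rewrite (pt_ideal_homog c (twn_homog Psi i hf)).
Qed.

Lemma bwd_orbit_zero d i f : f \is d.-homog ->
  f.@[bwd_orbit i] = 0 <-> f.@[rep (orbit_pt phi c (Negz i))] = 0.
Proof.
move=> hf; rewrite bwd_orbit_eval -(pt_ideal_homog _ hf).
by rewrite -[orbit_pt _ _ _]/(iter i.+1 phi c) pt_ideal_bwd (pt_ideal_homog c (twn_homog Phi i.+1 hf)).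
Qed.

(** Half of the orbit, enumerated by [e]. The vectors [w i] need not be the chosen
    representatives of its points: it is enough that the same forms vanish at them. *)
Lemma half_orbit_data (F : gr_aut k t.+1) (w : nat -> 'I_t.+1 -> k) (e : nat -> int) :
  (forall i f, (F f).@[w i.+1] = f.@[w i]) -> injective e ->
  (forall d i f, f \is d.-homog -> f.@[w i] = 0 <-> f.@[rep (orbit_pt phi c (e i))] = 0) ->
  orbit_data F w.
Proof.
move=> hw einj wE; have [oinj [_ dense]] := hcd; split=> // [i j ij|d f hf f0].
  have [|l [hl l0 lN]] := separating_linform (@rep_distinct (orbit_pt phi c (e i)) (orbit_pt phi c (e j)) _).
    by move=> /oinj/einj; apply/eqP.
  apply: (@nonprop_separated _ _ l) => //; last first.
  - by apply: contraNneq lN => /(wE _ _ _ hl)/eqP.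
  - exact/(wE _ _ _ hl).
  have [b wb] := rep_neq0 (orbit_pt phi c (e i)); exists b; apply: contraNneq wb => w0.
  apply/eqP; rewrite -(mevalXU (rep _) b); apply/(wE _ _ _ (dhomogX1 k b)).
  by rewrite mevalXU.
have [cl pr] := zero_locus_proper hf f0.
have fin := dense _ cl pr.
have : finite_set [set i : nat | f.@[w i] = 0].
  apply: (@sub_finite_set _ _ ((orbit_pt phi c \o e) @^-1` (range (orbit_pt phi c) `&` [set x | vanishes f x]))).
    move=> i /(wE _ _ _ hf) f0i; split; first by exists (e i).
    exact/(vanishes_rep _ hf).
  apply: finite_preimage fin => i j _ _ /oinj; exact: einj.
case/finite_seqP => s sE; exists (\max_(x <- s) x).+1 => i si.
apply/eqP => fi; have : i \in s by have : [set` s] i by rewrite -sE.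
by move=> is_; have := @leq_bigmax_seq _ s xpredT (fun x => x) i is_ isT; rewrite leqNgt si.
Qed.

Theorem orbit_bi_orbit : bi_orbit Phi Psi fwd_orbit bwd_orbit.
Proof.
split.
- apply: (@half_orbit_data _ _ Posz); last by move=> d i f; apply: fwd_orbit_zero.
    move=> i f; rewrite !fwd_orbit_eval twnSr.
    by rewrite PhiK.
  by move=> i j [].
- apply: (@half_orbit_data _ _ Negz); last by move=> d i f; apply: bwd_orbit_zero.
    move=> i f; rewrite !bwd_orbit_eval (twnSr Phi i.+1).
    by rewrite PsiK.
  by move=> i j [].
- exact: PhiK.
- exact: PsiK.
- by move=> f; rewrite fwd_orbit_eval bwd_orbit_eval.
Qed.

Lemma fwd_orbit0 f : f \is 1.-homog -> vanishes f c <-> f.@[fwd_orbit 0] = 0.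
Proof. by move=> hf; rewrite (vanishes_rep c hf) fwd_orbit_eval. Qed.

End Orbit.
End Representatives.

(** * Graded free resolutions *)

Section FreegLift.
Variables (A : nzRingType) (G : choiceType) (M : lmodType A) (f : G -> M).
Implicit Types (x : {freeg G / A}).

Lemma fglift_add x y : fglift f (x + y) = fglift f x + fglift f y.
Proof.
have B := @lift_is_additive A G M f.
have L0 : fglift f 0 = 0 by rewrite -(subrr 0) B subrr.
have LN z : fglift f (- z) = - fglift f z by rewrite -sub0r B L0 sub0r.
by rewrite -{1}[y]opprK B LN opprK.
Qed.

Lemma fglift_expand x : fglift f x = \sum_(g <- dom x) coeff g x *: f g.
Proof.
rewrite -{1}[x]freeg_sumE (big_morph _ fglift_add (_ : fglift f 0 = 0)).
  by apply: eq_bigr => g _; rewrite liftU.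
by apply: (addrI (fglift f 0)); rewrite -fglift_add !addr0.
Qed.

Lemma fglift_linear : linear (fglift f).
Proof.
move=> a x y; rewrite fglift_add; congr (_ + _).
rewrite [in RHS]fglift_expand scaler_sumr.
have L0 : fglift f 0 = 0 by apply: (addrI (fglift f 0)); rewrite -fglift_add !addr0.
rewrite -[a *: x]/(\sum_(g <- dom x) << a * coeff g x *g g >>).
rewrite (big_morph _ fglift_add L0).
by apply: eq_bigr => g _; rewrite liftU scalerA.
Qed.

Lemma freeg_scaleE (a : A) g : << a *g g >> = a *: << 1 *g g >> :> {freeg G / A}.
Proof. by apply/eqP/freeg_eqP => h; rewrite coeffZ !coeffU mul1r. Qed.

Lemma freeg_expand x : x = \sum_(g <- dom x) coeff g x *: << 1 *g g >>.
Proof. by rewrite -{1}[x]freeg_sumE; apply: eq_bigr => g _; rewrite freeg_scaleE. Qed.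

Lemma fglift_gen g : fglift f << 1 *g g >> = f g.
Proof. by rewrite liftU scale1r. Qed.

End FreegLift.

Section GradedModules.
Variables (k : fieldType) (A : grAlg k).

Lemma linear_map_lincomb (M N : lmodType A) (f : M -> N) I (r : seq I) (a : I -> A) (x : I -> M) :
  linear f -> f (\sum_(i <- r) a i *: x i) = \sum_(i <- r) a i *: f (x i).
Proof.
move=> fL; have f0 : f 0 = 0 by have := fL (-1) 0 0; rewrite scaleN1r addNr scaleN1r addNr.
by elim: r => [|i r IH]; rewrite ?big_nil // !big_cons fL IH.
Qed.

Lemma linear_map0 (M N : lmodType A) (f : M -> N) : linear f -> f 0 = 0.
Proof. by move=> fL; have := fL (-1) 0 0; rewrite scaleN1r addNr scaleN1r addNr. Qed.

Lemma linear_mapB (M N : lmodType A) (f : M -> N) x y : linear f -> f (x - y) = f x - f y.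
Proof. by move=> fL; rewrite addrC -scaleN1r fL scaleN1r addrC. Qed.

Lemma linear_map_sum (M N : lmodType A) (f : M -> N) I (r : seq I) (x : I -> M) :
  linear f -> f (\sum_(i <- r) x i) = \sum_(i <- r) f (x i).
Proof.
move=> fL; have := linear_map_lincomb r (fun=> 1) x fL.
by under eq_bigr do rewrite scale1r; move->; apply: eq_bigr => i _; rewrite scale1r.
Qed.

(** The degree [d] is listed even when the component of this degree is zero. *)
Lemma homogeneous_component (M : grMod A) (x : M) (d : int) : exists y : int -> M,
  (forall i, gm_deg i (y i)) /\ exists2 r : seq int, uniq r /\ d \in r & x = \sum_(i <- r) y i.
Proof.
have [_ /(_ x)[s [hs ->]] _] := gm_grading M.
have [|r [y [ur _ Dy ->]]] := grading_collect (gm_grading M) (P := xpredT) (s := s).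
  by move=> z /hs[i Di]; exists i.
have [dr|dr] := boolP (d \in r); first by exists y; split=> //; exists r.
exists (fun i => if i == d then 0 else y i); split.
  by move=> i; case: eqP => // _; apply: grading0 (gm_grading M) _.
exists (d :: r); first by rewrite /= dr mem_head.
rewrite big_cons eqxx add0r; apply: eq_big_seq => i ir.
by case: eqP => // id; rewrite -id ir in dr.
Qed.

Lemma homogeneous_lift (M N : grMod A) (f : M -> N) (d : int) (x : M) :
  is_grHom f -> gm_deg d (f x) -> exists2 y, gm_deg d y & f y = f x.
Proof.
move=> [fL fD] dfx; have [y [Dy [r [ur dr] xE]]] := homogeneous_component x d.
exists (y d) => //; apply/eqP; rewrite -subr_eq0; apply/eqP.
have [gB _ gI] := gm_grading N.
have := gI r (fun i => if i == d then f (y d) - f x else f (y i)) ur.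
move=> /(_ _ _ d dr); rewrite eqxx; apply.
  by move=> i; case: eqP => [->|_]; [case: (gB d) => _; apply=> //; apply: fD|apply: fD].
rewrite (big_rem d dr) /= eqxx xE (linear_map_sum _ _ fL) (big_rem d dr) /= opprD addrA subrr sub0r.
rewrite addrC; apply/eqP; rewrite subr_eq0; apply/eqP.
by apply: eq_big_seq => i; rewrite mem_rem_uniq // inE => /andP[/negPf->].
Qed.

Lemma kernel_homogeneous (M N : grMod A) (f : M -> N) (x : M) : is_grHom f -> f x = 0 ->
  exists2 s : seq M, forall y, y \in s -> f y = 0 /\ exists d, gm_deg d y & x = \sum_(y <- s) y.
Proof.
move=> [fL fD] fx; have [y [Dy [r [ur _] xE]]] := homogeneous_component x 0.
exists (map y r); last by rewrite big_map.
move=> _ /mapP[i ir ->]; split; last by exists i.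
have [_ _ gI] := gm_grading N; apply: (gI r (fun i => f (y i))) => // [j|].
  exact: fD.
by rewrite -(linear_map_sum _ _ fL) -xE.
Qed.

Definition reg_deg (m : int) : set A^o :=
  match m with Posz d => ga_deg d | Negz _ => [set 0] end.

Lemma reg_deg0 m : reg_deg m 0.
Proof. by case: m => [d|d] //; apply: grading0 (ga_grading A) d. Qed.

Lemma reg_grading : is_grading reg_deg.
Proof.
have [gB gS gI] := ga_grading A; split.
- move=> i; split; first exact: reg_deg0.
  by case: i => d x y; [case: (gB d) => _; apply | move=> -> ->; rewrite subr0].
- move=> x; have [s [hs ->]] := gS x; exists s; split=> // y /hs[d Dy].
  by exists (Posz d).
- move=> s x us Dx s0 i si; case: i si => d si; last by have := Dx (Negz d).
  pose s' := [seq `|j|%N | j <- s & (0 <= j)%R].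
  apply: (gI s' (fun j => x (Posz j))).
  + rewrite map_inj_in_uniq ?filter_uniq // => i j.
    by rewrite !mem_filter; case: i => // i; case: j => // j /= _ _ ->.
  + by move=> j; apply: (Dx (Posz j)).
  + rewrite big_map big_filter -[RHS]s0 big_mkcond; apply: eq_bigr => -[j|j] _ //=.
    by have := Dx (Negz j).
  + by apply/mapP; exists (Posz d); rewrite ?mem_filter.
Qed.

Lemma reg_act (n : nat) (m : int) (a : A) (x : A^o) :
  ga_deg n a -> reg_deg m x -> reg_deg (n%:Z + m) (a *: x).
Proof.
case: m => [m|m] Da; first exact: ga_mul.
by move=> ->; rewrite scaler0; apply: reg_deg0.
Qed.

Definition reg_mod : grMod A := GrMod reg_grading reg_act.

Lemma reg_mod_projective : is_grProjective reg_mod.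
Proof.
move=> M N g f hg surj [fL fD].
have [x0 x0E] := surj (f 1).
have [|m1 Dm1 m1E] := @homogeneous_lift M N g 0 x0 hg.
  by rewrite x0E; apply: (fD 0); apply: ga_one.
exists (fun x => x *: m1); split; first split.
- by move=> a x y; rewrite scalerDl scalerA.
- move=> [m|m] x; last by move=> ->; rewrite scale0r; apply: grading0 (gm_grading M) _.
  by move=> Dx; rewrite -[m%:Z]addr0; apply: gm_act.
move=> x; case: hg => gL _.
have := gL x m1 0; rewrite addr0 (linear_map0 gL) addr0 => ->; rewrite m1E x0E.
have := fL x 1 0; rewrite addr0 (linear_map0 fL) addr0 => <-; congr f.
by rewrite -[RHS]mulr1.
Qed.

Section Free.
Variables (G : choiceType) (dg : G -> int).

Definition free_deg (m : int) : set {freeg G / A} :=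
  [set x | forall g, reg_deg (m - dg g) (coeff g x)].

Lemma free_grading : is_grading free_deg.
Proof.
have [gB gS gI] := reg_grading; split.
- move=> i; split=> [g|x y Dx Dy g]; first by rewrite coeff0; apply: reg_deg0.
  by rewrite coeffB; case: (gB (i - dg g)) => _; apply; [apply: Dx|apply: Dy].
- move=> x; rewrite -{1}[x]freeg_sumE; elim: (dom x) => [|g r [s [hs sE]]].
    by exists [::]; split=> //; rewrite !big_nil.
  have [u [hu uE]] := gS (coeff g x).
  exists ([seq << (y : A) *g g >> | y <- u] ++ s); split.
    move=> z; rewrite mem_cat => /orP[/mapP[y /hu[i Di] ->]|/hs//].
    exists (i + dg g) => h; rewrite coeffU; have [<-|_] := eqVneq g h.
      by rewrite mulr1 addrK.
    by rewrite mulr0; apply: reg_deg0.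
  rewrite big_cons big_cat big_map sE; congr (_ + _); rewrite {1}uE.
  elim: (u) => [|y v IH]; rewrite ?big_nil ?big_cons ?freegU0 //.
  by rewrite -freegUD IH.
- move=> s x us Dx s0 i si; apply/eqP/freeg_eqP => g; rewrite coeff0.
  have := gI [seq j - dg g | j <- s] (fun j => coeff g (x (j + dg g))).
  move=> /(_ _ _ _ (i - dg g)); rewrite subrK; apply.
  + by rewrite map_inj_uniq // => j1 j2 /addIr.
  + by move=> j; have := Dx (j + dg g) g; rewrite addrK.
  + rewrite big_map -[RHS](coeff0 A g) -s0 raddf_sum; apply: eq_bigr => j _.
    by rewrite subrK.
  + exact: map_f.
Qed.

Lemma free_act (n : nat) (m : int) (a : A) (x : {freeg G / A}) :
  ga_deg n a -> free_deg m x -> free_deg (n%:Z + m) (a *: x).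
Proof. by move=> Da Dx g; rewrite coeffZ -addrA; apply: reg_act. Qed.

Definition free_mod : grMod A := GrMod free_grading free_act.

Lemma free_gen_deg g : gm_deg (dg g) (<< 1 *g g >> : free_mod).
Proof.
move=> h; rewrite coeffU; have [<-|_] := eqVneq g h; last by rewrite mulr0; apply: reg_deg0.
by rewrite mulr1 subrr; apply: ga_one.
Qed.

Lemma fglift_grHom (M : grMod A) (f : G -> M) : (forall g, gm_deg (dg g) (f g)) ->
  is_grHom (fglift f : free_mod -> M).
Proof.
move=> hf; split; first exact: fglift_linear.
move=> m x Dx; have gM := gm_grading M; rewrite fglift_expand; apply: big_ind.
- exact: grading0 gM m.
- by move=> y z; apply: gradingD gM _ _ _.
move=> g _; have := Dx g; case E: (m - dg g) => [p|p]; last first.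
  by move=> ->; rewrite scale0r; apply: grading0 gM m.
by move=> Da; rewrite -[m](subrK (dg g)) E; apply: gm_act.
Qed.

Lemma free_mod_projective : is_grProjective free_mod.
Proof.
move=> M N g f hg surj [fL fD].
have /choice[l hl] : forall x : G, exists m : M, gm_deg (dg x) m /\ g m = f << 1 *g x >>.
  move=> x; have [m mE] := surj (f << 1 *g x >>).
  have [|y Dy yE] := @homogeneous_lift M N g (dg x) m hg; last by exists y; rewrite yE.
  by rewrite mE; apply: fD; apply: free_gen_deg.
exists (fglift l); split; first by apply: fglift_grHom => x; case: (hl x).
move=> x; rewrite fglift_expand; case: hg => gL _.
rewrite (linear_map_lincomb _ _ _ gL) [in RHS](freeg_expand x) (linear_map_lincomb _ _ _ fL).
by apply: eq_bigr => y _; case: (hl y) => _ ->.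
Qed.

End Free.

(** The free module on the homogeneous elements of the kernel of [f], mapped onto
    this kernel. All pairs of a degree and an element serve as indices, with the
    irrelevant ones mapped to zero. *)
Section Cover.
Variables (M N : grMod A) (f : M -> N).
Hypothesis hf : is_grHom f.

Definition cover_gen (g : int * M) : M := if `[< gm_deg g.1 g.2 /\ f g.2 = 0 >] then g.2 else 0.

Definition kernel_cover : grMod A := @free_mod (int * M)%type fst.

Definition cover_map : kernel_cover -> M := fglift cover_gen.

Lemma cover_gen_deg g : gm_deg g.1 (cover_gen g).
Proof. by rewrite /cover_gen; case: asboolP => [[]//|_]; apply: grading0 (gm_grading M) _. Qed.

Lemma cover_map_grHom : is_grHom cover_map.
Proof. by apply: fglift_grHom => g; apply: cover_gen_deg. Qed.

Lemma cover_exact x : f x = 0 <-> exists y, cover_map y = x.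
Proof.
have fL := hf.1; split=> [fx|[y <-]].
  have [s hs ->] := kernel_homogeneous hf fx; elim: s hs => [|y s IH] hs.
    by exists 0; rewrite big_nil (linear_map0 (proj1 cover_map_grHom)).
  have [z zE] := IH (fun y ys => hs y (mem_behead (s := _ :: s) ys)).
  have [fy [d Dy]] := hs y (mem_head _ _).
  exists (1 *: << 1 *g (d, y) >> + z).
  rewrite (proj1 cover_map_grHom) zE big_cons scale1r; congr (_ + _).
  by rewrite /cover_map fglift_gen /cover_gen; case: asboolP => // -[].
rewrite /cover_map fglift_expand (linear_map_lincomb _ _ _ fL) big1 // => g _.
by rewrite /cover_gen; case: asboolP => [[_ ->]|_]; rewrite ?(linear_map0 fL) scaler0.
Qed.

End Cover.

Record gr_map := GrMap {
  gr_src : grMod A;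
  gr_tgt : grMod A;
  gr_fun :> gr_src -> gr_tgt;
  gr_homP : is_grHom gr_fun
}.

Definition next_map (f : gr_map) : gr_map := GrMap (cover_map_grHom f).

Definition augmentation : reg_mod -> triv_mod A := @triv_pi k A.

Lemma augmentation_grHom : is_grHom augmentation.
Proof.
split=> [a x y|[m|m] x].
- by rewrite /augmentation triv_piD; congr (_ + _); apply/esym/triv_scale_pi.
- by move=> Dx; left; exists m, x.
- by move=> ->; right; rewrite /augmentation triv_pi0E.
Qed.

Definition res_map i : gr_map := iter i next_map (GrMap augmentation_grHom).

Definition free_resolution : grResolution (triv_mod A).
Proof.
refine (@GrResolution k A (triv_mod A) (fun i => gr_src (res_map i))
  (fun i => @gr_fun (res_map i.+1)) augmentation _ _ augmentation_grHom _ _ _).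
- case=> [|i]; [exact: reg_mod_projective|exact: free_mod_projective].
- by move=> i; apply: (gr_homP (res_map i.+1)).
- by move=> y; have [a ->] := triv_pi_surj y; exists a.
- exact: (cover_exact augmentation_grHom).
- by move=> i; apply: (cover_exact (gr_homP (res_map i.+1))).
Defined.

(** Finitely many families with finite support are zero in some degree [i], where a
    class concentrated in degree [i] would have to vanish. *)
Lemma not_chi_of_nonzero_ext j (M : grMod A) (P : grResolution (triv_mod A)) :
  is_grNoetherian M ->
  (forall i : nat, exists2 f, @cocycle k A _ P j (shift M i%:Z) f &
     ~ @coboundary k A _ P j (shift M i%:Z) f) ->
  ~ chi A j.
Proof.
move=> nM ext /(_ j M (leqnn j) nM P)[s [hs H]].
have [N hN] : exists N : nat, forall x, x \in s -> forall i, (N <= i)%N -> x i%:Z = 0.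
  elim: s hs {H} => [|x s IH] hs; first by exists 0%N.
  have [N hN] := IH (fun y ys => hs y (mem_behead (s := x :: s) ys)).
  have [fx _] := hs x (mem_head _ _).
  have : finite_set [set i : nat | x i%:Z <> 0].
    by apply: (finite_preimage _ fx) => i i' _ _ [].
  case/finite_seqP => r rE; exists (maxn N (\max_(i <- r) i).+1) => y.
  rewrite inE => /predU1P[->|ys] i; rewrite geq_max => /andP[Ni ri]; last exact: hN ys _ Ni.
  apply: contrapT => xi; have ir : i \in r by have : [set` r] i by rewrite -rE.
  by have := @leq_bigmax_seq _ r xpredT (fun x => x) i ir isT; rewrite leqNgt ri.
have [f cf ncf] := ext N.
pose z : int -> res_obj P j -> M := fun i => if i == N%:Z then f else fun=> 0.
have [|a [_ /(_ N%:Z)]] := H z.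
  split.
    apply: (@sub_finite_set _ _ [set N%:Z]); last exact: finite_set1.
    by move=> i; rewrite /z /=; case: eqP.
  move=> i; rewrite /z; case: eqP => [->//|_]; split=> //; split.
    by move=> b x y; rewrite scaler0 addr0.
  by move=> m x _; apply: grading0 (gm_grading (shift M i)) m.
suff -> : (z - \sum_(i < size s) (a i)%:A *: s`_i) N%:Z = f by [].
suff E : (\sum_(i < size s) (a i)%:A *: s`_i) N%:Z = 0.
  rewrite -[LHS]/(z N%:Z - (\sum_(i < size s) (a i)%:A *: s`_i) N%:Z) E subr0.
  by rewrite /z eqxx.
elim/big_ind: _ => [//|x y ex ey|i _].
  by rewrite -[LHS]/(x N%:Z + y N%:Z) ex ey addr0.
rewrite -[LHS]/((a i)%:A *: s`_i N%:Z) (hN _ _ N) ?scaler0 //.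
by apply: mem_nth.
Qed.

End GradedModules.

(** * Failure of the chi condition *)

Section TwistModule.
Variables (k : fieldType) (t : nat) (Phi : gr_aut k t.+1) (c : pt k t).
Local Notation A := (Ralg Phi c).
Local Notation S := (twist_grAlg Phi).

(** The argument records which subalgebra acts on the twisted algebra. *)
Definition twist_module (_ : pt k t) : Type := S.
HB.instance Definition _ := GRing.Zmodule.on (twist_module c).

Definition twist_scale (a : A) (x : twist_module c) : twist_module c := (\val a : S) * (x : S).

Lemma twist_scaleA a b x : twist_scale a (twist_scale b x) = twist_scale (a * b) x.
Proof.
have e : (\val (a * b) : S) = \val a * \val b := rmorphM _ a b.
by rewrite /twist_scale e; apply: (mulrA (\val a : S) (\val b) x).
Qed.

Lemma twist_scale1 : left_id 1 twist_scale.
Proof. exact: mul1r. Qed.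

Lemma twist_scaleDr : right_distributive twist_scale +%R.
Proof. by move=> a x y; apply: mulrDr. Qed.

Lemma twist_scaleDl x : {morph twist_scale^~ x : a b / a + b}.
Proof. by move=> a b; apply: mulrDl. Qed.

HB.instance Definition _ := GRing.Zmodule_isLmodule.Build A (twist_module c)
  twist_scaleA twist_scale1 twist_scaleDr twist_scaleDl.

End TwistModule.

Section Cocycle.
Variables (k : closedFieldType) (t : nat) (Phi Psi : gr_aut k t.+1) (v v' : nat -> 'I_t.+1 -> k).
Variable c : pt k t.
Hypothesis bo : bi_orbit Phi Psi v v'.
Hypothesis vc : forall f : {mpoly k[t.+1]}, f \is 1.-homog -> vanishes f c <-> f.@[v 0%N] = 0.
Hypothesis ht : (2 <= t)%N.
Local Notation U := {mpoly k[t.+1]}.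
Local Notation S := (twist_grAlg Phi).
Local Notation A := (Ralg Phi c).
Local Notation Smod := (@twist_module k t Phi c).

Let od : orbit_data Phi v := bo_left bo.

Lemma cmp_mul_homog m d (x : S) (f : U) : f \is d.-homog ->
  cmp m (x * (f : S)) = if (d <= m)%N then twn Phi d (cmp (m - d) x) * f else 0.
Proof.
move=> hf; have -> : x * (f : S) = (twn Phi d (x : U) * f : U) :> S by apply: twist_mul_homogE.
case: leqP => [dm|md]; first by rewrite /cmp (pihomog_mulr _ hf) // pihomog_twn.
have -> : twn Phi d (x : U) * f = \sum_(i < msize (x : U)) twn Phi d (cmp i x) * f.
  by rewrite {1}(cmp_expand (leqnn (msize (x : U)))) raddf_sum mulr_suml.
rewrite /cmp raddf_sum big1 // => i _.
apply: (@pihomog_ne0 _ _ _ (i + d)%N); first by rewrite neq_ltn (leq_trans md) ?orbT ?leq_addl.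
by apply: dhomogM => //; apply: twn_homog; apply: cmp_homog.
Qed.

Variables (l : 'I_t.+1) (i : nat) (sig : nat -> U).
Hypothesis sig_homog : forall m, sig m \is m.-homog.
Hypothesis sig1 : forall m, (sig m).@[v i] = 1.
Hypothesis sig0 : forall m j, (j < m)%N -> j != i -> (sig m).@[v j] = 0.

Let lam (f : U) : k := (f^`M(l)).@[v 0%N].

Let lamD f g : lam (f + g) = lam f + lam g.
Proof. by rewrite /lam mderivD mevalD. Qed.

Let lam0 : lam 0 = 0.
Proof. by rewrite /lam mderiv0 meval0. Qed.

Let lamM f g : g.@[v 0%N] = 0 -> lam (f * g) = f.@[v 0%N] * lam g.
Proof. by move=> g0; rewrite /lam mderivM mevalD !mevalM g0 mulr0 add0r. Qed.

Let d0 := @augmentation k A.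
Let d1 := cover_map d0.
Let tg := cover_gen d0.
Let P1 := kernel_cover (reg_mod A).

Lemma tg_facts (g : int * reg_mod A) :
  tg g = 0 \/ exists N, [/\ g.1 = N.+1%:Z, Rn v N.+1 (\val (tg g : A)) & (\val (tg g : A) : U).@[v 0%N] = 0].
Proof.
rewrite /tg /cover_gen; case: asboolP => [[Dg g0]|_]; last by left.
case: g Dg g0 => -[[|N]|N] y /= Dy y0; last by left.
  left; exact: (@ga_deg0_ge1 _ A y Dy (proj1 (triv_pi0 (y : A)) y0)).
right; exists N; have Ry := Ralg_val_Rset bo vc y N.+1.
have hy : (\val (y : A) : U) \is N.+1.-homog by exact: Dy.
rewrite cmp_id // in Ry; split=> //; exact: (proj2 Ry).
Qed.

(** Evaluation at [c_i] defines a quotient of [S / R] that is a truncated point module. A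
    tangent vector at [c_0], here the derivative [lam], extends it by one dimension in degree [i],
    because the derivative of a product with second factor vanishing at [c_0] is the value of
    the first factor times the derivative of the second. This extension is a map from the augmentation ideal to the point
    module; [Theta] lifts it to a map from the free module [P1] to [S]. The form [sig m] is
    chosen to have value 1 at [c_i] and to vanish at the other points that matter. *)
Definition lift_gen (g : int * reg_mod A) : Smod :=
  lam (\val (tg g : A) : U) *: (sig (`|g.1|%N + i)%N : S).

Definition Theta : P1 -> Smod := fglift lift_gen.

Lemma lift_gen_homog g : (lift_gen g : U) \is (`|g.1| + i)%N.-homog.
Proof. by apply: rpredZ; apply: sig_homog. Qed.

Lemma ThetaE x : Theta x = \sum_(g <- dom x) (\val (coeff g x : A) : S) * (lift_gen g : S).
Proof. exact: fglift_expand. Qed.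

Lemma val_d1E x : (\val (d1 x : A) : S) =
  \sum_(g <- dom x) (\val (coeff g x : A) : S) * \val (tg g : A).
Proof.
rewrite /d1 /cover_map fglift_expand raddf_sum; apply: eq_bigr => g _.
exact: rmorphM.
Qed.

(** At the other points one of the factors of each term vanishes. At [c_i] the value of
    [Theta x] is the derivative at [c_0] of [d1 x], because [d1 x] is a sum of products
    with second factor vanishing at [c_0]. *)
Lemma Theta_Rset x : d1 x = 0 -> Rset v (Theta x : S).
Proof.
move=> dx m; split=> [|j jm]; first exact: cmp_homog.
rewrite ThetaE cmp_sum raddf_sum /=.
under eq_bigr => g _ do rewrite (cmp_mul_homog _ _ (lift_gen_homog g)).
have [jE|ji] := eqVneq j i; last first.
  rewrite big1 // => g _; case: leqP => [gm|_]; last exact: meval0.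
  rewrite mevalM; have [jg|gj] := ltnP j (`|g.1|%N + i)%N.
    by rewrite mevalZ sig0 ?mulr0.
  rewrite -(subnKC gj) (twn_eval od).
  have [_ ->] := Ralg_val_Rset bo vc (coeff g x : A) (m - (`|g.1|%N + i))%N; first by rewrite mul0r.
  by rewrite ltn_sub2r // (leq_ltn_trans gj).
rewrite jE; transitivity (lam (cmp (m - i) (\val (d1 x : A) : S))); last first.
  by rewrite dx raddf0 cmp0 lam0.
rewrite val_d1E cmp_sum (big_morph _ lamD lam0); apply: eq_bigr => g _.
have [tg0|[N [gN [hg _] g0]]] := tg_facts g.
  rewrite /lift_gen tg0 raddf0 lam0 scale0r mulr0.
  by case: ifP => _; rewrite ?mulr0 ?cmp0 ?lam0 meval0.
rewrite (cmp_mul_homog _ _ hg) gN absz_nat [(N.+1 + i)%N]addnC.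
have -> : (i + N.+1 <= m)%N = (N.+1 <= m - i)%N by rewrite leq_subRL // ltnW // -jE.
case: (N.+1 <= m - i)%N; last by rewrite meval0 lam0.
rewrite lamM // mevalM mevalZ sig1 mulr1; congr (_ * _).
have := twn_eval od i 0 (twn Phi N.+1 (cmp (m - i - N.+1)%N (\val (coeff g x : A) : S))).
by rewrite addn0 -twnD subnDA => ->.
Qed.

(** The degree is an integer, as in graded modules. *)
Definition pieces_int (z : int) : set S :=
  match z with Posz d => [set f | (f : U) \is d.-homog] | Negz _ => [set 0] end.

Lemma Theta_deg m x : gm_deg m x -> pieces_int (i%:Z + m) (Theta x : S).
Proof.
move=> Dx; have P0 z : pieces_int z 0 by case: z => // d; apply: rpred0.
have PD z f g : pieces_int z f -> pieces_int z g -> pieces_int z (f + g).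
  by case: z => [d|d]; [apply: rpredD | move=> -> ->; rewrite addr0].
rewrite ThetaE; apply: big_ind => [|f g|g _]; [exact: P0|exact: PD|].
have [tg0|[N [gN _ _]]] := tg_facts g.
  by rewrite /lift_gen tg0 raddf0 lam0 scale0r mulr0; apply: P0.
have := Dx g; rewrite gN; case E: (m - N.+1%:Z) => [p|p]; last first.
  by move=> ->; rewrite raddf0 mul0r; apply: P0.
move=> Da; have -> : i%:Z + m = Posz (p + (N.+1 + i))%N.
  have -> : m = p%:Z + N.+1%:Z by rewrite -E subrK.
  by rewrite addrC -addrA -!PoszD.
have hg := lift_gen_homog g; rewrite gN in hg.
exact: (@ga_mul _ S _ _ _ _ Da hg).
Qed.

Let P := free_resolution A.

Let val_injA (x y : A) : (\val x : S) = \val y -> x = y.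
Proof. exact: val_inj. Qed.

Lemma Theta_linear : linear Theta.
Proof. exact: fglift_linear. Qed.

Lemma Theta_cocycle : exists2 f : res_obj P 2 -> reg_mod A,
  @cocycle k A _ P 2 (shift (reg_mod A) i%:Z) f & forall x, (\val (f x : A) : S) = Theta (res_d x).
Proof.
have /choice[f fE] : forall x : res_obj P 2, exists y : A, (\val y : S) = Theta (res_d x).
  move=> x; apply: (Ralg_of_Rset bo vc); apply: Theta_Rset.
  exact: (@res_exact k A _ P 0 (res_d x)).2 (ex_intro _ x erefl).
have [dL dD] := @res_d_hom k A _ P 1.
exists f; last exact: fE.
split; first split.
- move=> a x y; apply: (val_injA (x := f (a *: x + y)) (y := a * (f x : A) + (f y : A))).
  rewrite fE (dL a x y) (Theta_linear a (res_d x) (res_d y)).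
  rewrite raddfD /= -!fE; congr (_ + _).
- move=> m x /dD/Theta_deg; rewrite -fE => H; change (reg_deg (i%:Z + m) (f x)).
  move: H; case: (i%:Z + m) => [d|d] H; first exact: H.
  by apply: (val_injA (y := 0)); rewrite raddf0; apply: H.
move=> x; apply: (val_injA (y := 0)); rewrite fE raddf0.
have -> : res_d (res_d x) = 0 :> res_obj P 1.
  exact: (@res_exact k A _ P 1 (res_d x)).2 (ex_intro _ x erefl).
exact: (linear_map0 Theta_linear).
Qed.

(** On a Koszul relation [r1 y1 = r2 y2] the two values of a coboundary are multiples of
    [y2] and [y1], which contradicts that the derivative of [y1] does not vanish. *)
Lemma Theta_not_coboundary (Y1 Y2 : U) (f : res_obj P 2 -> reg_mod A) :
  Rn v 1 Y1 -> Rn v 1 Y2 -> Y1 != 0 -> (forall x, Y2 != x *: Y1) -> lam Y1 != 0 ->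
  (forall x, (\val (f x : A) : S) = Theta (res_d x)) ->
  ~ @coboundary k A _ P 2 (shift (reg_mod A) i%:Z) f.
Proof.
move=> RY1 RY2 Y10 Y21 lY1 fE [h [[hL hD] hE]].
have n3 : (3 <= t.+1)%N by rewrite ltnS.
(* With the factor [w], both sides of the Koszul relation have coefficients in the
   subalgebra. *)
have [w [hw w0 w1 w2]] := linform_through (v 2) n3 (v_neq0 od 1).
have koszul Y : Y \is 1.-homog -> exists2 r, Rn v 2 r & twn Phi 1 r = Y * w.
  move=> hY; apply: (Rn_twn od); first by rewrite -[2%N]/(1 + 1)%N; apply: dhomogM.
  move=> j j3; have [->|->] : j = 1%N \/ j = 2%N by lia.
    by rewrite mevalM w1 mulr0.
  by rewrite mevalM w2 mulr0.
have [hY1 y10] := RY1; have [hY2 y20] := RY2.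
have [r1 Rr1 r1E] := koszul Y2 hY2; have [r2 Rr2 r2E] := koszul Y1 hY1.
have lift m g : Rn v m g -> exists y : A, (\val y : S) = g.
  by move=> Rg; apply: (Ralg_of_Rset bo vc); apply: Rset_homog Rg.
have [y1 y1E] := lift _ _ RY1; have [y2 y2E] := lift _ _ RY2.
have [a1 a1E] := lift _ _ Rr1; have [a2 a2E] := lift _ _ Rr2.
pose e (y : A) : P1 := << 1 *g (1%:Z, y : reg_mod A) >>.
have tgE (y : A) Y : (\val y : S) = Y -> Rn v 1 Y -> tg (1%:Z, y : reg_mod A) = y.
  move=> yE [hY _]; have Dy : ga_deg 1%N y by rewrite /ga_deg /= /gen_deg /= yE.
  rewrite /tg /cover_gen; case: asboolP => //= -[]; split=> //.
  by apply/triv_pi0/asboolP; exists [:: y]; rewrite big_seq1; split=> // z; rewrite inE => /eqP->; exists 1%N.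
have d1e (y : A) Y : (\val y : S) = Y -> Rn v 1 Y -> d1 (e y) = y.
  by move=> yE RY; rewrite /d1 /cover_map fglift_gen; apply: tgE yE RY.
pose x : P1 := a1 *: e y1 - a2 *: e y2.
have d1L : linear d1 := (cover_map_grHom d0).1.
have dx : d1 x = 0.
  rewrite (linear_mapB _ _ d1L).
  have d1Z b y : d1 (b *: y) = b *: d1 y by have := d1L b y 0; rewrite !(linear_map0 d1L) !addr0.
  rewrite !d1Z (d1e _ _ y1E RY1) (d1e _ _ y2E RY2).
  have e1 : (\val (a1 * y1) : S) = (twn Phi 1 r1 * Y1 : U).
    by rewrite -(twist_mul_homogE (r1 : S) hY1) -a1E -y1E; apply: rmorphM.
  have e2 : (\val (a2 * y2) : S) = (twn Phi 1 r2 * Y2 : U).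
    by rewrite -(twist_mul_homogE (r2 : S) hY2) -a2E -y2E; apply: rmorphM.
  apply: (val_injA (x := a1 * y1 - a2 * y2) (y := 0)).
  transitivity ((\val (a1 * y1) : S) - \val (a2 * y2)); first exact: raddfB.
  have E : Y2 * w * Y1 = Y1 * w * Y2 by ring.
  by rewrite e1 e2 raddf0 r1E r2E E; apply: subrr.
have [z zE] := (@res_exact k A _ P 0 x).1 dx.
have hx : (\val (h x : A) : S) = Theta x.
  by have := fE z; rewrite (hE z) zE.
have eD y : gm_deg 1%:Z (e y) by apply: (@free_gen_deg k A _ fst (1%:Z, y : reg_mod A)).
have rho_Rn y : Rn v i.+1 (\val (h (e y) : A) : S).
  have := hD _ _ (eD y); rewrite -[gm_deg _ _]/(reg_deg (i%:Z + 1%:Z) (h (e y))).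
  rewrite -PoszD addn1 => H; rewrite -(cmp_id Phi (H : (\val (h (e y) : A) : U) \is i.+1.-homog)).
  exact: Ralg_val_Rset bo vc _ _.
pose X (y : A) : S := (lift_gen (1%:Z, y : reg_mod A) : S) - \val (h (e y) : A).
have X_homog y : (X y : U) \is i.+1.-homog.
  by apply: (@rpredB U); [apply: (lift_gen_homog (1%:Z, y : reg_mod A)) | apply: (rho_Rn y).1].
have XE : (r1 : S) * X y1 = (r2 : S) * X y2.
  have : (\val (h x : A) : S) = (r1 : S) * \val (h (e y1) : A) - (r2 : S) * \val (h (e y2) : A).
    rewrite (linear_mapB _ _ hL); have hZ b y : h (b *: y) = b *: h y.
      by have := hL b y 0; rewrite !(linear_map0 hL) !addr0.
    have e1 : (\val (a1 * (h (e y1) : A)) : S) = \val a1 * \val (h (e y1) : A) := rmorphM _ _ _.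
    have e2 : (\val (a2 * (h (e y2) : A)) : S) = \val a2 * \val (h (e y2) : A) := rmorphM _ _ _.
    rewrite !hZ -a1E -a2E -e1 -e2; exact: raddfB.
  rewrite hx (linear_mapB _ _ Theta_linear).
  have TZ b y : Theta (b *: e y) = (\val (b : A) : S) * lift_gen (1%:Z, y : reg_mod A) :> S.
    have := Theta_linear b (e y) 0; rewrite !(linear_map0 Theta_linear) !addr0 => ->.
    by rewrite /Theta fglift_gen.
  have subE (p q p' q' : S) : p - q = p' - q' -> p - p' = q - q'.
    move/eqP; rewrite subr_eq => /eqP->.
    by rewrite addrAC [p' - q' - p']addrAC subrr sub0r addrC.
  by rewrite !TZ a1E a2E /X !mulrBr; apply: subE.
pose L1 := twn Phi i Y1; pose L2 := twn Phi i Y2.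
have XE' : L2 * X y1 = L1 * (X y2 : U).
  have wn0 : twn Phi i w != 0 by rewrite twn_eq0.
  apply: (mulIf wn0); rewrite mulrAC -rmorphM /= -r1E -twnD addn1.
  rewrite mulrAC -rmorphM /= -r2E -twnD addn1.
  have := XE; rewrite (twist_mul_homogE (r1 : S) (X_homog y1)) (twist_mul_homogE (r2 : S) (X_homog y2)).
  exact.
have [q qE] : mdvd L1 (X y1).
  apply: (linform_prime (f := L2)); rewrite ?twn_homog ?twn_eq0 //; last by exists (X y2).
  move=> b; apply: contraNneq (Y21 b) => E; apply/eqP; apply: (@twn_inj _ _ Phi i).
  by rewrite linearZ.
have := congr1 (meval (v i)) qE; have L1v : L1.@[v i] = 0.
  by have := twn_eval od i 0 Y1; rewrite addn0 => ->; apply: y10.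
rewrite mevalM L1v mul0r (_ : (X y1 : U) = lam Y1 *: sig (1 + i)%N - (\val (h (e y1) : A) : S)).
  by rewrite mevalB mevalZ sig1 (rho_Rn y1).2 // subr0 mulr1; apply/eqP.
by rewrite /X /lift_gen (tgE _ _ y1E RY1) y1E.
Qed.

End Cocycle.

Section ChiFails.
Variables (k : closedFieldType) (t : nat) (Phi Psi : gr_aut k t.+1) (v v' : nat -> 'I_t.+1 -> k).
Variable c : pt k t.
Hypothesis bo : bi_orbit Phi Psi v v'.
Hypothesis vc : forall f : {mpoly k[t.+1]}, f \is 1.-homog -> vanishes f c <-> f.@[v 0%N] = 0.
Hypothesis ht : (2 <= t)%N.
Local Notation U := {mpoly k[t.+1]}.
Local Notation A := (Ralg Phi c).

Lemma reg_mod_noetherian : is_grNoetherian (reg_mod A).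
Proof.
have [lN _] := Ralg_noetherian bo vc.
move=> J hJ JS; apply: lN JS => n; have [J0 JL _] := hJ n; split=> // [x y Jx Jy|a x Jx].
  have <- : (-1 : A) * (y : A) + (x : A) = x - y by rewrite mulN1r addrC.
  exact: (JL (-1) y x Jy Jx).
by rewrite -[a * x]addr0; apply: (JL a x 0 Jx J0).
Qed.

Theorem Ralg_not_chi2 : ~ chi A 2.
Proof.
have od := bo_left bo; have n3 : (3 <= t.+1)%N by rewrite ltnS.
have [Y1 [Y2 [[h1 h2] [p1 p2] [Y10 Y21] _]]] := two_linforms n3 (v_neq0 od 0).
have [l lY] : exists l, Y1@_U_(l) != 0.
  apply: contrapT => nE; case/eqP: Y10; rewrite (linform_sum h1) big1 // => j _.
  by apply/eqP; rewrite mscalerI; apply/orP; left; apply: contrapT => /negP h; apply: nE; exists j.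
have lY1 : (Y1^`M(l)).@[v 0%N] != 0.
  rewrite {1}(linform_sum h1) (raddf_sum (mderiv l)) (raddf_sum (meval (v 0%N))) (bigD1 l) //= big1 => [|j jl].
    rewrite addr0 mderivZ mevalZ mderivX mnm1E eqxx mevalZ mul1r.
    have -> : (U_(l) - U_(l) = 0)%MM by apply/mnmP => j; rewrite mnmBE mnm0E subnn.
    by rewrite mpolyX0 meval1 mulr1.
  by rewrite mderivZ mevalZ mderivX mnm1E (negPf jl) mevalZ mul0r mulr0.
have R1 Y : Y \is 1.-homog -> Y.@[v 0%N] = 0 -> Rn v 1 Y.
  by move=> hY Y0; split=> // j; rewrite ltnS leqn0 => /eqP->.
apply: (not_chi_of_nonzero_ext (P := free_resolution A) reg_mod_noetherian) => i.
have /choice[sig hsig] : forall m, exists s : U, [/\ s \is m.-homog, s.@[v i] = 1 &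
    forall j, (j < m)%N -> j != i -> s.@[v j] = 0].
  move=> m; have [|||s [hs s1 s0]] := @separating_form _ _ v [seq j <- iota 0 m | j != i] i m.
  - by move=> j; rewrite mem_filter => /andP[ji _]; apply: (od_distinct od).
  - exact: v_neq0 od i.
  - by rewrite size_filter (leq_trans (count_size _ _)) // size_iota.
  by exists s; split=> // j jm ji; apply: s0; rewrite mem_filter ji mem_iota.
have s1 m : sig m \is m.-homog by case: (hsig m).
have s2 m : (sig m).@[v i] = 1 by case: (hsig m).
have s3 m j : (j < m)%N -> j != i -> (sig m).@[v j] = 0 by case: (hsig m) => _ _; apply.
have [f cf fE] := Theta_cocycle bo vc l s1 s2 s3.
exists f => //; exact: (Theta_not_coboundary bo vc ht s1 s2 (R1 _ h1 p1) (R1 _ h2 p2) Y10 Y21 lY1 fE).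
Qed.

End ChiFails.

Theorem theorem1p5 (k : closedFieldType) (t : nat) (ht : (2 <= t)%N)
    (phi : proj_aut k t) (c : pt k t)
    (Phi : gr_aut k t.+1) (hPhi : lifts Phi phi)
    (hcd : critical_density_condition phi c) :
  [/\ connected_gr (Ralg Phi c),
      fin_gen_deg1 (Ralg Phi c),
      is_maximal_order (Ralg Phi c) &
      forall i : nat, (2 <= i)%N -> ~ chi (Ralg Phi c) i].
Proof.
have bo := orbit_bi_orbit hPhi hcd.
have vc := @fwd_orbit0 k t c Phi.
split.
- exact: Ralg_connected.
- exact: Ralg_fin_gen bo vc.
- exact: Ralg_maximal_order bo vc ht.
- move=> i i2 hchi; apply: (Ralg_not_chi2 bo vc ht) => j M j2.
  by apply: hchi; apply: leq_trans i2.
Qed.
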